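(* Let $(A,\le_A)$ and $(A',\le_{A'})$ be quasi-hereditary $k$-algebras with exact Borel subalgebras $B\subseteq A$ and $B'\subseteq A'$. Equip $\operatorname{Sim}(A\otimes_k A')$ with the product order. Then $B\otimes_k B'$ is an exact Borel subalgebra of the quasi-hereditary algebra $A\otimes_k A'$. Moreover, $B\otimes_k B'$ is strong if and only if both $B$ and $B'$ are strong.
   Context: Conventions: $k$ is an algebraically closed field; all algebras are nonzero finite-dimensional associative unital $k$-algebras, subalgebras contain the unit, and modules are finitely generated left modules unless stated otherwise. $\operatorname{Sim}(A)$ is a set of representatives of the isomorphism classes of simple $A$-modules, and $P(L)$ is the projective cover of $L$. Quasi-hereditary algebras: for a partial order $\le_A$ on $\operatorname{Sim}(A)$ and $L\in\operatorname{Sim}(A)$, the standard module is $\Delta(L)=P(L)/\sum_{L'\not\le_A L,\ f\in\operatorname{Hom}_A(P(L'),P(L))}\operatorname{im}(f)$. The pair $(A,\le_A)$ is quasi-hereditary if for every $L\in \operatorname{Sim}(A)$ one has $\operatorname{End}_A(\Delta(L))\cong k$ and the kernel of $P(L)\to\Delta(L)$ has a finite filtration whose subquotients are isomorphic to standard modules $\Delta(L')$ with $L'>_A L$. It is called directed if it is quasi-hereditary and all standard modules are simple. Exact Borel subalgebra: a subalgebra $B$ of a quasi-hereditary algebra $(A,\le_A)$ is an exact Borel subalgebra if (1) $A$ is projective as a right $B$-module; (2) there is a bijection $\phi:\operatorname{Sim}(B)\to\operatorname{Sim}(A)$ with $A\otimes_B L\cong\Delta(\phi(L))$ for all $L\in\operatorname{Sim}(B)$;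 (3) $(B,\le_B)$ is directed, where $L\le_B L'$ if and only if $\phi(L)\le_A\phi(L')$. It is called strong if $B$ contains a maximal semisimple subalgebra of $A$. Product order: since $k$ is algebraically closed, the simple $A\otimes_k A'$-modules are the modules $L\otimes_k L'$ with $L\in \operatorname{Sim}(A)$, $L'\in\operatorname{Sim}(A')$; set $L_1\otimes L_1'\le L_2\otimes L_2'$ if and only if $L_1\le_A L_2$ and $L_1'\le_{A'}L_2'$. It is known that $A\otimes_k A'$ is quasi-hereditary with this order, with standard modules $\Delta(L\otimes L')\cong\Delta(L)\otimes_k\Delta(L')$. *)

(* Defs.v *)
From HB Require Import structures.
From mathcomp Require Import all_boot all_order all_algebra all_field.

Set Implicit Arguments.
Unset Strict Implicit.
Unset Printing Implicit Defensive.

Import GRing.Theory VectorInternalTheory.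
Local Open Scope ring_scope.

(* The converse ring A^c is the opposite algebra: right A-modules are left
   A^c-modules. *)
Section Opposite.
Variables (k : fieldType) (A : falgType k).

HB.instance Definition _ := Vector.copy A^c A.

Fact converse_scalerAl (a : k) (u v : A^c) :
  a *: (u * v) = (a *: u : A^c) * v.
Proof. exact: (@scalerAr k A a (v : A) (u : A)). Qed.

HB.instance Definition _ :=
  GRing.Lmodule_isLalgebra.Build k A^c converse_scalerAl.

Fact converse_scalerAr (a : k) (u v : A^c) :
  a *: (u * v) = u * (a *: v : A^c).
Proof. exact: (@scalerAl k A a (v : A) (u : A)). Qed.

HB.instance Definition _ :=
  GRing.Lalgebra_isAlgebra.Build k A^c converse_scalerAr.

Definition oppalg : falgType k := A^c.

End Opposite.

Section SeqLemmas.
Variables (k : fieldType) (V : vectType k).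

Lemma memv_bigcap_seq (T : eqType) (s : seq T) (U : T -> {vspace V}) v :
  v \in (\bigcap_(a <- s) U a)%VS <-> (forall a, a \in s -> v \in U a).
Proof.
elim: s => [|b s IHs]; first by rewrite big_nil memvf.
rewrite big_cons memv_cap; split=> [/andP[Ub /IHs Us] a | Uv].
  by rewrite inE => /predU1P[->|/Us].
rewrite Uv ?mem_head //=; apply/IHs => a sa.
by apply: Uv; rewrite inE sa orbT.
Qed.

Lemma subv_sum_seq (T : eqType) (s : seq T) (U : T -> {vspace V}) W :
  (\sum_(a <- s) U a <= W)%VS <-> (forall a, a \in s -> (U a <= W)%VS).
Proof.
elim: s => [|b s IHs]; first by rewrite big_nil sub0v.
rewrite big_cons subv_add; split=> [/andP[Ub /IHs Us] a | UW].
  by rewrite inE => /predU1P[->|/Us].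
rewrite UW ?mem_head //=; apply/IHs => a sa.
by apply: UW; rewrite inE sa orbT.
Qed.

Lemma vbasis_linear (E : vectType k) (g : E -> V) (U : {vspace E}) W :
    linear g -> (forall b, b \in (vbasis U : seq E) -> g b \in (W : {vspace V})) ->
  forall v, v \in U -> g v \in W.
Proof.
move=> lg gW v Uv.
pose gl : {linear E -> V} := HB.pack g (GRing.isLinear.Build k E V _ g lg).
rewrite -[g v]/(gl v) (coord_vbasis Uv) linear_sum; apply: memv_suml => i _.
rewrite linearZZ; apply: memvZ; apply: gW; by rewrite mem_nth // size_tuple.
Qed.

Lemma linfun_linear (E : vectType k) (g : E -> V) : linear g -> linfun g =1 g.
Proof.
move=> lg v.
pose gl : {linear E -> V} := HB.pack g (GRing.isLinear.Build k E V _ g lg).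
exact: (lfunE gl).
Qed.

End SeqLemmas.

Section Tensor.
Variables (k : fieldType).
Implicit Types V W U : vectType k.

(* In coordinates, v (x) w is the rank one matrix v^T w; the universal property
   is tliftE and tensor_ext. *)
Definition tensor V W : Type := 'M[k]_(dim V, dim W).

HB.instance Definition _ V W := Vector.copy (tensor V W) 'M[k]_(dim V, dim W).

Definition tens V W (v : V) (w : W) : tensor V W := (v2r v)^T *m v2r w.

Lemma tens_linearl V W (w : W) : linear (fun v : V => tens v w).
Proof.
by move=> a u v; rewrite /tens !linearP /= mulmxDl -scalemxAl.
Qed.

Lemma tens_linearr V W (v : V) : linear (tens v : W -> tensor V W).
Proof.
by move=> a u w; rewrite /tens linearP /= mulmxDr -scalemxAr.
Qed.

Section Lift.
Variables (V W U : vectType k) (f : V -> W -> U).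

Definition tlift_fun (X : tensor V W) : U :=
  \sum_i \sum_j (X : 'M_(_, _)) i j
     *: f (r2v (delta_mx 0 i)) (r2v (delta_mx 0 j)).

Fact tlift_is_linear : linear tlift_fun.
Proof.
move=> a X Y; rewrite /tlift_fun scaler_sumr -big_split; apply: eq_bigr => i _.
rewrite scaler_sumr -big_split; apply: eq_bigr => j _ /=.
by rewrite !mxE scalerDl scalerA.
Qed.

HB.instance Definition _ :=
  GRing.isLinear.Build k (tensor V W) U _ tlift_fun tlift_is_linear.

(* The linear map defined by v (x) w |-> f v w, when f is bilinear. *)
Definition tlift : 'Hom(tensor V W, U) := linfun tlift_fun.

Hypothesis f_linl : forall w, linear (fun v => f v w).
Hypothesis f_linr : forall v, linear (f v).

Lemma tliftE v w : tlift (tens v w) = f v w.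
Proof.
have r2v_sum (E : vectType k) (u : E) :
    u = \sum_i v2r u 0 i *: r2v (delta_mx 0 i).
  rewrite -[LHS](v2rK u) [v2r u]row_sum_delta linear_sum.
  by apply: eq_bigr => i _; rewrite linearZ -row_sum_delta.
pose fl w : {linear V -> U} := HB.pack (fun v => f v w)
  (GRing.isLinear.Build k V U _ (fun v => f v w) (f_linl w)).
pose fr v : {linear W -> U} := HB.pack (f v)
  (GRing.isLinear.Build k W U _ (f v) (f_linr v)).
rewrite lfunE /= /tlift_fun -[RHS]/(fl w v) [in RHS](r2v_sum _ v) linear_sum.
apply: eq_bigr => i _; rewrite [RHS]linearZZ.
rewrite -[fl w _]/(fr (r2v (delta_mx 0 i)) w) [in RHS](r2v_sum _ w) linear_sum.
rewrite scaler_sumr; apply: eq_bigr => j _.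
rewrite linearZZ scalerA.
by rewrite mxE big_ord1 mxE.
Qed.

End Lift.

Lemma tensor_ext V W U (f g : 'Hom(tensor V W, U)) :
  (forall v w, f (tens v w) = g (tens v w)) -> f = g.
Proof.
move=> fg; apply/lfunP => X.
rewrite [X : 'M_(_, _)]matrix_sum_delta !linear_sum; apply: eq_bigr => i _.
rewrite !linear_sum; apply: eq_bigr => j _; rewrite !linearZ; congr (_ *: _).
have -> : delta_mx i j = tens (r2v (delta_mx 0 i)) (r2v (delta_mx 0 j)) :> tensor V W.
  by rewrite /tens !r2vK trmx_delta mul_delta_mx.
exact: fg.
Qed.

Lemma tensor_extf V W U (f g : tensor V W -> U) : linear f -> linear g ->
  (forall v w, f (tens v w) = g (tens v w)) -> f =1 g.
Proof.
move=> lf lg fg X.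
pose fl : {linear tensor V W -> U} :=
  HB.pack f (GRing.isLinear.Build k (tensor V W) U _ f lf).
pose gl : {linear tensor V W -> U} :=
  HB.pack g (GRing.isLinear.Build k (tensor V W) U _ g lg).
have /lfunP/(_ X) : linfun fl = linfun gl.
  by apply: tensor_ext => a a'; rewrite (lfunE fl) (lfunE gl); apply: fg.
by rewrite (lfunE fl) (lfunE gl).
Qed.

Definition tmap V W V' W' (f : 'Hom(V, V')) (g : 'Hom(W, W')) :
    'Hom(tensor V W, tensor V' W') :=
  tlift (fun v w => tens (f v) (g w)).

Lemma tmapE V W V' W' (f : 'Hom(V, V')) (g : 'Hom(W, W')) v w :
  tmap f g (tens v w) = tens (f v) (g w).
Proof.
rewrite /tmap tliftE // => [x|x] a u u'; rewrite linearP.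
  exact: tens_linearl.
exact: tens_linearr.
Qed.

Lemma tmap_comp V W V' W' V2 W2 (f : 'Hom(V, V')) (g : 'Hom(W, W'))
    (f' : 'Hom(V', V2)) (g' : 'Hom(W', W2)) :
  tmap (f' \o f)%VF (g' \o g)%VF = (tmap f' g' \o tmap f g)%VF.
Proof. by apply: tensor_ext => v w; rewrite comp_lfunE !tmapE !comp_lfunE. Qed.

Lemma tmap1 V W : tmap (\1 : 'End(V))%VF (\1 : 'End(W))%VF = \1%VF.
Proof. by apply: tensor_ext => v w; rewrite tmapE !id_lfunE. Qed.

Lemma tmap_linearl V W V' W' (g : 'Hom(W, W')) :
  linear (fun f : 'Hom(V, V') => tmap f g).
Proof.
move=> a f f'; apply: tensor_ext => v w.
rewrite add_lfunE scale_lfunE !tmapE add_lfunE scale_lfunE.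
exact: tens_linearl.
Qed.

Lemma tmap_linearr V W V' W' (f : 'Hom(V, V')) :
  linear (tmap f : 'Hom(W, W') -> _).
Proof.
move=> a g g'; apply: tensor_ext => v w.
rewrite add_lfunE scale_lfunE !tmapE add_lfunE scale_lfunE.
exact: tens_linearr.
Qed.

End Tensor.

Section TensorAlgebra.
Variables (k : fieldType) (A A' : falgType k).

Definition tensalg : Type := tensor A A'.
HB.instance Definition _ := Vector.copy tensalg (tensor A A').

Implicit Types X Y Z : tensalg.

(* (a (x) a') (b (x) b') = ab (x) a'b' *)
Definition tens_mul X Y : tensalg :=
  tlift (fun (a : A) (a' : A') => tmap (amull a) (amull a')) X Y.

Definition tens_one : tensalg := tens (1 : A) (1 : A').

Let tens_mulf_linl (a' : A') : linear (fun a : A => tmap (amull a) (amull a')).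
Proof. by move=> c a b; rewrite amull_is_linear; apply: tmap_linearl. Qed.

Let tens_mulf_linr (a : A) : linear (fun a' : A' => tmap (amull a) (amull a')).
Proof. by move=> c a' b'; rewrite amull_is_linear; apply: tmap_linearr. Qed.

Lemma tens_mulE (a b : A) (a' b' : A') :
  tens_mul (tens a a') (tens b b') = tens (a * b) (a' * b').
Proof. by rewrite /tens_mul tliftE // tmapE !(lfunE (_ \*o _)). Qed.

Fact tens_mul_linearl Y : linear (tens_mul^~ Y).
Proof. by move=> c X X'; rewrite /tens_mul linearD linearZZ add_lfunE scale_lfunE. Qed.

Fact tens_mul_linearr X : linear (tens_mul X).
Proof. by move=> c Y Y'; rewrite /tens_mul linearD linearZZ. Qed.

Fact tens_mulA : associative tens_mul.
Proof.
move=> X Y Z; move: X; apply: tensor_extf.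
- by move=> c X X'; rewrite tens_mul_linearl.
- by move=> c X X'; rewrite !tens_mul_linearl.
move=> a a'; move: Y; apply: tensor_extf.
- by move=> c Y Y'; rewrite tens_mul_linearl tens_mul_linearr.
- by move=> c Y Y'; rewrite tens_mul_linearr tens_mul_linearl.
move=> b b'; move: Z; apply: tensor_extf.
- by move=> c Z Z'; rewrite !tens_mul_linearr.
- by move=> c Z Z'; rewrite !tens_mul_linearr.
by move=> c c'; rewrite !tens_mulE !mulrA.
Qed.

Fact tens_mul1 : left_id tens_one tens_mul.
Proof.
apply: tensor_extf => [||a a'].
- exact: tens_mul_linearr.
- by [].
- by rewrite tens_mulE !mul1r.
Qed.

Fact tens_mulr1 : right_id tens_one tens_mul.
Proof.
apply: tensor_extf => [||a a'].
- exact: tens_mul_linearl.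
- by [].
- by rewrite tens_mulE !mulr1.
Qed.

Fact tens_mulDl : left_distributive tens_mul +%R.
Proof.
move=> X Y Z; have := tens_mul_linearl Z 1 X Y.
by rewrite !scale1r.
Qed.

Fact tens_mulDr : right_distributive tens_mul +%R.
Proof.
move=> X Y Z; have := tens_mul_linearr X 1 Y Z.
by rewrite !scale1r.
Qed.

Fact tens_one_neq0 : tens_one != 0.
Proof.
have nz (C : falgType k) : v2r (1 : C) != 0.
  by rewrite -(raddf0 v2r) (inj_eq (@v2r_inj _ _)) oner_neq0.
have /rV0Pn[i i0] := nz A; have /rV0Pn[j j0] := nz A'.
apply/eqP => /(congr1 (fun M : 'M_(_, _) => M i j)).
rewrite [LHS]mxE big_ord1 !mxE => /eqP.
by rewrite mulf_eq0 (negPf i0) (negPf j0).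
Qed.

HB.instance Definition _ := GRing.Zmodule_isNzRing.Build tensalg
  tens_mulA tens_mul1 tens_mulr1 tens_mulDl tens_mulDr tens_one_neq0.

Fact tens_scalerAl (c : k) X Y : c *: (X * Y) = (c *: X : tensalg) * Y.
Proof.
have := tens_mul_linearl Y c X 0.
by rewrite -[tens_mul 0 Y]/((0 : tensalg) * Y) mul0r !addr0.
Qed.

HB.instance Definition _ :=
  GRing.Lmodule_isLalgebra.Build k tensalg tens_scalerAl.

Fact tens_scalerAr (c : k) X Y : c *: (X * Y) = X * (c *: Y : tensalg).
Proof.
have := tens_mul_linearr X c Y 0.
by rewrite -[tens_mul X 0]/(X * (0 : tensalg)) mulr0 !addr0.
Qed.

HB.instance Definition _ :=
  GRing.Lalgebra_isAlgebra.Build k tensalg tens_scalerAr.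

HB.instance Definition _ := Algebra_isFalgebra.Build k tensalg.

End TensorAlgebra.

(* Finitely generated left modules over the finite-dimensional algebra A, i.e.
   finite-dimensional k-spaces with a k-linear action of A. *)
Record lmodule (k : fieldType) (A : falgType k) := LModule {
  lm_sort :> vectType k;
  lm_act : A -> 'End(lm_sort);
  lm_linear : linear lm_act;
  lm_act1 : lm_act 1 = \1%VF;
  lm_actM : forall a b : A, lm_act (a * b) = (lm_act a \o lm_act b)%VF
}.

Section Modules.
Variables (k : fieldType) (A : falgType k).
Implicit Types M N P L D : lmodule A.

HB.instance Definition _ M :=
  GRing.isLinear.Build k A 'End(M) _ (@lm_act k A M) (@lm_linear k A M).

Definition is_hom M N (f : 'Hom(M, N)) : Prop :=
  forall a v, f (lm_act M a v) = lm_act N a (f v).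

Definition miso M N : Prop := exists2 f : 'Hom(M, N), is_hom f & bijective f.

Definition hom_space M N : {vspace 'Hom(M, N)} :=
  (\bigcap_(a <- vbasis {:A})
     lker (linfun (fun f : 'Hom(M, N) =>
                     (f \o lm_act M a)%VF - (lm_act N a \o f)%VF)))%VS.

Record submod M := Submod {
  sm_space :> {vspace M};
  sm_stable : forall a, (lm_act M a @: sm_space <= sm_space)%VS
}.

Fact submod0_subproof M a : (lm_act M a @: 0 <= 0)%VS.
Proof. by rewrite limg0. Qed.
Definition submod0 M : submod M := Submod (@submod0_subproof M).

Fact submodT_subproof M a : (lm_act M a @: fullv <= fullv)%VS.
Proof. exact: subvf. Qed.
Definition submodT M : submod M := Submod (@submodT_subproof M).

(* The subquotient N / N' for N' <= N (in general (N + N') / N'), carried by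
   the complement N :\: N' of N' in N, with canonical projection subquot_pi. *)
Section Subquotient.
Variables (M : lmodule A) (N N' : submod M).
Let V : vectType k := subvs_of (N :\: N').

Definition subquot_pi : 'Hom(M, V) :=
  (linfun (vsproj (N :\: N')) \o addv_pi1 N N')%VF.

Definition subquot_act (a : A) : 'End(V) :=
  (subquot_pi \o lm_act M a \o linfun vsval)%VF.

Let inN v : v \in (N :\: N')%VS -> v \in (N : {vspace M}).
Proof. by apply: subvP; apply: diffvSl. Qed.

Lemma vsval_subquot_pi v : vsval (subquot_pi v) = addv_pi1 N N' v.
Proof.
rewrite comp_lfunE lfunE vsprojK //.
exact: memv_pi.
Qed.

Lemma subquot_pi_vsval (x : V) : subquot_pi (vsval x) = x.
Proof.
apply: val_inj; rewrite [LHS]vsval_subquot_pi.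
by rewrite daddv_pi_id ?capv_diff // subvsP.
Qed.

Lemma subquot_pi_eq0 v : v \in (N' : {vspace M}) -> subquot_pi v = 0.
Proof.
move=> N'v; apply: val_inj; rewrite [LHS]vsval_subquot_pi.
have /addv_pi1_pi2 : v \in (N + N')%VS by apply: subvP (addvSr _ _) _ N'v.
by rewrite addv_pi2_id // => /(canRL (addrK v)); rewrite subrr.
Qed.

Lemma subquot_pi_rem v : v \in (N : {vspace M}) ->
  v - vsval (subquot_pi v) \in (N' : {vspace M}).
Proof.
move=> Nv; rewrite vsval_subquot_pi.
have /addv_pi1_pi2 Dv : v \in (N + N')%VS by apply: subvP (addvSl _ _) _ Nv.
by rewrite -{1}Dv addrC addKr memv_pi2.
Qed.

Lemma subquot_actE a x :
  subquot_act a x = subquot_pi (lm_act M a (vsval x)).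
Proof. by rewrite /subquot_act 2!comp_lfunE (lfunE vsval). Qed.

Lemma subquot_pi_act a v : v \in (N : {vspace M}) ->
  subquot_pi (lm_act M a v) = subquot_act a (subquot_pi v).
Proof.
move=> Nv; set w := vsval (subquot_pi v).
have N'd : lm_act M a (v - w) \in (N' : {vspace M}).
  apply: subvP (sm_stable N' a) _ _; apply: memv_img.
  exact: subquot_pi_rem.
have -> : lm_act M a v = lm_act M a (v - w) + lm_act M a w.
  by rewrite -linearD subrK.
have lfD (f : 'Hom(M, V)) x y : f (x + y) = f x + f y by exact: linearD.
rewrite lfD (subquot_pi_eq0 N'd) add0r.
by rewrite subquot_actE.
Qed.

Fact subquot_linear : linear subquot_act.
Proof.
move=> c a b; apply/lfunP => x.
rewrite add_lfunE scale_lfunE !subquot_actE lm_linear add_lfunE scale_lfunE.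
exact: linearP.
Qed.

Fact subquot_act1 : subquot_act 1 = \1%VF.
Proof.
apply/lfunP => x; rewrite subquot_actE lm_act1 !id_lfunE.
exact: subquot_pi_vsval.
Qed.

Fact subquot_actM a b :
  subquot_act (a * b) = (subquot_act a \o subquot_act b)%VF.
Proof.
apply/lfunP => x; rewrite [RHS]comp_lfunE.
have Nx : vsval x \in (N : {vspace M}) by apply/inN/subvsP.
have Nbx : lm_act M b (vsval x) \in (N : {vspace M}).
  by apply: subvP (sm_stable N b) _ _; apply: memv_img.
by rewrite subquot_actE lm_actM comp_lfunE subquot_pi_act // -subquot_actE.
Qed.

Definition subquot : lmodule A :=
  LModule subquot_linear subquot_act1 subquot_actM.

End Subquotient.

Definition quot M (N : submod M) : lmodule A := subquot (submodT M) N.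

Definition simple M : Prop :=
  dim M != 0%N /\
  forall N : submod M, N = 0%VS :> {vspace M} \/ N = fullv :> {vspace M}.

Definition semisimple M : Prop :=
  exists (n : nat) (S : 'I_n -> submod M),
    [/\ forall i, simple (subquot (S i) (submod0 M)),
        directv (\sum_i S i)%VS & (\sum_i S i)%VS = fullv].

Definition projective P : Prop :=
  forall (M N : lmodule A) (g : 'Hom(M, N)) (f : 'Hom(P, N)),
    is_hom g -> limg g = fullv -> is_hom f ->
  exists2 h : 'Hom(P, M), is_hom h & (g \o h)%VF = f.

Definition superfluous P (K : {vspace P}) : Prop :=
  forall N : submod P, (N + K = fullv)%VS -> N = fullv :> {vspace P}.

Definition projective_cover P L : Prop :=
  projective P /\
  exists p : 'Hom(P, L), [/\ is_hom p, limg p = fullv & superfluous (lker p)].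

(* t is an isomorphism of k-algebras from k onto End_A(D). *)
Definition End_iso_field D : Prop :=
  exists t : k -> 'End(D),
    [/\ forall a b c, t (a * b + c) = a *: t b + t c,
        t 1 = \1%VF /\ forall a b, t (a * b) = (t a \o t b)%VF,
        injective t
      & forall f : 'End(D), is_hom f <-> exists c, f = t c].

Definition regmod_act (a : A) : 'End(A) := amull a.

Fact regmod_actM a b : regmod_act (a * b) = (regmod_act a \o regmod_act b)%VF.
Proof.
by apply/lfunP => x; rewrite comp_lfunE !lfunE /= mulrA.
Qed.

Definition regmod : lmodule A :=
  LModule (@amull_is_linear k A) (@amull1 k A) regmod_actM.

Section QuasiHereditary.
Variable I : finType.
Implicit Types (S Q : I -> lmodule A) (le : rel I).

(* S is a set Sim(A) of representatives of the isomorphism classes of simple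
   A-modules, indexed by I (which is necessarily finite). *)
Definition simple_reps S : Prop :=
  [/\ forall i, simple (S i),
      forall i j, miso (S i) (S j) -> i = j
    & forall M, simple M -> exists i, miso M (S i)].

(* The sum of the images of all f : P(j) -> P(i) with j not <= i; summing over
   a basis of Hom_A(P(j), P(i)) gives the same result, see traceP. *)
Definition trace_space Q le i : {vspace Q i} :=
  (\sum_(j | ~~ le j i) \sum_(f <- vbasis (hom_space (Q j) (Q i))) limg f)%VS.

Lemma hom_spaceP M N (f : 'Hom(M, N)) : reflect (is_hom f) (f \in hom_space M N).
Proof.
pose d a (h : 'Hom(M, N)) := (h \o lm_act M a)%VF - (lm_act N a \o h)%VF.
have dlin a : linear (d a).
  move=> c g h; rewrite /d comp_lfunDl comp_lfunDr -comp_lfunZl -comp_lfunZr.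
  by rewrite opprD addrACA scalerBr.
have alin : linear (fun a => d a f).
  move=> c b b'; rewrite /d !lm_linear comp_lfunDl comp_lfunDr.
  by rewrite -comp_lfunZl -comp_lfunZr opprD addrACA scalerBr.
apply: (iffP idP) => [/memv_bigcap_seq fP a v | fP].
  suff: d a f \in 0%VS.
    rewrite memv0 => /eqP/lfunP/(_ v)/eqP.
    by rewrite add_lfunE opp_lfunE !comp_lfunE zero_lfunE subr_eq0 => /eqP.
  apply: (vbasis_linear alin _ (memvf a)) => b /fP.
  by rewrite memv_ker (linfun_linear (dlin b)) memv0.
apply/memv_bigcap_seq => a _; rewrite memv_ker (linfun_linear (dlin a)).
apply/eqP/lfunP => v.
by rewrite add_lfunE opp_lfunE !comp_lfunE fP subrr zero_lfunE.
Qed.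

Lemma traceP Q le i (U : {vspace Q i}) :
  (trace_space Q le i <= U)%VS <->
  (forall j (f : 'Hom(Q j, Q i)), ~~ le j i -> is_hom f -> (limg f <= U)%VS).
Proof.
split=> [QU j f nij hf | QU].
  apply/subvP=> _ /memv_imgP[x _ ->].
  have flin : linear (fun g : 'Hom(Q j, Q i) => g x).
    by move=> c g h; rewrite add_lfunE scale_lfunE.
  have /(vbasis_linear flin) : forall g : 'Hom(Q j, Q i),
      g \in (vbasis (hom_space (Q j) (Q i)) : seq _) -> g x \in U.
    move=> g gb; have /subv_sumP/(_ j nij)/subv_sum_seq/(_ g gb) := QU.
    by move/subvP; apply; apply: memv_img; apply: memvf.
  by apply; apply/hom_spaceP.
apply/subv_sumP => j nij; apply/subv_sum_seq => f fb.
by apply: QU nij _; apply/hom_spaceP/vbasis_mem.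
Qed.

Fact trace_stable Q le i a :
  (lm_act (Q i) a @: trace_space Q le i <= trace_space Q le i)%VS.
Proof.
rewrite limg_sum; apply/subv_sumP => j nij; rewrite limg_sum.
apply/subv_sum_seq => f fb.
have /hom_spaceP hf : f \in hom_space (Q j) (Q i) by apply: vbasis_mem.
apply: (@subv_trans _ _ (limg f)).
  apply/subvP => _ /memv_imgP[_ /memv_imgP[x _ ->] ->].
  by rewrite -hf memv_img ?memvf.
by have /traceP := subvv (trace_space Q le i); apply.
Qed.

Definition trace Q le i : submod (Q i) := Submod (@trace_stable Q le i).

(* Q j is meant to be a projective cover of the j-th simple module. *)
Definition standard Q le i : lmodule A := quot (trace Q le i).

Definition standard_ker Q le i : {vspace Q i} :=
  lker (subquot_pi (submodT (Q i)) (trace Q le i)).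

Definition filtered_by M (K : {vspace M}) (D : I -> lmodule A) (X : pred I) :
    Prop :=
  exists (n : nat) (F : nat -> submod M),
    [/\ F 0%N = 0%VS :> {vspace M}, F n = K :> {vspace M}
      & forall t, (t < n)%N ->
          (F t <= F t.+1)%VS /\
          exists2 j, X j & miso (subquot (F t.+1) (F t)) (D j)].

Definition quasi_hereditary_for S Q le : Prop :=
  [/\ simple_reps S,
      reflexive le /\ antisymmetric le /\ transitive le,
      forall i, projective_cover (Q i) (S i),
      forall i, End_iso_field (standard Q le i)
    & forall i, filtered_by (standard_ker Q le i) (standard Q le)
                  (fun j => (j != i) && le i j)].

Definition quasi_hereditary S le : Prop :=
  exists Q, quasi_hereditary_for S Q le.

Definition directed S le : Prop :=
  exists2 Q, quasi_hereditary_for S Q le & forall i, simple (standard Q le i).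

End QuasiHereditary.

End Modules.

(* Subalgebras contain the unit of A (an {aspace A} may have another one). *)
Record subalg (k : fieldType) (A : falgType k) := Subalg {
  sa_space :> {aspace A};
  sa_one : 1 \in sa_space
}.

Definition salg (k : fieldType) (A : falgType k) (B : subalg A) : falgType k :=
  subvs_of B.

Lemma salg1 (k : fieldType) (A : falgType k) (B : subalg A) :
  vsval (1 : salg B) = 1.
Proof.
by apply/eqP; rewrite [_ == _]algid_eq1 sa_one.
Qed.

Section Borel.
Variables (k : fieldType) (A : falgType k).
Implicit Types B S T : subalg A.

Section RightRegular.
Variable B : subalg A.

Definition rreg_act (b : oppalg (salg B)) : 'End(A) := amulr (vsval b).

Fact rreg_linear : linear rreg_act.
Proof.
by move=> c a b; apply: (amulr_is_linear c (vsval (a : salg B)) (vsval (b : salg B))).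
Qed.
Fact rreg_act1 : rreg_act 1 = \1%VF.
Proof.
apply/lfunP => x; rewrite id_lfunE lfunE.
by rewrite -[LHS]/(x * vsval (1 : salg B)) salg1 mulr1.
Qed.
Fact rreg_actM b c : rreg_act (b * c) = (rreg_act b \o rreg_act c)%VF.
Proof.
apply/lfunP => x; rewrite comp_lfunE !lfunE.
rewrite -[LHS]/(x * (vsval (c : salg B) * vsval (b : salg B))).
by rewrite -[RHS]/(x * vsval (c : salg B) * vsval (b : salg B)) mulrA.
Qed.

Definition rreg : lmodule (oppalg (salg B)) :=
  LModule rreg_linear rreg_act1 rreg_actM.

End RightRegular.

(* A (x)_B L is the quotient of A (x)_k L by the span of the elements
   ab (x) l - a (x) bl. *)
Section Induction.
Variables (B : subalg A) (L : lmodule (salg B)).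

Definition ext_act (a : A) : 'End(tensor A L) := tmap (amull a) \1%VF.

Fact ext_linear : linear ext_act.
Proof.
by move=> c a b; rewrite /ext_act amull_is_linear; apply: tmap_linearl.
Qed.
Fact ext_act1 : ext_act 1 = \1%VF.
Proof.
by rewrite /ext_act amull1 tmap1.
Qed.
Fact ext_actM a b : ext_act (a * b) = (ext_act a \o ext_act b)%VF.
Proof.
by rewrite /ext_act -tmap_comp comp_lfun1l -[amull _]/(regmod_act _) regmod_actM.
Qed.

Definition ext_mod : lmodule A := LModule ext_linear ext_act1 ext_actM.

Definition balance_map (b : salg B) : 'End(ext_mod) :=
  tmap (amulr (vsval b)) \1%VF - tmap \1%VF (lm_act L b).

Lemma ext_actE a x l : lm_act ext_mod a (tens x l) = tens (a * x) l.
Proof. by rewrite [LHS]tmapE lfunE id_lfunE. Qed.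

Lemma balance_mapE b a l : balance_map b (tens a l) =
  tens (a * vsval b) l - tens a (lm_act L b l).
Proof. by rewrite add_lfunE opp_lfunE !tmapE !id_lfunE lfunE. Qed.

Definition balance_space : {vspace ext_mod} :=
  (\sum_(b <- vbasis {:salg B}) limg (balance_map b))%VS.

Lemma balanceP (U : {vspace ext_mod}) :
  (balance_space <= U)%VS <->
  (forall a b l,
     (tens (a * vsval b) l - tens a (lm_act L b l) : tensor A L) \in U).
Proof.
split=> [bU a b l | bU].
  rewrite -balance_mapE.
  have blin : linear (fun b => balance_map b (tens a l)).
    move=> c b1 b2; rewrite !balance_mapE lm_linear add_lfunE scale_lfunE.
    rewrite linearP mulrDr -scalerAr tens_linearl tens_linearr.
    by rewrite opprD addrACA scalerBr.
  apply: (vbasis_linear blin _ (memvf b)) => b' b'b.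
  have /subv_sum_seq/(_ b' b'b)/subvP := bU; apply.
  by rewrite memv_img ?memvf.
apply/subv_sum_seq => b _; apply/subvP => _ /memv_imgP[X _ ->].
pose pU := projv U.
suff: (pU \o balance_map b)%VF = balance_map b.
  by move/lfunP/(_ X); rewrite comp_lfunE => <-; apply: memv_proj.
apply: tensor_ext => a l.
by rewrite comp_lfunE /pU projv_id // balance_mapE.
Qed.

Fact balance_stable a : (lm_act ext_mod a @: balance_space <= balance_space)%VS.
Proof.
rewrite limg_sum; apply/subv_sum_seq => b bb.
rewrite -limg_comp.
have -> : (lm_act ext_mod a \o balance_map b)%VF
    = (balance_map b \o lm_act ext_mod a)%VF.
  apply: tensor_ext => x l; rewrite !comp_lfunE ext_actE !balance_mapE.
  have lfB (f : 'End(tensor A L)) u v : f (u - v) = f u - f v by exact: linearB.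
  by rewrite lfB !ext_actE mulrA.
rewrite limg_comp; apply: subv_trans (limgS _ (subvf _)) _.
by have /subv_sum_seq := subvv balance_space; apply.
Qed.

Definition balance : submod ext_mod := Submod balance_stable.

Definition induced : lmodule A := quot balance.

End Induction.

(* Meant for (A, le) quasi-hereditary with Sim(A) = {S i | i : I}; the standard
   modules do not depend, up to isomorphism, on the projective covers Q. *)
Definition exact_borel (I : finType) (S : I -> lmodule A) (le : rel I)
    (B : subalg A) : Prop :=
  projective (rreg B) /\
  exists (J : finType) (T : J -> lmodule (salg B)) (phi : J -> I),
    [/\ simple_reps T, bijective phi,
        exists2 Q : I -> lmodule A,
          forall i, projective_cover (Q i) (S i)
        & forall j, miso (induced (T j)) (standard Q le (phi j))
      & directed T (fun j j' => le (phi j) (phi j'))].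

Definition semisimple_subalg S : Prop := semisimple (regmod (salg S)).

(* Maximal for inclusion among the semisimple subalgebras of A. *)
Definition maximal_semisimple_subalg S : Prop :=
  semisimple_subalg S /\
  forall T, semisimple_subalg T -> (S <= T)%VS -> T = S :> {vspace A}.

Definition strong B : Prop :=
  exists2 S, maximal_semisimple_subalg S & (S <= B)%VS.

End Borel.

Section TensorModule.
Variables (k : fieldType) (A A' : falgType k).
Variables (L : lmodule A) (L' : lmodule A').

(* (a (x) a') (l (x) l') = al (x) a'l' *)
Definition tensmod_act (X : tensalg A A') : 'End(tensor L L') :=
  tlift (fun (a : A) (a' : A') => tmap (lm_act L a) (lm_act L' a')) X.

Fact tensmod_linear : linear tensmod_act.
Proof.
by move=> c X Y; rewrite /tensmod_act linearD linearZZ.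
Qed.

Lemma tensmod_actE a a' l l' :
  tensmod_act (tens a a') (tens l l') = tens (lm_act L a l) (lm_act L' a' l').
Proof.
rewrite /tensmod_act tliftE ?tmapE // => [x|x] c y z; rewrite lm_linear.
  exact: tmap_linearl.
exact: tmap_linearr.
Qed.

Fact tensmod_act1 : tensmod_act 1 = \1%VF.
Proof.
apply: tensor_ext => l l'.
by rewrite tensmod_actE !lm_act1 !id_lfunE.
Qed.
Fact tensmod_actM X Y :
  tensmod_act (X * Y) = (tensmod_act X \o tensmod_act Y)%VF.
Proof.
apply: tensor_ext => l l'; rewrite comp_lfunE.
move: X; apply: tensor_extf.
- by move=> c X X'; rewrite mulrDl -scalerAl tensmod_linear add_lfunE scale_lfunE.
- by move=> c X X'; rewrite tensmod_linear add_lfunE scale_lfunE.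
move=> a a'; move: Y; apply: tensor_extf.
- by move=> c Y Y'; rewrite mulrDr -scalerAr tensmod_linear add_lfunE scale_lfunE.
- move=> c Y Y'; rewrite tensmod_linear add_lfunE scale_lfunE.
  by rewrite linearD linearZZ.
move=> b b'; rewrite -[_ * _]/(tens_mul _ _) tens_mulE !tensmod_actE.
by rewrite !lm_actM !comp_lfunE.
Qed.

Definition tensmod : lmodule (tensalg A A') :=
  LModule tensmod_linear tensmod_act1 tensmod_actM.

End TensorModule.

Section TensorSubalgebra.
Variables (k : fieldType) (A A' : falgType k) (B : subalg A) (B' : subalg A').

Definition tens_incl : 'Hom(tensalg (salg B) (salg B'), tensalg A A') :=
  tmap (linfun (vsval : salg B -> A)) (linfun (vsval : salg B' -> A')).

(* The subspace of A (x) A' spanned by the b (x) b'. *)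
Definition tens_subspace : {vspace tensalg A A'} := limg tens_incl.

Lemma tens_inclE b b' : tens_incl (tens b b') = tens (vsval b) (vsval b').
Proof. by rewrite tmapE !lfunE. Qed.

Lemma tens_inclM (X Y : tensalg (salg B) (salg B')) :
  tens_incl (X * Y) = tens_incl X * tens_incl Y.
Proof.
move: X; apply: tensor_extf.
- by move=> c X X'; rewrite mulrDl -scalerAl linearD linearZZ.
- by move=> c X X'; rewrite linearD linearZZ mulrDl -scalerAl.
move=> a a'; move: Y; apply: tensor_extf.
- by move=> c Y Y'; rewrite mulrDr -scalerAr linearD linearZZ.
- by move=> c Y Y'; rewrite linearD linearZZ mulrDr -scalerAr.
move=> b b'.
transitivity (tens_incl (tens (a * b) (a' * b'))).
  by congr (tens_incl _); apply: tens_mulE.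
by rewrite !tens_inclE; apply/esym/tens_mulE.
Qed.

Lemma tens_subspace_one : 1 \in tens_subspace.
Proof.
apply/memv_imgP; exists 1; first exact: memvf.
by rewrite tens_inclE !salg1.
Qed.

Fact tens_subspace_aspace : is_aspace tens_subspace.
Proof.
rewrite /is_aspace has_algid1 ?tens_subspace_one //=.
apply/prodvP => _ _ /memv_imgP[X _ ->] /memv_imgP[Y _ ->].
by rewrite -tens_inclM memv_img ?memvf.
Qed.

Definition tens_subalg : subalg (tensalg A A') :=
  @Subalg k (tensalg A A') (ASpace tens_subspace_aspace) tens_subspace_one.

End TensorSubalgebra.

(* The family of the simple A (x) A'-modules L (x) L' with the product order. *)
Definition tens_simples (k : fieldType) (A A' : falgType k) (I I' : Type)
    (S : I -> lmodule A) (S' : I' -> lmodule A') (x : I * I') :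
    lmodule (tensalg A A') :=
  tensmod (S x.1) (S' x.2).

Definition prod_le (I I' : Type) (le : rel I) (le' : rel I') : rel (I * I') :=
  fun x y => le x.1 y.1 && le' x.2 y.2.

(* Main.v *)
(* The algebras [A (x) A'], [B (x) B'] and [(B (x) B')^op] are all presented as
   tensor products of smaller ones, so the general facts are proved for an
   algebra [C] with an isomorphism from [A (x) A'].  An [A (x) A']-linear map
   [M (x) M' -> N (x) N'], restricted to [M (x) w] and contracted with a
   functional on [N'], is [A]-linear; this reduces the statements on projective
   covers, traces and endomorphisms to the two factors.  Hence the standard
   modules are the tensor products of standard modules, and a filtration of
   [Q (x) Q'] is obtained by refining [U_t (x) Q'] with the
   [U_t (x) Q' + U_(t+1) (x) U'_s].

   Strength: by a relative Wedderburn-Malcev theorem every semisimple subalgebra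
   lies in a complement of the radical, so the maximal semisimple subalgebras
   are exactly the complements [U] of the radical [J].  Such [U], [U'] give the
   complement [U (x) U'].  Conversely, if [B (x) B'] contains a complement, then
   contraction yields [B + J = A], and a complement of the radical of [B] is one
   of the radical of [A]. *)
Require Import Defs.
From HB Require Import structures.
From mathcomp Require Import all_boot all_order all_algebra all_field.
From Stdlib Require List.
From Stdlib Require Import Classical_Prop.

Set Implicit Arguments.
Unset Strict Implicit.
Unset Printing Implicit Defensive.

Import GRing.Theory VectorInternalTheory.
Local Open Scope ring_scope.

(** * Tensor products of vector spaces *)

(** The radical is the common annihilator of the given simple modules; its two working properties,
    invertibility of [1 - n] and Nakayama's lemma, come from the existence of simple quotients, not
    from nilpotency. Algebraic closedness enters through Schur's lemma: density then provides
    elements of the algebra acting as matrix units. These make [L (x) L'] simple and supply the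
    separability element of [A / rad]. The Wedderburn-Malcev theorem is relative in that the
    complement must contain a given [B]; therefore the section of [A -> A / J] that is improved step
    by step is kept left [B]-linear and the identity on [B] throughout. The obstacle in the converse
    on strength is that [A (x) J'] lies in the radical of [A (x) A'], and contracting it with an
    arbitrary functional on [A'] can give all of [A]. The functionals used are coordinates of
    [a' |-> a' v'] with [v'] in a simple [A']-module; they vanish on [J'], and one of them is
    nonzero at [1]. *)

Section LinearMaps.
Variables (k : fieldType) (V W E : vectType k).

Lemma lfunD (f : 'Hom(V, W)) u v : f (u + v) = f u + f v.
Proof. exact: linearD. Qed.

Lemma lfunB (f : 'Hom(V, W)) u v : f (u - v) = f u - f v.
Proof. exact: linearB. Qed.

Lemma lfunZ (f : 'Hom(V, W)) c u : f (c *: u) = c *: f u.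
Proof. exact: linearZ. Qed.

Lemma lfun0 (f : 'Hom(V, W)) : f 0 = 0.
Proof. exact: linear0. Qed.

Lemma lfun_sum (f : 'Hom(V, W)) (I : Type) (r : seq I) (P : pred I) F :
  f (\sum_(i <- r | P i) F i) = \sum_(i <- r | P i) f (F i).
Proof. exact: linear_sum. Qed.

Lemma limg_sub (f : 'Hom(V, W)) (U : {vspace W}) :
  (forall v, f v \in U) -> (limg f <= U)%VS.
Proof. by move=> fU; apply/subvP => _ /memv_imgP[v _ ->]. Qed.

Lemma mem_limg (f : 'Hom(V, W)) v : f v \in limg f.
Proof. by rewrite memv_img ?memvf. Qed.

Lemma limg_fullP (f : 'Hom(V, W)) :
  limg f = fullv <-> (forall w, exists v, f v = w).
Proof.
split=> [ff w | fs].
  have: w \in limg f by rewrite ff memvf.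
  by case/memv_imgP => v _ ->; exists v.
by apply/vspaceP => w; rewrite memvf; have [v <-] := fs w; rewrite mem_limg.
Qed.

Lemma inv_lfunK (f : 'Hom(V, W)) v : f ((f^-1)%VF (f v)) = f v.
Proof. by rewrite limg_lfunVK ?mem_limg. Qed.

Lemma lker0_inj (f : 'Hom(V, W)) : lker f = 0%VS <-> injective f.
Proof. by split=> [/eqP/lker0P | /lker0P/eqP]. Qed.

Lemma lfun_bij (f : 'Hom(V, W)) :
  injective f -> limg f = fullv -> bijective f.
Proof.
move=> fi ff; exists (f^-1)%VF => v.
  by apply: fi; rewrite inv_lfunK.
by rewrite limg_lfunVK // ff memvf.
Qed.

Lemma subvPn (U U' : {vspace V}) :
  ~~ (U <= U')%VS -> exists2 v, v \in U & v \notin U'.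
Proof.
move=> nU; suff: has (fun v => v \notin U') (vbasis U).
  by case/hasP => v /vbasis_mem; exists v.
apply: contraNT nU; rewrite -all_predC => /allP aU.
rewrite -(span_basis (vbasisP U)); apply/span_subvP => v vU.
by have := aU v vU; rewrite /= negbK.
Qed.

End LinearMaps.

Section TensorSpaces.
Variables (k : fieldType).
Implicit Types V W E : vectType k.

Lemma tens0l V W w : tens (0 : V) (w : W) = 0.
Proof. by have := tens_linearl w (-1) (0 : V) 0; rewrite !scaleN1r oppr0 addr0 addNr. Qed.
Lemma tens0r V W v : tens (v : V) (0 : W) = 0.
Proof. by have := tens_linearr v (-1) (0 : W) 0; rewrite !scaleN1r oppr0 addr0 addNr. Qed.
Lemma tensDl V W (v v' : V) (w : W) : tens (v + v') w = tens v w + tens v' w.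
Proof. by have := tens_linearl w 1 v v'; rewrite !scale1r. Qed.
Lemma tensDr V W (v : V) (w w' : W) : tens v (w + w') = tens v w + tens v w'.
Proof. by have := tens_linearr v 1 w w'; rewrite !scale1r. Qed.
Lemma tensZl V W c (v : V) (w : W) : tens (c *: v) w = c *: tens v w.
Proof. by have := tens_linearl w c v 0; rewrite tens0l !addr0. Qed.
Lemma tensZr V W c (v : V) (w : W) : tens v (c *: w) = c *: tens v w.
Proof. by have := tens_linearr v c w 0; rewrite tens0r !addr0. Qed.
Lemma tensBl V W (v v' : V) (w : W) : tens (v - v') w = tens v w - tens v' w.
Proof. by rewrite tensDl -scaleN1r tensZl scaleN1r. Qed.
Lemma tensBr V W (v : V) (w w' : W) : tens v (w - w') = tens v w - tens v w'.
Proof. by rewrite tensDr -scaleN1r tensZr scaleN1r. Qed.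

(** Induction on pure tensors: [g X \in U] says that [g] and its composite with [projv U] agree at
    [X], an equation of linear maps that [tensor_ext] checks on pure tensors. With [U] zero it also
    proves equalities that are linear in [X]. *)
Lemma tens_memv V W E (g : tensor V W -> E) (U : {vspace E}) :
  linear g -> (forall v w, g (tens v w) \in U) -> forall X, g X \in U.
Proof.
move=> lg gU X; rewrite -(linfun_linear lg X).
have -> : linfun g = (projv U \o linfun g)%VF.
  by apply: tensor_ext => v w; rewrite comp_lfunE (linfun_linear lg) projv_id.
by rewrite comp_lfunE memv_proj.
Qed.

Lemma tens_memv_lfun V W E (g : 'Hom(tensor V W, E)) (U : {vspace E}) :
  (forall v w, g (tens v w) \in U) -> forall X, g X \in U.
Proof. by apply: tens_memv; apply: linearP. Qed.

(* Contractions of the right and of the left factor with coordinate functionals. *)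
Definition ctrr V W (j : 'I_(dim W)) : 'Hom(tensor V W, V) :=
  tlift (fun v w => v2r w 0 j *: v).
Definition ctrl V W (i : 'I_(dim V)) : 'Hom(tensor V W, W) :=
  tlift (fun v w => v2r v 0 i *: w).

Lemma ctrrE V W j (v : V) (w : W) : ctrr V j (tens v w) = v2r w 0 j *: v.
Proof.
rewrite tliftE // => [{}w | {}v] c x y; first by rewrite scalerDr !scalerA mulrC.
by rewrite linearP !mxE scalerDl scalerA.
Qed.

Lemma ctrlE V W i (v : V) (w : W) : ctrl W i (tens v w) = v2r v 0 i *: w.
Proof.
rewrite tliftE // => [{}w | {}v] c x y; last by rewrite scalerDr !scalerA mulrC.
by rewrite linearP !mxE scalerDl scalerA.
Qed.

Lemma v2r_ctrr V W j (X : tensor V W) i :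
  v2r (ctrr V j X) 0 i = (X : 'M_(_, _)) i j.
Proof.
pose f (X : tensor V W) : k^o := v2r (ctrr V j X) 0 i.
pose g (X : tensor V W) : k^o := (X : 'M_(_, _)) i j.
suff /(_ X) : f =1 g by [].
apply: tensor_extf => [c Y Z | c Y Z | v w].
- by rewrite /f !linearP !mxE.
- by rewrite /g !mxE.
by rewrite /f /g ctrrE linearZ mxE [RHS]mxE big_ord1 !mxE mulrC.
Qed.

Lemma v2r_ctrl V W i (X : tensor V W) j :
  v2r (ctrl W i X) 0 j = (X : 'M_(_, _)) i j.
Proof.
pose f (X : tensor V W) : k^o := v2r (ctrl W i X) 0 j.
pose g (X : tensor V W) : k^o := (X : 'M_(_, _)) i j.
suff /(_ X) : f =1 g by [].
apply: tensor_extf => [c Y Z | c Y Z | v w].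
- by rewrite /f !linearP !mxE.
- by rewrite /g !mxE.
by rewrite /f /g ctrlE linearZ mxE [RHS]mxE big_ord1 !mxE.
Qed.

Lemma ctrr_eq V W (X Y : tensor V W) :
  (forall j, ctrr V j X = ctrr V j Y) -> X = Y.
Proof.
by move=> XY; apply/matrixP => i j; rewrite -[LHS]v2r_ctrr -[RHS]v2r_ctrr XY.
Qed.

Lemma ctrl_eq V W (X Y : tensor V W) :
  (forall j, ctrl W j X = ctrl W j Y) -> X = Y.
Proof.
by move=> XY; apply/matrixP => i j; rewrite -[LHS]v2r_ctrl -[RHS]v2r_ctrl XY.
Qed.

(** Contraction of one factor commutes with maps on the other; this is what makes the slices of a
    homomorphism equivariant. *)
Lemma ctrr_tmap V V' W j (f : 'Hom(V, V')) (X : tensor V W) :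
  ctrr V' j (tmap f \1%VF X) = f (ctrr V j X).
Proof.
suff /lfunP/(_ X) : (ctrr V' j \o tmap f \1 = f \o ctrr V j)%VF.
  by rewrite !comp_lfunE.
by apply: tensor_ext => v w; rewrite !comp_lfunE tmapE !ctrrE id_lfunE lfunZ.
Qed.

Lemma ctrl_tmap V W W' j (f : 'Hom(W, W')) (X : tensor V W) :
  ctrl W' j (tmap \1%VF f X) = f (ctrl W j X).
Proof.
suff /lfunP/(_ X) : (ctrl W' j \o tmap \1 f = f \o ctrl W j)%VF.
  by rewrite !comp_lfunE.
by apply: tensor_ext => v w; rewrite !comp_lfunE tmapE !ctrlE id_lfunE lfunZ.
Qed.

Lemma coord_neq0 V (v : V) : v != 0 -> exists i, v2r v 0 i != 0.
Proof.
move=> v0; apply/rV0Pn; apply: contraNneq v0 => v0.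
by rewrite -(inj_eq (@v2r_inj _ _)) v0 linear0.
Qed.

Lemma tens_eq0 V W (v : V) (w : W) : (tens v w == 0) = (v == 0) || (w == 0).
Proof.
apply/idP/idP => [/eqP t0 | /orP[] /eqP->]; last 2 first.
- by rewrite tens0l.
- by rewrite tens0r.
case: eqVneq => //= v0; apply/idPn => w0; have [j wj] := coord_neq0 w0.
have /eqP := congr1 (ctrr V j) t0; rewrite ctrrE lfun0 scaler_eq0.
by rewrite (negPf wj) (negPf v0).
Qed.

(** The kernel of [f (x) g] is [ker f (x) W + V (x) ker g]. It is phrased as a test on pure tensors
    because the target [U] is usually a trace, a balance space or the kernel of another map. *)
Lemma lker_tmap V W V' W' (f : 'Hom(V, V')) (g : 'Hom(W, W'))
    (U : {vspace tensor V W}) :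
  (forall v w, f v = 0 -> tens v w \in U) ->
  (forall v w, g w = 0 -> tens v w \in U) ->
  (lker (tmap f g) <= U)%VS.
Proof.
move=> fU gU; apply/subvP => X /[!memv_ker]/eqP X0.
(* Since [f f^-1 f = f], the map [f^-1 \o f] has the kernel of [f] and is the identity modulo it.
   Hence [p] fixes the kernel of [f (x) g] pointwise, while every [p X] lies in [U]. *)
pose p := (\1 - tmap (f^-1 \o f) (g^-1 \o g))%VF : 'End(tensor V W).
have: p X \in U.
  apply: tens_memv_lfun => v w; rewrite add_lfunE opp_lfunE id_lfunE tmapE.
  rewrite !comp_lfunE; set v' := (f^-1)%VF _; set w' := (g^-1)%VF _.
  have -> : tens v w - tens v' w' = tens (v - v') w + tens v' (w - w').
    by rewrite tensBl tensBr addrA subrK.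
  by apply: memvD; [apply: fU | apply: gU]; rewrite lfunB inv_lfunK subrr.
by rewrite add_lfunE opp_lfunE id_lfunE tmap_comp comp_lfunE X0 lfun0 subr0.
Qed.

Lemma tmap_lr V W V' W' (f : 'Hom(V, V')) (g : 'Hom(W, W')) X :
  tmap f g X = tmap f \1%VF (tmap \1%VF g X).
Proof. by rewrite -comp_lfunE -tmap_comp comp_lfun1l comp_lfun1r. Qed.

Lemma tmap_rl V W V' W' (f : 'Hom(V, V')) (g : 'Hom(W, W')) X :
  tmap f g X = tmap \1%VF g (tmap f \1%VF X).
Proof. by rewrite -comp_lfunE -tmap_comp comp_lfun1l comp_lfun1r. Qed.

Lemma tmap_surj V W V' W' (f : 'Hom(V, V')) (g : 'Hom(W, W')) :
  limg f = fullv -> limg g = fullv -> limg (tmap f g) = fullv.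
Proof.
move=> /limg_fullP ff /limg_fullP gf; apply/limg_fullP => X.
suff: X \in limg (tmap f g) by case/memv_imgP => Y _ ->; exists Y.
move: X; apply: (@tens_memv _ _ _ id) => // v w.
by have [x <-] := ff v; have [y <-] := gf w; rewrite -tmapE mem_limg.
Qed.

Lemma tmap_inj V W V' W' (f : 'Hom(V, V')) (g : 'Hom(W, W')) :
  injective f -> injective g -> injective (tmap f g).
Proof.
move=> fi gi; apply/lker0_inj/eqP; rewrite -subv0; apply: lker_tmap => v w h.
  by rewrite (fi v 0) ?lfun0 // tens0l mem0v.
by rewrite (gi w 0) ?lfun0 // tens0r mem0v.
Qed.

(* U (x) U' inside V (x) W. *)
Definition tsub V W (U : {vspace V}) (U' : {vspace W}) : {vspace tensor V W} :=
  limg (tmap (projv U) (projv U')).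

Lemma mem_tsub V W (U : {vspace V}) (U' : {vspace W}) v w :
  v \in U -> w \in U' -> tens v w \in tsub U U'.
Proof. by move=> Uv Uw; rewrite -(projv_id Uv) -(projv_id Uw) -tmapE mem_limg. Qed.

Lemma tsub_ind V W E (U : {vspace V}) (U' : {vspace W}) (g : tensor V W -> E)
    (Z : {vspace E}) :
  linear g -> (forall v w, v \in U -> w \in U' -> g (tens v w) \in Z) ->
  forall X, X \in tsub U U' -> g X \in Z.
Proof.
move=> lg gZ _ /memv_imgP[X _ ->].
have := @tens_memv V W E (fun X => g (tmap (projv U) (projv U') X)) Z.
apply=> [c x y | v w]; first by rewrite linearP lg.
by rewrite tmapE gZ ?memv_proj.
Qed.

Lemma tsub_sub V W (U : {vspace V}) (U' : {vspace W})
    (Z : {vspace tensor V W}) :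
  (forall v w, v \in U -> w \in U' -> tens v w \in Z) -> (tsub U U' <= Z)%VS.
Proof. by move=> UZ; apply/subvP; apply: (@tsub_ind _ _ _ _ _ id). Qed.

Lemma tsubS V W (U1 U2 : {vspace V}) (U1' U2' : {vspace W}) :
  (U1 <= U2)%VS -> (U1' <= U2')%VS -> (tsub U1 U1' <= tsub U2 U2')%VS.
Proof.
move=> /subvP s /subvP s'; apply: tsub_sub => v w /s Uv /s' Uw.
exact: mem_tsub.
Qed.

Lemma tsub0l V W (U' : {vspace W}) : tsub (0 : {vspace V}) U' = 0%VS.
Proof.
apply/eqP; rewrite -subv0; apply: tsub_sub => v w.
by rewrite memv0 => /eqP->; rewrite tens0l mem0v.
Qed.

Lemma tsub0r V W (U : {vspace V}) : tsub U (0 : {vspace W}) = 0%VS.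
Proof.
apply/eqP; rewrite -subv0; apply: tsub_sub => v w _.
by rewrite memv0 => /eqP->; rewrite tens0r mem0v.
Qed.

End TensorSpaces.

(** * Modules and submodules *)

Lemma dim_neq0P (k : fieldType) (V : vectType k) :
  dim V != 0%N <-> exists v : V, v != 0.
Proof.
rewrite -dimvf dimv_eq0; split=> [V0 | [v v0]].
  by exists (vpick {:V}); rewrite vpick0.
by apply: contraNneq v0 => V0; have := memvf v; rewrite V0 memv0.
Qed.

Section Modules.
Variables (k : fieldType) (A : falgType k).
Implicit Types M N P : lmodule A.

Section Action.
Variable M : lmodule A.
Lemma actD a b (v : M) : lm_act M (a + b) v = lm_act M a v + lm_act M b v.
Proof. by rewrite linearD add_lfunE. Qed.
Lemma actB a b (v : M) : lm_act M (a - b) v = lm_act M a v - lm_act M b v.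
Proof. by rewrite linearB add_lfunE opp_lfunE. Qed.
Lemma actZ c a (v : M) : lm_act M (c *: a) v = c *: lm_act M a v.
Proof. by rewrite linearZ scale_lfunE. Qed.
Lemma act1 (v : M) : lm_act M 1 v = v.
Proof. by rewrite lm_act1 id_lfunE. Qed.
Lemma actM a b (v : M) : lm_act M (a * b) v = lm_act M a (lm_act M b v).
Proof. by rewrite lm_actM comp_lfunE. Qed.
Lemma act_linear v : linear (fun a => lm_act M a v).
Proof. by move=> c a b; rewrite actD actZ. Qed.

Lemma sm_act (N : submod M) a v : v \in (N : {vspace M}) ->
  lm_act M a v \in (N : {vspace M}).
Proof. by move=> Nv; apply: subvP (sm_stable N a) _ _; apply: memv_img. Qed.

Definition stable_space (U : {vspace M}) : Prop :=
  forall a v, v \in U -> lm_act M a v \in U.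

Fact stable_submod_subproof (U : {vspace M}) : stable_space U ->
  forall a, (lm_act M a @: U <= U)%VS.
Proof. by move=> hU a; apply/subvP => _ /memv_imgP[v Uv ->]; apply: hU. Qed.
Definition stable_submod (U : {vspace M}) (hU : stable_space U) : submod M :=
  Submod (stable_submod_subproof hU).

Lemma stable_add (N N' : submod M) : stable_space (N + N').
Proof.
move=> a _ /memv_addP[u Nu [v Nv ->]].
by rewrite lfunD memv_add ?sm_act.
Qed.
Definition submod_add (N N' : submod M) := stable_submod (@stable_add N N').

Lemma stable_cap (N N' : submod M) : stable_space (N :&: N').
Proof. by move=> a v /memv_capP[Nv N'v]; rewrite memv_cap !sm_act. Qed.
Definition submod_cap (N N' : submod M) := stable_submod (@stable_cap N N').

Lemma stable_sum (I : finType) (P : pred I) (F : I -> submod M) :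
  stable_space (\sum_(i | P i) F i).
Proof.
move=> a _ /memv_sumP[v Fv ->]; rewrite lfun_sum; apply: memv_suml => i Pi.
by apply: subvP (sumv_sup i Pi (subvv _)) _ _; apply: sm_act; apply: Fv.
Qed.
Definition submod_sum (I : finType) (P : pred I) (F : I -> submod M) :=
  stable_submod (@stable_sum I P F).
End Action.

Lemma is_hom_id M : is_hom (\1%VF : 'End(M)).
Proof. by move=> a v; rewrite !id_lfunE. Qed.

Lemma is_hom_comp M N P (f : 'Hom(M, N)) (g : 'Hom(N, P)) :
  is_hom f -> is_hom g -> is_hom (g \o f)%VF.
Proof. by move=> hf hg a v; rewrite !comp_lfunE hf hg. Qed.

Lemma is_hom_scale M N c (f : 'Hom(M, N)) : is_hom f -> is_hom (c *: f).
Proof. by move=> hf a v; rewrite !scale_lfunE hf lfunZ. Qed.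

Lemma is_hom_inv M N (f : 'Hom(M, N)) :
  is_hom f -> injective f -> limg f = fullv -> is_hom (f^-1)%VF.
Proof.
move=> hf fi ff a v; apply: fi.
by rewrite hf !limg_lfunVK ?ff ?memvf.
Qed.

Lemma misoP M N : miso M N <->
  exists f : 'Hom(M, N), [/\ is_hom f, injective f & limg f = fullv].
Proof.
split=> [[f hf [g fK gK]] | [f [hf fi ff]]].
  exists f; split=> //; first exact: can_inj fK.
  by apply/limg_fullP => w; exists (g w).
by exists f => //; apply: lfun_bij.
Qed.

Lemma miso_refl M : miso M M.
Proof. by exists \1%VF; [apply: is_hom_id | exists id => v; rewrite id_lfunE]. Qed.

Lemma miso_sym M N : miso M N -> miso N M.
Proof.
move/misoP=> [f [hf fi ff]]; exists (f^-1)%VF; first exact: is_hom_inv.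
exists f => v; first by rewrite limg_lfunVK ?ff ?memvf.
by apply: fi; rewrite inv_lfunK.
Qed.

Lemma miso_trans M N P : miso M N -> miso N P -> miso M P.
Proof.
move=> [f hf fb] [g hg gb]; exists (g \o f)%VF; first exact: is_hom_comp.
apply: (@eq_bij _ _ (g \o f)) => [|v]; last by rewrite comp_lfunE.
exact: bij_comp.
Qed.

Lemma stable_ker M N (f : 'Hom(M, N)) : is_hom f -> stable_space (lker f).
Proof. by move=> hf a v /[!memv_ker]/eqP fv; rewrite hf fv lfun0. Qed.
Definition submod_ker M N (f : 'Hom(M, N)) (hf : is_hom f) :=
  stable_submod (@stable_ker M N f hf).

Lemma stable_img M N (f : 'Hom(M, N)) (X : submod M) :
  is_hom f -> stable_space (f @: X)%VS.
Proof.
by move=> hf a _ /memv_imgP[v Xv ->]; rewrite -hf memv_img ?sm_act.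
Qed.
Definition submod_img M N (f : 'Hom(M, N)) X (hf : is_hom f) :=
  stable_submod (@stable_img M N f X hf).

(** Equivariance of [f] is asked only on [N]: the maps at hand, such as [subquot_pi], are defined on
    all of [M] but commute with the action only there. *)
Lemma subquot_iso M (N N' : submod M) (D : lmodule A) (f : 'Hom(M, D)) :
    (forall a v, v \in (N : {vspace M}) -> f (lm_act M a v) = lm_act D a (f v)) ->
    (forall d, exists2 v, v \in (N : {vspace M}) & f v = d) ->
    (forall v, v \in (N : {vspace M}) -> f v = 0 -> v \in (N' : {vspace M})) ->
    (forall v, v \in (N' : {vspace M}) -> f v = 0) ->
  miso (subquot N N') D.
Proof.
move=> hf fs fN fN'; apply/misoP.
have inN (x : subquot N N') : vsval x \in (N : {vspace M}).
  by apply: subvP (diffvSl N N') _ (subvsP x).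
have f_pi v : v \in (N : {vspace M}) -> f (vsval (subquot_pi N N' v)) = f v.
  move=> Nv; apply/esym/eqP; rewrite -subr_eq0 -lfunB; apply/eqP/fN'.
  exact: subquot_pi_rem.
pose g : 'Hom(subquot N N', D) := (f \o linfun vsval)%VF.
have gE x : g x = f (vsval x) by rewrite comp_lfunE (lfunE vsval).
exists g; split=> [a x | x y | ].
- rewrite !gE -[lm_act _ a x]/(subquot_act N N' a x) subquot_actE.
  by rewrite f_pi ?sm_act // hf.
- rewrite !gE => /eqP; rewrite -subr_eq0 -lfunB => /eqP f0.
  have /subquot_pi_eq0 -/(_ N) : vsval x - vsval y \in (N' : {vspace M}).
    by apply: fN f0; rewrite memvB ?inN.
  rewrite lfunB !subquot_pi_vsval.
  by move/eqP; rewrite subr_eq0 => /eqP.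
apply/limg_fullP => d; have [v Nv <-] := fs d.
by exists (subquot_pi N N' v); rewrite gE f_pi.
Qed.

Lemma quot_iso M (K : submod M) (D : lmodule A) (f : 'Hom(M, D)) :
  is_hom f -> limg f = fullv -> lker f = K -> miso (quot K) D.
Proof.
move=> hf /limg_fullP ff fK; apply: (@subquot_iso _ _ _ _ f) => //.
- by move=> d; have [v <-] := ff d; exists v => //; apply: memvf.
- by move=> v _ fv; rewrite -fK memv_ker fv.
by move=> v; rewrite -fK memv_ker => /eqP.
Qed.

Lemma subquot_pi_surj M (N N' : submod M) (x : subquot N N') :
  exists2 v, v \in (N : {vspace M}) & subquot_pi N N' v = x.
Proof.
exists (vsval x); last exact: subquot_pi_vsval.
exact: subvP (diffvSl N N') _ (subvsP x).
Qed.

Lemma subquot_pi_full M (N N' : submod M) : limg (subquot_pi N N') = fullv.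
Proof. by apply/limg_fullP => x; have [v _ <-] := subquot_pi_surj x; exists v. Qed.

Lemma lker_quot_pi M (K : submod M) : lker (subquot_pi (submodT M) K) = K.
Proof.
apply/eqP; rewrite eqEsubv; apply/andP; split; apply/subvP => v; last first.
  by rewrite memv_ker => /subquot_pi_eq0 ->.
rewrite memv_ker => /eqP v0; have := @subquot_pi_rem _ _ M (submodT M) K v.
by rewrite v0 subr0 memvf; apply.
Qed.

Lemma quot_pi_hom M (K : submod M) :
  is_hom (subquot_pi (submodT M) K : 'Hom(M, quot K)).
Proof. by move=> a v; apply: subquot_pi_act; apply: memvf. Qed.

(** Zero counts as an atom, so that the image of a simple module under any homomorphism is one. *)
Definition atom M (N : submod M) : Prop :=
  forall X : submod M, (X <= N)%VS -> X = 0%VS :> {vspace M} \/ X = N :> {vspace M}.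

Lemma simple_subquot M (N N' : submod M) :
    (N' <= N)%VS -> N' <> N :> {vspace M} ->
    (forall X : submod M, (N' <= X <= N)%VS ->
       X = N' :> {vspace M} \/ X = N :> {vspace M}) ->
  simple (subquot N N').
Proof.
move=> sN'N neq between; split.
  apply/dim_neq0P; have /subvPn[v Nv N'v] : ~~ (N <= N')%VS.
    by apply/negP => sNN'; apply: neq; apply/eqP; rewrite eqEsubv sN'N.
  exists (subquot_pi N N' v); apply: contra N'v => /eqP v0.
  by have := subquot_pi_rem N' Nv; rewrite v0 subr0.
move=> X.
pose Y : {vspace M} := (N :&: (subquot_pi N N' @^-1: X))%VS.
have YP v : v \in (N : {vspace M}) ->
    (v \in Y) = (subquot_pi N N' v \in (X : {vspace _})).
  by move=> Nv; rewrite memv_cap Nv -memv_preim.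
have YN v : v \in Y -> v \in (N : {vspace M}) by case/memv_capP.
have hY : stable_space Y.
  move=> a v Yv; have Nv := YN _ Yv; rewrite YP ?sm_act //.
  rewrite subquot_pi_act //; apply: (sm_act (N := X)).
  by rewrite -YP.
have [|eY|eY] := between (stable_submod hY).
- apply/andP; split; last by apply/subvP => v /YN.
  apply/subvP => v N'v; rewrite YP ?(subvP sN'N) //.
  by rewrite subquot_pi_eq0 ?mem0v.
- left; apply/eqP; rewrite -subv0; apply/subvP => x Xx.
  have [v Nv vx] := subquot_pi_surj x.
  have : v \in (stable_submod hY : {vspace M}) by rewrite [X in _ \in X]/= YP ?vx.
  by rewrite eY => /subquot_pi_eq0-/(_ N); rewrite vx => ->; rewrite mem0v.
right; apply/vspaceP => x; rewrite memvf.
have [v Nv <-] := subquot_pi_surj x.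
have : v \in (stable_submod hY : {vspace M}) by rewrite eY.
by rewrite [X in _ \in X -> _]/= YP.
Qed.

Lemma ex_atom M (N : submod M) : N <> 0%VS :> {vspace M} ->
  exists N1 : submod M, [/\ (N1 <= N)%VS, N1 <> 0%VS :> {vspace M} & atom N1].
Proof.
have [n] := ubnP (\dim N); elim: n N => // n IHn N ltn N0.
case: (classic (atom N)) => [aN | naN]; first by exists N; split.
have [X [sX X0 XN]] : exists X : submod M,
    [/\ (X <= N)%VS, X <> 0%VS :> {vspace M} & X <> N :> {vspace M}].
  apply: NNPP => nX; apply: naN => X sX.
  case: (classic (X = 0%VS :> {vspace M})) => [|X0]; first by left.
  case: (classic (X = N :> {vspace M})) => [|XN]; first by right.
  by case: nX; exists X.
have ltX : (\dim X < \dim N)%N.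
  rewrite ltn_neqAle dimvS // andbT; apply/eqP => eX; apply: XN; apply/eqP.
  by rewrite -(geq_leqif (dimv_leqif_eq sX)) eX.
have [N1 [sN1 N10 aN1]] := IHn X (leq_trans ltX ltn) X0.
by exists N1; split=> //; apply: subv_trans sX.
Qed.

Lemma ex_coatom M (N : submod M) : N <> fullv :> {vspace M} ->
  exists N1 : submod M, [/\ (N <= N1)%VS, N1 <> fullv :> {vspace M} &
    forall X : submod M, (N1 <= X)%VS -> X = N1 :> {vspace M} \/ X = fullv :> {vspace M}].
Proof.
have [n] := ubnP (dim M - \dim N)%N; elim: n N => // n IHn N ltn N0.
case: (classic (forall X : submod M, (N <= X)%VS ->
         X = N :> {vspace M} \/ X = fullv :> {vspace M})) => [aN | naN].
  by exists N; split.
have [X [sX X0 XN]] : exists X : submod M,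
    [/\ (N <= X)%VS, X <> fullv :> {vspace M} & X <> N :> {vspace M}].
  apply: NNPP => nX; apply: naN => X sX.
  case: (classic (X = N :> {vspace M})) => [|X0]; first by left.
  case: (classic (X = fullv :> {vspace M})) => [|XN]; first by right.
  by case: nX; exists X.
have ltX : (\dim N < \dim X)%N.
  rewrite ltn_neqAle dimvS // andbT; apply/eqP => eX; apply: XN; apply/esym/eqP.
  by rewrite -(geq_leqif (dimv_leqif_eq sX)) eX.
have leX : (\dim X <= dim M)%N by rewrite -dimvf dimvS ?subvf.
have [|N1 [sN1 N10 aN1]] := IHn X _ X0.
  by apply: leq_trans (ltn_sub2l _ ltX) _ => //; apply: leq_trans leX.
by exists N1; split=> //; apply: subv_trans sX _.
Qed.

Lemma submod_incl (M : lmodule A) (N : submod M) :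
  exists i : 'Hom(subquot N (submod0 M), M),
    [/\ is_hom i, injective i & limg i = N].
Proof.
pose g : 'Hom(subquot N (submod0 M), M) := linfun vsval.
have gE x : g x = vsval x by rewrite lfunE.
have inN x : g x \in (N : {vspace M}).
  by rewrite gE; apply: subvP (diffvSl _ _) _ (subvsP x).
have pE v : v \in (N : {vspace M}) -> g (subquot_pi N (submod0 M) v) = v.
  move=> Nv; have := subquot_pi_rem (submod0 M) Nv.
  by rewrite gE memv0 subr_eq0 => /eqP <-.
exists g; split=> [a x | x y |].
- rewrite -[lm_act _ a x]/(subquot_act _ _ a x) subquot_actE pE ?gE //.
  by apply: sm_act; rewrite -gE.
- by rewrite !gE => /val_inj.
apply/eqP; rewrite eqEsubv limg_sub //=; apply/subvP => v Nv.
by rewrite -(pE v Nv) mem_limg.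
Qed.

Section SimpleFamily.
Variables (I : finType) (S : I -> lmodule A).
Hypothesis allS : forall M, simple M -> exists i, miso M (S i).

Lemma ex_simple_sub M (N : submod M) : N <> 0%VS :> {vspace M} ->
  exists i (f : 'Hom(S i, M)), [/\ is_hom f, injective f & (limg f <= N)%VS].
Proof.
case/ex_atom => N1 [sN1 N10 aN1].
have sim : simple (subquot N1 (submod0 M)).
  apply: simple_subquot => [||X /andP[_ /aN1]//]; first exact: sub0v.
  by move=> e; apply: N10; rewrite -e.
have [i /miso_sym/misoP[f [hf fi _]]] := allS sim.
have [g [hg gi gN]] := submod_incl N1.
exists i, (g \o f)%VF; split=> [|u v|]; first exact: is_hom_comp.
  by rewrite !comp_lfunE => /gi/fi.
apply: subv_trans sN1; rewrite -gN; apply: limg_sub => v.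
by rewrite comp_lfunE mem_limg.
Qed.

Lemma ex_simple_quo M (N : submod M) : N <> fullv :> {vspace M} ->
  exists i (f : 'Hom(M, S i)), [/\ is_hom f, limg f = fullv & (N <= lker f)%VS].
Proof.
case/ex_coatom => N1 [sN1 N10 aN1].
have sim : simple (subquot (submodT M) N1).
  by apply: simple_subquot => [||X /andP[/aN1]//]; first exact: subvf.
have [i /misoP[f [hf fi /limg_fullP ff]]] := allS sim.
exists i, (f \o subquot_pi (submodT M) N1)%VF; split.
- exact: is_hom_comp (quot_pi_hom N1) hf.
- apply/limg_fullP => w; have [x <-] := ff w.
  by have [v _ <-] := subquot_pi_surj x; exists v; rewrite comp_lfunE.
apply/subvP => v Nv; rewrite memv_ker comp_lfunE subquot_pi_eq0 ?lfun0 //.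
exact: subvP sN1 _ _.
Qed.

End SimpleFamily.

Section Schur.
Variables (M N : lmodule A) (f : 'Hom(M, N)).
Hypotheses (hf : is_hom f) (f0 : f <> 0).

Lemma simple_hom_inj : simple M -> injective f.
Proof.
case=> _ /(_ (submod_ker hf))[|] /= k0; first exact/lker0_inj.
case: f0; apply/lfunP => v; apply/eqP.
by rewrite zero_lfunE -memv_ker k0 memvf.
Qed.

Lemma simple_hom_surj : simple N -> limg f = fullv.
Proof.
case=> _ /(_ (submod_img (submodT M) hf))[|] //= k0; case: f0.
by apply/lfunP => v; apply/eqP; rewrite zero_lfunE -memv0 -k0 mem_limg.
Qed.

Lemma simple_hom_miso : simple M -> simple N -> miso M N.
Proof.
move=> sM sN; apply/misoP; exists f; split=> //.
  exact: simple_hom_inj.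
exact: simple_hom_surj.
Qed.

End Schur.

Lemma miso_simple M N : miso M N -> simple M -> simple N.
Proof.
case/misoP => f [hf fi ff] [M0 sM]; split.
  have /dim_neq0P[v v0] := M0; apply/dim_neq0P; exists (f v).
  by apply: contraNneq v0 => fv; apply/eqP/fi; rewrite fv lfun0.
move=> X.
have hX : stable_space (f @^-1: X).
  by move=> a v; rewrite -!memv_preim hf => Xv; apply: sm_act.
have fV w : f ((f^-1)%VF w) = w by rewrite limg_lfunVK // ff memvf.
case: (sM (stable_submod hX)) => /= eX; [left | right]; apply/vspaceP => w.
  rewrite -{1}(fV w) memv_preim eX !memv0; apply/eqP/eqP => [w0 | ->].
    by rewrite -(fV w) w0 lfun0.
  by apply: fi; rewrite fV lfun0.
by rewrite -{1}(fV w) memv_preim eX !memvf.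
Qed.

Lemma miso_projective M N : miso M N -> projective M -> projective N.
Proof.
case/misoP => e [he ei ef] pM X Y g f hg gf hf.
have [h hh gh] := pM X Y g (f \o e)%VF hg gf (is_hom_comp he hf).
exists (h \o e^-1)%VF; first by apply: is_hom_comp hh; apply: is_hom_inv.
apply/lfunP => v; rewrite comp_lfunA gh !comp_lfunE.
by rewrite limg_lfunVK // ef memvf.
Qed.

Lemma miso_projective_cover P M N : miso M N ->
  projective_cover P M -> projective_cover P N.
Proof.
case/misoP => e [he ei /limg_fullP ef] [pP [p [hp /limg_fullP pf sp]]]; split=> //.
exists (e \o p)%VF; split; first exact: is_hom_comp.
  apply/limg_fullP => w; have [v <-] := ef w; have [u <-] := pf v.
  by exists u; rewrite comp_lfunE.
suff -> : lker (e \o p)%VF = lker p by [].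
apply/vspaceP => v; rewrite !memv_ker comp_lfunE.
by apply/eqP/eqP => [e0 | ->]; [apply: ei; rewrite e0 lfun0 | rewrite lfun0].
Qed.

End Modules.

Section Restriction.
Variable k : fieldType.

Record alghom (C D : falgType k) := AlgHom {
  ah_fun :> 'Hom(C, D);
  ah_one : ah_fun 1 = 1;
  ah_mul : forall x y, ah_fun (x * y) = ah_fun x * ah_fun y
}.

Variables (C D : falgType k) (h : alghom C D).

Section Resmod.
Variable M : lmodule D.

Definition resmod_act (c : C) : 'End(M) := lm_act M (h c).
Fact resmod_linear : linear resmod_act.
Proof. by move=> a x y; rewrite /resmod_act !linearP. Qed.
Fact resmod_act1 : resmod_act 1 = \1%VF.
Proof. by rewrite /resmod_act ah_one lm_act1. Qed.
Fact resmod_actM x y : resmod_act (x * y) = (resmod_act x \o resmod_act y)%VF.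
Proof. by rewrite /resmod_act ah_mul lm_actM. Qed.
Definition resmod : lmodule C := LModule resmod_linear resmod_act1 resmod_actM.
End Resmod.

Lemma resmod_hom (M N : lmodule D) (f : 'Hom(M, N)) :
  is_hom f -> @is_hom _ _ (resmod M) (resmod N) f.
Proof. by move=> hf a v; apply: hf. Qed.

(** Surjectivity is required only on the operators on [M]: the inclusion of a subalgebra reaches all
    of them as soon as it is onto modulo the radical. *)
Lemma resmod_simple (M : lmodule D) :
  (forall d, exists c, lm_act M (h c) = lm_act M d) ->
  simple M -> simple (resmod M).
Proof.
move=> hs [M0 sM]; split=> // X.
have hX : @stable_space _ _ M X.
  by move=> d v Xv; have [c <-] := hs d; apply: (@sm_act _ _ (resmod M)).
exact: sM (stable_submod hX).
Qed.

End Restriction.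

(** * Density and the radical *)

Section Coordinates.
Variables (k : fieldType) (V : vectType k).

Definition bvec (i : 'I_(dim V)) : V := r2v (delta_mx 0 i).

Lemma v2r_bvec i j : v2r (bvec i) 0 j = (j == i)%:R.
Proof. by rewrite r2vK mxE eqxx. Qed.

Lemma bvec_sum v : v = \sum_i v2r v 0 i *: bvec i.
Proof.
rewrite -[LHS](v2rK v) [v2r v]row_sum_delta linear_sum.
by apply: eq_bigr => i _; rewrite linearZ -row_sum_delta.
Qed.

Lemma bvec_ext (W : vectType k) (f g : 'Hom(V, W)) :
  (forall i, f (bvec i) = g (bvec i)) -> f = g.
Proof.
move=> fg; apply/lfunP => v; rewrite (bvec_sum v) !lfun_sum.
by apply: eq_bigr => i _; rewrite !lfunZ fg.
Qed.

Definition rank1_fun (W : vectType k) (i : 'I_(dim V)) (w : W) (v : V) : W :=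
  v2r v 0 i *: w.
(** [rank1 i (bvec j)] is the matrix unit sending the [i]-th basis vector to the [j]-th. *)
Definition rank1 (W : vectType k) i (w : W) : 'Hom(V, W) := linfun (rank1_fun i w).

Lemma rank1E (W : vectType k) i (w : W) v : rank1 i w v = v2r v 0 i *: w.
Proof.
by rewrite linfun_linear // => c x y; rewrite /rank1_fun linearP !mxE scalerDl scalerA.
Qed.

Lemma rank1_linear (W : vectType k) i : linear (@rank1 W i).
Proof.
move=> c u w; apply/lfunP => v.
by rewrite add_lfunE scale_lfunE !rank1E scalerDr !scalerA mulrC.
Qed.

Lemma lfun_rank1_sum (W : vectType k) (f : 'Hom(V, W)) :
  f = \sum_i rank1 i (f (bvec i)).
Proof.
apply: bvec_ext => i; rewrite sum_lfunE (bigD1 i) //= rank1E v2r_bvec eqxx scale1r.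
rewrite big1 ?addr0 // => j ji.
by rewrite rank1E v2r_bvec (negPf ji) scale0r.
Qed.

End Coordinates.

(** Algebraic closedness enters here: the characteristic polynomial has size [dim V + 1], hence a
    root as soon as [V] is nonzero. *)
Lemma lfun_eigenvalue (k : closedFieldType) (V : vectType k) (f : 'End(V)) :
  dim V != 0%N -> exists (c : k) (v : V), v != 0 /\ f v = c *: v.
Proof.
move=> V0; pose g := lin1_mx (v2r \o f \o r2v).
have [c cg] : exists c, root (char_poly g) c.
  by apply/closed_rootP; rewrite size_char_poly.
move: cg; rewrite -eigenvalue_root_char => /eigenvalueP[u uc u0].
exists c, (r2v u); split.
  by rewrite -(inj_eq (@v2r_inj _ _)) r2vK linear0.
by apply: v2r_inj; move: uc; rewrite mul_rV_lin1 /= => ->; rewrite linearZ /= r2vK.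
Qed.

Lemma schur_scalar (k : closedFieldType) (A : falgType k) (M : lmodule A)
    (f : 'End(M)) :
  simple M -> is_hom f -> exists c, f = c *: \1%VF.
Proof.
move=> sM hf; have [M0 _] := sM.
have [c [v [v0 fv]]] := lfun_eigenvalue f M0; exists c.
have hg : is_hom (f - c *: \1%VF : 'End(M)).
  by move=> a w; rewrite !add_lfunE !opp_lfunE !scale_lfunE !id_lfunE hf lfunB lfunZ.
apply: NNPP => nf; have g0 : f - c *: \1%VF <> 0.
  by move/eqP; rewrite subr_eq0 => /eqP.
have /(_ v 0) := simple_hom_inj hg g0 sM.
rewrite lfun0 add_lfunE opp_lfunE scale_lfunE id_lfunE fv subrr => /(_ erefl) ve.
by rewrite ve eqxx in v0.
Qed.

(** * Jacobson density for finite families of simple modules *)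

Section Density.
Variables (k : closedFieldType) (A : falgType k) (I : finType).
Variable S : I -> lmodule A.
Hypothesis simpleS : forall i, simple (S i).
Hypothesis injS : forall i j, miso (S i) (S j) -> i = j.

Let pt := {i : I & lm_sort (S i)}.
Let pnt i (w : S i) : pt := existT (fun i => lm_sort (S i)) i w.

Definition act_at (M : lmodule A) (v : M) : 'Hom(A, M) :=
  linfun (fun a => lm_act M a v).

Lemma act_atE (M : lmodule A) (v : M) a : act_at v a = lm_act M a v.
Proof. by rewrite (linfun_linear (act_linear v)). Qed.

Definition ann (s : seq pt) : {vspace A} :=
  (\bigcap_(p <- s) lker (act_at (tagged p)))%VS.

Lemma annS i (w : S i) s a :
  a \in ann (pnt w :: s) <-> lm_act (S i) a w = 0 /\ a \in ann s.
Proof.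
rewrite /ann big_cons memv_cap memv_ker act_atE /=.
by split=> [/andP[/eqP] | [-> ->]] //; rewrite eqxx.
Qed.

Lemma ann_ideal s a b : b \in ann s -> a * b \in ann s.
Proof.
elim: s => [|[i w] s IHs]; first by rewrite /ann big_nil !memvf.
by move/annS => [bw /IHs bs]; apply/annS; rewrite actM bw lfun0.
Qed.

(* Jacobson density: the vectors killed by the annihilator of s are the
   combinations of those in s, so they are killed by all f killing s. *)
Lemma density_ann (f : forall i, 'End(S i)) s i (v : S i) :
    (forall p, List.In p s -> f (tag p) (tagged p) = 0) ->
    (forall a, a \in ann s -> lm_act (S i) a v = 0) ->
  f i v = 0.
Proof.
elim: s i v => [|[j w] s IHs] i v fs sv.
  by rewrite -(act1 v) sv ?lfun0 // /ann big_nil memvf.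
have {}IHs i' (v' : S i') : (forall a, a \in ann s -> lm_act (S i') a v' = 0) ->
    f i' v' = 0.
  by apply: IHs => p ps; apply: fs; right.
have fw : f j w = 0 by apply: (fs (pnt w)); left.
(* [U = L w] is a submodule of [S j]. If it is zero, [w] imposes no condition beyond those of [s];
   otherwise it is all of [S j]. *)
pose L := ann s; pose U := (act_at w @: L)%VS.
have hU : stable_space U.
  move=> a _ /memv_imgP[b Lb ->]; rewrite act_atE -actM -act_atE.
  by rewrite memv_img ?ann_ideal.
have [_ /(_ (stable_submod hU))/=[U0|UT]] := simpleS j.
  apply: IHs => a sa; apply: sv; apply/annS; split=> //.
  by apply/eqP; rewrite -act_atE -memv0 -U0 memv_img.
pose g := (act_at w \o projv L)%VF; pose g' := (g^-1)%VF.
(* The map [a w |-> a v] for [a] in [L]: [g'] picks such an [a], and by [sv] the value depends only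
   on [a w]. *)
pose h := (act_at v \o projv L \o g')%VF : 'Hom(S j, S i).
have hE a : a \in L -> h (lm_act (S j) a w) = lm_act (S i) a v.
  move=> La; rewrite !comp_lfunE act_atE; set b := projv L _.
  have Lb : b \in L by apply: memv_proj.
  apply/eqP; rewrite -subr_eq0 -actB; apply/eqP/sv/annS.
  split; last by rewrite memvB.
  have gb : lm_act (S j) a w \in limg g.
    by apply/memv_imgP; exists a; rewrite ?memvf // comp_lfunE projv_id // act_atE.
  have := limg_lfunVK gb; rewrite comp_lfunE act_atE -/g' -/b actB => ->.
  by rewrite subrr.
have Usurj u : exists2 a, a \in L & lm_act (S j) a w = u.
  have /memv_imgP[a La ->] : u \in U by rewrite UT memvf.
  by exists a => //; rewrite act_atE.
have hh : is_hom h.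
  move=> a u; have [b Lb <-] := Usurj u.
  by rewrite -actM !hE ?ann_ideal // actM.
(* For [j = i], [h] is a scalar [c] by Schur, so [v - c w] is killed by [ann s] and the induction
   hypothesis applies; for [j != i], [h] vanishes and [v] itself is killed by [ann s]. *)
case: (eqVneq j i) => [ji | ij].
  destruct ji; have [c hc] := schur_scalar (simpleS j) hh.
  have : f j (v - c *: w) = 0.
    apply: IHs => a La; rewrite lfunB lfunZ -hE // hc scale_lfunE id_lfunE.
    by rewrite subrr.
  by rewrite lfunB lfunZ fw scaler0 subr0.
have h0 : h = 0.
  apply: NNPP => h0; case/eqP: ij; apply: injS.
  exact: simple_hom_miso hh h0 (simpleS j) (simpleS i).
by apply: IHs => a La; rewrite -hE // h0 zero_lfunE.
Qed.

(** Among the basis vectors of all the [S j], let [s] omit only the [b]-th one of [S i]. By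
    [density_ann], [ann s] does not kill that vector, hence by simplicity it moves it to any [u]. *)
Lemma density_rank1 i (b : 'I_(dim (S i))) (u : S i) :
  exists a, lm_act (S i) a = rank1 b u /\ forall j, j != i -> lm_act (S j) a = 0.
Proof.
pose ix := {j : I & 'I_(dim (S j))}.
pose mk j (c : 'I_(dim (S j))) : ix := Tagged (fun j => 'I_(dim (S j))) c.
have mkE j (c d : 'I_(dim (S j))) : (mk j c == mk j d) = (c == d).
  exact: eq_Tagged.
pose ib := mk i b.
pose e (p : ix) : pt := pnt (bvec (tagged p)).
pose s := [seq e p | p <- enum (predC1 ib)].
have sP a : a \in ann s -> forall p, p != ib ->
    lm_act (S (tag p)) a (bvec (tagged p)) = 0.
  move=> + p pb; have : p \in enum (predC1 ib) by rewrite mem_enum.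
  rewrite /s; elim: (enum _) => //= q r IHr.
  by rewrite inE => /predU1P[<- | /IHr rp] /annS[] // _ /rp.
pose U := (act_at (bvec b) @: ann s)%VS.
have hU : stable_space U.
  move=> a _ /memv_imgP[c Lc ->]; rewrite act_atE -actM -act_atE.
  by rewrite memv_img ?ann_ideal.
have [_ /(_ (stable_submod hU))/=[U0|UT]] := simpleS i.
  (* The projection onto the [b]-th line of [S i], zero on the other modules; the sum over [c]
     avoids transporting [b] along [j = i]. *)
  pose f j : 'End(S j) := \sum_(c | mk j c == ib) rank1 c (bvec c).
  suff /eqP : f i (bvec b) = 0.
    rewrite sum_lfunE (big_pred1 b) => [|c]; last by rewrite mkE.
    rewrite rank1E v2r_bvec eqxx scale1r => b0.
    have := v2r_bvec b b; rewrite (eqP b0) linear0 mxE eqxx => /eqP.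
    by rewrite eq_sym oner_eq0.
  apply: (density_ann (s := s)) => [p | a sa]; last first.
    by apply/eqP; rewrite -act_atE -memv0 -U0 memv_img.
  rewrite /s; have : forall q, q \in enum (predC1 ib) -> q != ib.
    by move=> q; rewrite mem_enum.
  elim: (enum _) => //= q r IHr nr [<- | ]; last first.
    by apply: IHr => x xr; apply: nr; rewrite inE xr orbT.
  rewrite /= sum_lfunE big1 // => c /eqP eb.
  rewrite rank1E v2r_bvec; case: eqP => [ec|]; last by rewrite scale0r.
  have := nr q (mem_head _ _); rewrite -eb ec.
  by case: (q) => /= x y; rewrite eqxx.
have /memv_imgP[a La ua] : u \in U by rewrite UT memvf.
rewrite act_atE in ua.
exists a; split=> [|j ji]; apply: bvec_ext => c.
  rewrite rank1E v2r_bvec; case: eqP => [<-|/eqP bc]; first by rewrite scale1r.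
  rewrite scale0r; apply: (sP a La (mk i c)); apply: contra bc.
  by rewrite mkE eq_sym.
rewrite zero_lfunE; apply: (sP a La (mk j c)); apply: contra ji.
by move/eqP => e'; rewrite -[j]/(tag (mk j c)) e'.
Qed.

Lemma density i (f : 'End(S i)) :
  exists a, lm_act (S i) a = f /\ forall j, j != i -> lm_act (S j) a = 0.
Proof.
have /fin_all_exists[a aP] : forall b : 'I_(dim (S i)), exists a,
    lm_act (S i) a = rank1 b (f (bvec b)) /\
    forall j, j != i -> lm_act (S j) a = 0.
  by move=> b; apply: density_rank1.
exists (\sum_b a b); split=> [|j ji]; rewrite linear_sum.
  rewrite [RHS]lfun_rank1_sum; apply: eq_bigr => b _.
  by have [] := aP b.
by rewrite big1 // => b _; exact: (proj2 (aP b)).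
Qed.

(** A lift to [A] of each factor [End(S i)] of [A / rad], chosen linear in [f]; it is multiplicative
    only modulo the radical. *)
Lemma density_linear : exists E : forall i, 'Hom('End(S i), A),
  forall i f, lm_act (S i) (E i f) = f /\
              forall j, j != i -> lm_act (S j) (E i f) = 0.
Proof.
apply: (@fin_all_exists _ (fun i => 'Hom('End(S i), A))
  (fun i E => forall f, lm_act (S i) (E f) = f /\
              forall j, j != i -> lm_act (S j) (E f) = 0)) => i.
pose Ai := (\bigcap_(j | j != i) lker (linfun (lm_act (S j))))%VS.
have AiP a : a \in Ai <-> forall j, j != i -> lm_act (S j) a = 0.
  split=> [/subv_bigcapP aA j ji | aj].
    have := aA j ji; rewrite -memvE memv_ker lfunE => /eqP.
    exact.
  rewrite memvE; apply/subv_bigcapP => j ji.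
  by rewrite -memvE memv_ker lfunE /= aj.
pose R := (linfun (lm_act (S i)) \o projv Ai)%VF.
exists (projv Ai \o R^-1)%VF => f.
rewrite comp_lfunE; split; last by apply/AiP/memv_proj.
have : f \in limg R.
  have [a [<- /AiP aA]] := density f; apply/memv_imgP; exists a; first exact: memvf.
  by rewrite comp_lfunE projv_id // lfunE.
by move/limg_lfunVK; rewrite comp_lfunE (lfunE (lm_act (S i))).
Qed.

End Density.

Lemma burnside (k : closedFieldType) (A : falgType k) (M : lmodule A)
    (f : 'End(M)) :
  simple M -> exists a, lm_act M a = f.
Proof.
move=> sM; have [|i j _|a [<- _]] := @density _ A unit (fun _ => M) _ _ tt f => //.
  by case: i; case: j.
by exists a.
Qed.

(** * The radical: quasi-inverses and Nakayama's lemma *)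

Section Radical.
Variables (k : fieldType) (A : falgType k) (I : finType).
Variable S : I -> lmodule A.
Hypothesis simpleS : forall i, simple (S i).
Hypothesis allS : forall M : lmodule A, simple M -> exists i, miso M (S i).

Lemma regmod_actE a x : lm_act (regmod A) a x = a * x.
Proof. by rewrite [LHS]lfunE. Qed.

Lemma amulrE (u x : A) : amulr u x = x * u.
Proof. by rewrite lfunE. Qed.

Lemma amullE (u x : A) : amull u x = u * x.
Proof. by rewrite lfunE. Qed.

Definition rad : {vspace A} := (\bigcap_i lker (linfun (lm_act (S i))))%VS.

Lemma radP a : a \in rad <-> forall i, lm_act (S i) a = 0.
Proof.
split=> [/subv_bigcapP aA i | aj].
  by have := aA i isT; rewrite -memvE memv_ker lfunE => /eqP.
rewrite memvE; apply/subv_bigcapP => j _.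
by rewrite -memvE memv_ker lfunE /= aj.
Qed.

Lemma radMl a x : x \in rad -> a * x \in rad.
Proof. by move/radP => xr; apply/radP => i; rewrite lm_actM xr comp_lfun0r. Qed.

Lemma radMr a x : x \in rad -> x * a \in rad.
Proof. by move/radP => xr; apply/radP => i; rewrite lm_actM xr comp_lfun0l. Qed.

Lemma simple_neq0 (M : lmodule A) : simple M -> exists v : M, v != 0.
Proof. by case=> /dim_neq0P. Qed.

(** If the left ideal generated by [1 - n] were proper, some simple quotient [f] of [A] would kill
    it; but [n] acts as zero there, so [f 1 = 0] and then [f = 0]. *)
Lemma rad_left_inv n : n \in rad -> exists b, b * (1 - n) = 1.
Proof.
move=> nr; pose U : {vspace regmod A} := limg (amulr (1 - n)).
have hU : stable_space U.
  move=> a _ /memv_imgP[x _ ->]; apply/memv_imgP; exists (a * x); first exact: memvf.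
  by rewrite regmod_actE !amulrE mulrA.
case: (classic (stable_submod hU = fullv :> {vspace regmod A})) => [UT | nUT].
  have : (1 : regmod A) \in (stable_submod hU : {vspace _}) by rewrite UT memvf.
  by case/memv_imgP => b _; rewrite amulrE => e; exists b.
have [i [f [hf /limg_fullP ff /subvP Uf]]] := ex_simple_quo allS nUT.
have fE a : f a = lm_act (S i) a (f (1 : A)).
  by rewrite -hf regmod_actE mulr1.
have f1 : f (1 : A) = 0.
  have : f (1 - n) = 0.
    apply/eqP; rewrite -memv_ker; apply: Uf; apply/memv_imgP.
    by exists 1; rewrite ?memvf // amulrE mul1r.
  by rewrite lfunB (fE n) (proj1 (radP n) nr) zero_lfunE subr0.
have [v v0] := simple_neq0 (simpleS i); have [a av] := ff v.
by rewrite -av fE f1 lfun0 eqxx in v0.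
Qed.

(** A nonzero left ideal [K] has a simple quotient; [rad] annihilates it, so [rad * K] stays in the
    kernel. *)
Lemma rad_nakayama (K : {vspace A}) :
    (forall a x, x \in K -> a * x \in K) -> (K <= rad * K)%VS -> K = 0%VS.
Proof.
move=> Kid KJ.
have hK : @stable_space _ _ (regmod A) K.
  by move=> a x Kx; rewrite regmod_actE; apply: Kid.
pose N := stable_submod hK; pose Q := subquot N (submod0 (regmod A)).
apply: NNPP => K0.
have nQ : submod0 Q <> fullv :> {vspace Q}.
  move=> Q0; apply: K0; apply/eqP; rewrite -subv0; apply/subvP => x Kx.
  have /eqP x0 : subquot_pi N (submod0 (regmod A)) x == 0.
    by rewrite -memv0 -[0%VS]/(sm_space (submod0 Q)) Q0 memvf.
  have := @subquot_pi_rem _ _ (regmod A) N (submod0 _) x Kx.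
  by rewrite x0 subr0.
have [i [f [hf /limg_fullP ff _]]] := ex_simple_quo allS nQ.
pose g : 'Hom(A, S i) := (f \o subquot_pi N (submod0 (regmod A)))%VF.
have gE x : g x = f (subquot_pi N (submod0 (regmod A)) x) by rewrite comp_lfunE.
have gM a x : x \in K -> g (a * x) = lm_act (S i) a (g x).
  move=> Kx; rewrite !gE.
  by rewrite -regmod_actE subquot_pi_act // -hf.
have gK : (K <= lker g)%VS.
  apply: subv_trans KJ _; apply/prodvP => j x jr Kx.
  by rewrite memv_ker gM // (proj1 (radP j) jr) zero_lfunE.
have [v v0] := simple_neq0 (simpleS i); have [q qv] := ff v.
have [x Kx xq] := subquot_pi_surj q.
have := subvP gK _ Kx; rewrite memv_ker gE xq qv.
by rewrite (negPf v0).
Qed.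

End Radical.

(** * Algebras presented as tensor products *)

Record algiso (k : fieldType) (C D : falgType k) := AlgIso {
  ai_hom :> alghom C D;
  ai_inv : alghom D C;
  ai_homK : cancel ai_hom ai_inv;
  ai_invK : cancel ai_inv ai_hom
}.

Section SubmoduleInclusion.
Variables (k : fieldType) (A : falgType k).

(** The lifting property for a map that is onto only between submodules; in the case needed these
    are the [A']-linear maps inside the module of all linear maps. *)
Lemma projective_lift_sub (P M N : lmodule A) (X : submod M) (Y : submod N)
    (g : 'Hom(M, N)) (f : 'Hom(P, N)) :
    projective P -> is_hom g -> is_hom f ->
    (g @: X)%VS = Y -> (limg f <= Y)%VS ->
  exists h : 'Hom(P, M), [/\ is_hom h, (g \o h)%VF = f & (limg h <= X)%VS].
Proof.
move=> pP hg hf gX fY.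
have [i [hi _ iX]] := submod_incl X; have [j [hj jj jY]] := submod_incl Y.
have jV y : y \in (Y : {vspace N}) -> j ((j^-1)%VF y) = y.
  by move=> Yy; rewrite limg_lfunVK // jY.
have iXx x : i x \in (X : {vspace M}) by rewrite -iX mem_limg.
have gY x : g (i x) \in (Y : {vspace N}) by rewrite -gX memv_img.
pose g0 := (j^-1 \o g \o i)%VF; pose f0 := (j^-1 \o f)%VF.
have jg x : j (g0 x) = g (i x) by rewrite !comp_lfunE jV.
have jf x : j (f0 x) = f x by rewrite comp_lfunE jV // (subvP fY) ?mem_limg.
have hg0 : is_hom g0 by move=> a x; apply: jj; rewrite hj !jg hi hg.
have hf0 : is_hom f0 by move=> a x; apply: jj; rewrite hj !jf hf.
have g0T : limg g0 = fullv.
  apply/limg_fullP => y.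
  have : j y \in (g @: X)%VS by rewrite gX -jY mem_limg.
  case/memv_imgP => x; rewrite -iX => /memv_imgP[x' _ ->] jy.
  by exists x'; apply: jj; rewrite jg.
have [h hh gh] := pP _ _ g0 f0 hg0 g0T hf0.
exists (i \o h)%VF; split; first exact: is_hom_comp.
  apply/lfunP => x; rewrite 2!comp_lfunE -jg -jf -gh.
  by rewrite [in RHS]comp_lfunE.
by apply: limg_sub => x; rewrite comp_lfunE.
Qed.

Section HomModule.
Variables (V : vectType k) (M : lmodule A).
Definition hom_act_fun (a : A) (f : 'Hom(V, M)) : 'Hom(V, M) := (lm_act M a \o f)%VF.
Definition hom_act (a : A) : 'End('Hom(V, M)) := linfun (hom_act_fun a).
Lemma hom_actE a f v : hom_act a f v = lm_act M a (f v).
Proof.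
rewrite linfun_linear ?comp_lfunE // => c g h.
by rewrite /hom_act_fun comp_lfunDr -comp_lfunZr.
Qed.
Fact hom_act_linear : linear hom_act.
Proof.
move=> c a b; apply/lfunP => f; apply/lfunP => v.
by rewrite add_lfunE scale_lfunE !hom_actE add_lfunE scale_lfunE !hom_actE actD actZ.
Qed.
Fact hom_act1 : hom_act 1 = \1%VF.
Proof.
by apply/lfunP => f; apply/lfunP => v; rewrite hom_actE act1 id_lfunE.
Qed.
Fact hom_actM a b : hom_act (a * b) = (hom_act a \o hom_act b)%VF.
Proof.
by apply/lfunP => f; apply/lfunP => v; rewrite comp_lfunE !hom_actE actM.
Qed.
Definition hom_mod : lmodule A := LModule hom_act_linear hom_act1 hom_actM.
End HomModule.

End SubmoduleInclusion.

Section Slices.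
Variable k : fieldType.

Definition tens_rfun (V W : vectType k) (w : W) : 'Hom(V, tensor V W) :=
  linfun (fun v => tens v w).
Definition tens_lfun (V W : vectType k) (v : V) : 'Hom(W, tensor V W) :=
  linfun (fun w => tens v w).
Lemma tens_rfunE (V W : vectType k) (w : W) (v : V) : tens_rfun V w v = tens v w.
Proof. by rewrite (linfun_linear (tens_linearl w)). Qed.
Lemma tens_lfunE (V W : vectType k) (w : W) (v : V) : tens_lfun W v w = tens v w.
Proof. by rewrite (linfun_linear (tens_linearr v)). Qed.

Variables (V W V' W' : vectType k) (f : 'Hom(tensor V V', tensor W W')).

Definition slicel (w : V') j : 'Hom(V, W) := (ctrr W j \o f \o tens_rfun V w)%VF.
Definition slicer (v : V) j : 'Hom(V', W') := (ctrl W' j \o f \o tens_lfun V' v)%VF.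

Lemma slicelE w j v : slicel w j v = ctrr W j (f (tens v w)).
Proof. by rewrite !comp_lfunE tens_rfunE. Qed.
Lemma slicerE v j w : slicer v j w = ctrl W' j (f (tens v w)).
Proof. by rewrite !comp_lfunE tens_lfunE. Qed.

End Slices.

Section TensorPresentation.
Variables (k : fieldType) (A A' C : falgType k).
Variable t : algiso (tensalg A A') C.

Definition incl_fun : 'Hom(A, C) := linfun (fun a => t (tens a 1)).
Definition incr_fun : 'Hom(A', C) := linfun (fun a => t (tens 1 a)).

Lemma incl_funE a : incl_fun a = t (tens a 1).
Proof.
rewrite linfun_linear // => c x y.
by rewrite (tens_linearl (1 : A') c x y) lfunD lfunZ.
Qed.

Lemma incr_funE a : incr_fun a = t (tens 1 a).
Proof.
rewrite linfun_linear // => c x y.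
by rewrite (tens_linearr (1 : A) c x y) lfunD lfunZ.
Qed.

Lemma tensalg_mulE (a b : A) (a' b' : A') :
  (tens a a' : tensalg A A') * tens b b' = tens (a * b) (a' * b').
Proof. exact: tens_mulE. Qed.

Fact incl_one : incl_fun 1 = 1.
Proof. by rewrite incl_funE -[tens 1 1]/(1 : tensalg A A') ah_one. Qed.
Fact incr_one : incr_fun 1 = 1.
Proof. by rewrite incr_funE -[tens 1 1]/(1 : tensalg A A') ah_one. Qed.
Fact incl_mul x y : incl_fun (x * y) = incl_fun x * incl_fun y.
Proof. by rewrite !incl_funE -ah_mul tensalg_mulE mulr1. Qed.
Fact incr_mul x y : incr_fun (x * y) = incr_fun x * incr_fun y.
Proof. by rewrite !incr_funE -ah_mul tensalg_mulE mulr1. Qed.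

Definition incl : alghom A C := AlgHom incl_one incl_mul.
Definition incr : alghom A' C := AlgHom incr_one incr_mul.

Lemma inclE a : incl a = t (tens a 1). Proof. exact: incl_funE. Qed.
Lemma incrE a : incr a = t (tens 1 a). Proof. exact: incr_funE. Qed.

Lemma incl_incr a a' : incl a * incr a' = t (tens a a').
Proof. by rewrite inclE incrE -ah_mul tensalg_mulE mulr1 mul1r. Qed.

Lemma incr_incl a a' : incr a' * incl a = t (tens a a').
Proof. by rewrite inclE incrE -ah_mul tensalg_mulE mulr1 mul1r. Qed.

Lemma pres_memv (E : vectType k) (g : C -> E) (U : {vspace E}) :
  linear g -> (forall a a', g (incl a * incr a') \in U) -> forall c, g c \in U.
Proof.
move=> lg gU c; rewrite -(ai_invK t c); move: (ai_inv t c) => X.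
apply: (@tens_memv _ _ _ _ (fun X => g (t X))) => [d x y | a a'].
  by rewrite lfunD lfunZ lg.
by rewrite -incl_incr.
Qed.

Lemma pres_hom (X Y : lmodule C) (f : 'Hom(X, Y)) :
    (forall a v, f (lm_act X (incl a) v) = lm_act Y (incl a) (f v)) ->
    (forall a v, f (lm_act X (incr a) v) = lm_act Y (incr a) (f v)) ->
  is_hom f.
Proof.
move=> fl fr c v; apply/eqP; rewrite -subr_eq0 -memv0; move: c.
apply: pres_memv => [d x y | a a'].
  by rewrite !actD !actZ lfunD lfunZ scalerBr opprD addrACA.
by rewrite !actM fl fr subrr mem0v.
Qed.

Lemma pres_stable (X : lmodule C) (U : {vspace X}) :
    (forall a v, v \in U -> lm_act X (incl a) v \in U) ->
    (forall a v, v \in U -> lm_act X (incr a) v \in U) ->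
  stable_space U.
Proof.
move=> Ul Ur c v Uv; move: c.
apply: pres_memv => [d x y | a a']; first by rewrite actD actZ.
by rewrite actM; apply: Ul; apply: Ur.
Qed.

Section TensorModules.

Definition tmod (M : lmodule A) (M' : lmodule A') : lmodule C := resmod (ai_inv t) (tensmod M M').

Lemma tmod_act (M : lmodule A) (M' : lmodule A') a a' X :
  lm_act (tmod M M') (t (tens a a')) X = tmap (lm_act M a) (lm_act M' a') X.
Proof.
rewrite -[lm_act _ _]/(tensmod_act M M' (ai_inv t (t (tens a a')))) ai_homK.
have /lfunP -> // : tensmod_act M M' (tens a a') = tmap (lm_act M a) (lm_act M' a').
by apply: tensor_ext => v w; rewrite tensmod_actE tmapE.
Qed.

Lemma tmod_actl (M : lmodule A) (M' : lmodule A') a X :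
  lm_act (tmod M M') (incl a) X = tmap (lm_act M a) \1%VF X.
Proof. by rewrite inclE tmod_act lm_act1. Qed.

Lemma tmod_actr (M : lmodule A) (M' : lmodule A') a X :
  lm_act (tmod M M') (incr a) X = tmap \1%VF (lm_act M' a) X.
Proof. by rewrite incrE tmod_act lm_act1. Qed.

Lemma tmod_tens (M : lmodule A) (M' : lmodule A') a a' v w :
  lm_act (tmod M M') (t (tens a a')) (tens v w) =
    tens (lm_act M a v) (lm_act M' a' w).
Proof. by rewrite tmod_act tmapE. Qed.

Lemma tmod_tensl (M : lmodule A) (M' : lmodule A') a v w :
  lm_act (tmod M M') (incl a) (tens v w) = tens (lm_act M a v) w.
Proof. by rewrite tmod_actl tmapE id_lfunE. Qed.

Lemma tmod_tensr (M : lmodule A) (M' : lmodule A') a v w :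
  lm_act (tmod M M') (incr a) (tens v w) = tens v (lm_act M' a w).
Proof. by rewrite tmod_actr tmapE id_lfunE. Qed.

Lemma tmap_hom (M N : lmodule A) (M' N' : lmodule A') (f : 'Hom(M, N)) (g : 'Hom(M', N')) :
  is_hom f -> is_hom g -> @is_hom _ _ (tmod M M') (tmod N N') (tmap f g).
Proof.
move=> hf hg; apply: pres_hom => a X.
  rewrite !tmod_actl -!comp_lfunE -!tmap_comp comp_lfun1l comp_lfun1r.
  by congr (tmap _ _ X); apply/lfunP => v; rewrite !comp_lfunE hf.
rewrite !tmod_actr -!comp_lfunE -!tmap_comp comp_lfun1l comp_lfun1r.
by congr (tmap _ _ X); apply/lfunP => v; rewrite !comp_lfunE hg.
Qed.

Lemma slicel_hom (M N : lmodule A) (M' N' : lmodule A')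
    (f : 'Hom(tmod M M', tmod N N')) (w : M') j :
  is_hom f -> @is_hom _ _ M N (slicel f w j).
Proof. by move=> hf a v; rewrite !slicelE -tmod_tensl hf tmod_actl ctrr_tmap. Qed.

Lemma slicer_hom (M N : lmodule A) (M' N' : lmodule A')
    (f : 'Hom(tmod M M', tmod N N')) (v : M) j :
  is_hom f -> @is_hom _ _ M' N' (slicer f v j).
Proof. by move=> hf a w; rewrite !slicerE -tmod_tensr hf tmod_actr ctrl_tmap. Qed.

(* Hom_C(P (x) P', X) = Hom_A(P, Hom_A'(P', X)). *)
Lemma projective_tmod (P : lmodule A) (P' : lmodule A') :
  projective P -> projective P' -> projective (tmod P P').
Proof.
move=> pP pP' X Y g f hg gT hf.
have HP (Z : lmodule C) (u : 'Hom(P', Z)) :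
    reflect (@is_hom _ _ P' (resmod incr Z) u) (u \in hom_space P' (resmod incr Z)).
  exact: hom_spaceP.
have hE (Z : lmodule C) a (u : 'Hom(P', Z)) v :
    (lm_act (hom_mod P' (resmod incl Z)) a u : 'Hom(P', Z)) v =
      lm_act Z (incl a) (u v).
  exact: hom_actE.
have hH (Z : lmodule C) : @stable_space _ _ (hom_mod P' (resmod incl Z))
    (hom_space P' (resmod incr Z)).
  move=> a u /HP hu; apply/HP => b v.
  rewrite !hE hu -[lm_act (resmod incr Z) b _]/(lm_act Z (incr b) _).
  rewrite -[lm_act (resmod incr Z) b _]/(lm_act Z (incr b) _).
  by rewrite -!actM incl_incr -incr_incl.
pose gs : 'Hom(hom_mod P' (resmod incl X), hom_mod P' (resmod incl Y)) :=
  linfun (fun u : 'Hom(P', X) => (g \o u)%VF).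
have gsE (u : 'Hom(P', X)) v : (gs u : 'Hom(P', Y)) v = g (u v).
  rewrite linfun_linear ?comp_lfunE // => c x y.
  by rewrite comp_lfunDr -comp_lfunZr.
pose fs : 'Hom(P, hom_mod P' (resmod incl Y)) :=
  linfun (fun p => (f \o tens_lfun P' p : 'Hom(P', Y))%VF).
have fsE p v : (fs p : 'Hom(P', Y)) v = f (tens p v).
  rewrite linfun_linear ?comp_lfunE ?tens_lfunE // => c x y.
  apply/lfunP => w; rewrite add_lfunE scale_lfunE !comp_lfunE !tens_lfunE.
  by rewrite tensDl tensZl lfunD lfunZ.
have hgs : is_hom gs.
  move=> a u; apply/lfunP => v.
  by rewrite hE !gsE hE; apply: hg.
have hfs : is_hom fs.
  move=> a p; apply/lfunP => v.
  by rewrite fsE hE fsE -tmod_tensl hf.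
have [|| h [hh gh hX]] := @projective_lift_sub k A P _ _
    (stable_submod (hH X)) (stable_submod (hH Y)) gs fs pP hgs hfs.
(* Projectivity of [P']: every [A']-linear map into [Y] is [g] after an [A']-linear map into [X]. *)
- apply/eqP; rewrite eqEsubv; apply/andP; split; apply/subvP.
    move=> _ /memv_imgP[u /HP hu ->]; apply/HP => a v.
    by rewrite !gsE hu; apply: hg.
  move=> u /HP hu.
  have [u' hu' gu'] := pP' (resmod incr X) (resmod incr Y) g u
    (@resmod_hom _ _ _ incr _ _ _ hg) gT hu.
  apply/memv_imgP; exists u'; first exact/HP.
  by apply/lfunP => v; rewrite gsE -gu' comp_lfunE.
- apply: limg_sub => p; apply/HP => a v.
  by rewrite !fsE -tmod_tensr hf.
pose F : 'Hom(tmod P P', X) := tlift (fun p v => (h p : 'Hom(P', X)) v).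
have FE p v : F (tens p v) = (h p : 'Hom(P', X)) v.
  rewrite tliftE // => [w | w] c x y; last by rewrite lfunD lfunZ.
  by rewrite lfunD lfunZ add_lfunE scale_lfunE.
exists F.
- apply: pres_hom => a Z; apply/eqP; rewrite -subr_eq0 -memv0; move: Z.
    apply: tens_memv => [c x y | p v].
      by rewrite !(lfunD, lfunZ) scalerBr opprD addrACA.
    by rewrite tmod_tensl !FE hh hE subrr mem0v.
  apply: tens_memv => [c x y | p v].
    by rewrite !(lfunD, lfunZ) scalerBr opprD addrACA.
  rewrite tmod_tensr !FE.
  have /HP -> : h p \in hom_space P' (resmod incr X).
    by apply: (subvP hX); rewrite mem_limg.
  by rewrite subrr mem0v.
apply: tensor_ext => p v; rewrite comp_lfunE FE -gsE.
by rewrite -fsE -gh comp_lfunE.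
Qed.

End TensorModules.

End TensorPresentation.

(** * Standard modules and filtrations of tensor products *)

Section Chains.
Variables (k : fieldType) (A : falgType k) (I : finType) (M : lmodule A).
Variables (D : I -> lmodule A) (X : pred I).

(** A form of [filtered_by] with two free ends, so that pieces can be concatenated. Ends are
    compared as subspaces because a [submod] also carries a stability proof. *)
Inductive chain : submod M -> submod M -> Prop :=
| chain_nil (U V : submod M) : U = V :> {vspace M} -> chain U V
| chain_cons (U W V : submod M) j : (U <= W)%VS -> X j ->
    miso (subquot W U) (D j) -> chain W V -> chain U V.

Lemma subquot_ext (N1 N2 N1' N2' : submod M) :
  N1 = N2 :> {vspace M} -> N1' = N2' :> {vspace M} ->
  miso (subquot N1 N1') (subquot N2 N2').
Proof.
move=> e e'.
apply: (@subquot_iso _ _ M N1 N1' (subquot N2 N2') (subquot_pi N2 N2'));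
  rewrite ?e ?e'.
- by move=> a v Nv; apply: subquot_pi_act.
- by move=> d; have [v Nv <-] := subquot_pi_surj d; exists v.
- by move=> v Nv v0; have := subquot_pi_rem N2' Nv; rewrite v0 subr0.
by move=> v; apply: subquot_pi_eq0.
Qed.

Lemma chain_extl (U U' V : submod M) :
  U' = U :> {vspace M} -> chain U V -> chain U' V.
Proof.
move=> eU c; case: c eU => [{}U {}V e | {}U W {}V j sUW Xj iso c] eU.
  by apply: chain_nil; rewrite eU.
apply: chain_cons c => //; [by rewrite eU | exact: Xj |].
by apply: miso_trans iso; apply: subquot_ext.
Qed.

Lemma chain_trans (U W V : submod M) : chain U W -> chain W V -> chain U V.
Proof.
elim=> {U W} [U W e | U W W' j sUW Xj iso _ IH]; first exact: chain_extl.
by move/IH; apply: chain_cons iso.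
Qed.

Lemma chain_step (U V : submod M) j :
  (U <= V)%VS -> X j -> miso (subquot V U) (D j) -> chain U V.
Proof. by move=> sUV Xj iso; apply: chain_cons iso _ => //; apply: chain_nil. Qed.

Lemma chain_extr (U V V' : submod M) :
  chain U V -> V = V' :> {vspace M} -> chain U V'.
Proof. by move=> c e; apply: chain_trans c _; apply: chain_nil. Qed.

Lemma filtered_chain (K : submod M) :
  filtered_by K D X -> chain (submod0 M) K.
Proof.
case=> n [F [F0 Fn step]].
apply: (@chain_extl (F 0%N)) => //; apply: (@chain_extr _ (F n)) => //.
have {F0 Fn} : forall m, (m <= n)%N -> chain (F (n - m)%N) (F n).
  elim=> [|m IHm] mn; first by rewrite subn0; apply: chain_nil.
  apply: chain_trans (IHm (ltnW mn)).
  have [] := step (n - m.+1)%N; first by rewrite ltn_subrL /=; case: (n) mn.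
  by rewrite -subSn // subSS => sF [j Xj iso]; apply: chain_step iso.
by move/(_ n (leqnn n)); rewrite subnn.
Qed.

Lemma chain_filtered (U V : submod M) : chain U V -> U = 0%VS :> {vspace M} ->
  filtered_by V D X.
Proof.
move=> c U0; suff [n [F [F0 Fn step]]] : exists (n : nat) (F : nat -> submod M),
    [/\ F 0%N = U :> {vspace M}, F n = V :> {vspace M}
      & forall t, (t < n)%N ->
          (F t <= F t.+1)%VS /\
          exists2 j, X j & miso (subquot (F t.+1) (F t)) (D j)].
  by exists n, F; split; rewrite // F0.
elim: {U0} c => {U V} [U V e | U W V j sUW Xj iso _ [n [F [F0 Fn step]]]].
  by exists 0%N, (fun _ => U); split.
exists n.+1, (fun t => if t is s.+1 then F s else U); split=> // [[|t]] /=.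
  rewrite F0; split=> //; exists j => //.
  by apply: miso_trans iso; apply: subquot_ext.
by rewrite ltnS; apply: step.
Qed.

End Chains.

Section Covers.
Variables (k : fieldType) (A : falgType k).

(** Otherwise [r] maps the kernel of [p] onto the simple [T], so [ker r + ker p] is everything, and
    superfluity forces [ker r] to be everything. *)
Lemma superfluous_ker_simple (P L T : lmodule A) (p : 'Hom(P, L)) (r : 'Hom(P, T)) v :
    is_hom p -> superfluous (lker p) -> simple T -> is_hom r ->
  p v = 0 -> r v = 0.
Proof.
move=> hp sp sT hr pv; apply/eqP; apply: contraT => rv.
have r0 : r <> 0 by move=> r0; rewrite r0 zero_lfunE eqxx in rv.
have [_ /(_ (submod_img (submod_ker hp) hr))/=[e|e]] := sT.
  by rewrite -memv0 -e memv_img // memv_ker pv in rv.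
have /sp/= : (submod_ker hr + lker p = fullv)%VS.
  apply/vspaceP => x; rewrite memvf.
  have : r x \in (r @: lker p)%VS by rewrite e memvf.
  case/memv_imgP => y py rxy; rewrite -[x](subrK y); apply: memv_add => //.
  by rewrite memv_ker lfunB rxy subrr.
by move=> kT; have := memvf v; rewrite -kT memv_ker (negPf rv).
Qed.

Lemma End_iso_fieldP (D : lmodule A) : End_iso_field D <->
  dim D != 0%N /\ forall f : 'End(D), is_hom f -> exists c, f = c *: \1%VF.
Proof.
split=> [[t [tl [t1 _] ti tP]] | [D0 hD]].
  have t0 : t 0 = 0.
    have := tl 0 0 (0); rewrite mulr0 addr0 scale0r => e.
    have := tl 1 0 0; rewrite mulr0 addr0 scale1r => {}e.
    by apply: (@addrI _ (t 0)); rewrite addr0 -e.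
  have tc c : t c = c *: \1%VF by have := tl c 1 0; rewrite mulr1 addr0 t0 addr0 t1.
  split; last by move=> f /tP[c ->]; exists c.
  apply/dim_neq0P; apply: NNPP => nD.
  have /ti/eqP : t 1 = t 0.
    apply/lfunP => v; rewrite t1 t0 id_lfunE zero_lfunE; apply/eqP.
    by apply: contraT => v0; case: nD; exists v.
  by rewrite oner_eq0.
exists (fun c => c *: \1%VF); split=> [a b c | | a b | f].
- by rewrite scalerDl scalerA.
- split=> [|a b]; first by rewrite scale1r.
  by rewrite -comp_lfunZl -comp_lfunZr comp_lfun1l scalerA.
- have /dim_neq0P[v v0] := D0.
  move=> /lfunP/(_ v)/eqP; rewrite !scale_lfunE id_lfunE -subr_eq0 -scalerBl.
  by rewrite scaler_eq0 (negPf v0) orbF subr_eq0 => /eqP.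
split=> [/hD | [c ->]] //.
by apply: is_hom_scale; apply: is_hom_id.
Qed.

End Covers.

Section TensorProducts.
Variables (k : fieldType) (A A' C : falgType k).
Variable t : algiso (tensalg A A') C.
Notation tmod := (tmod t).

Lemma tmod_miso (M N : lmodule A) (M' N' : lmodule A') :
  miso M N -> miso M' N' -> miso (tmod M M') (tmod N N').
Proof.
case/misoP => f [hf fi ff] /misoP[g [hg gi gf]]; apply/misoP.
by exists (tmap f g); split; [apply: tmap_hom | apply: tmap_inj | apply: tmap_surj].
Qed.

Lemma stable_tsub (M : lmodule A) (M' : lmodule A') (N : submod M) (N' : submod M') :
  @stable_space _ _ (tmod M M') (tsub N N').
Proof.
apply: (pres_stable (t := t)) => a.
  apply: tsub_ind => [|v w Nv Nw]; first exact: linearP.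
  by rewrite tmod_tensl mem_tsub ?sm_act.
apply: tsub_ind => [|v w Nv Nw]; first exact: linearP.
by rewrite tmod_tensr mem_tsub ?sm_act.
Qed.
Definition tsubm M M' N N' : submod (tmod M M') :=
  stable_submod (@stable_tsub M M' N N').

Definition glue (M : lmodule A) (M' : lmodule A') (U V : submod M) (U' : submod M') :
    submod (tmod M M') :=
  submod_add (tsubm U (submodT M')) (tsubm V U').

Lemma glueS (M : lmodule A) (M' : lmodule A') (U V : submod M) (U' V' : submod M') :
  (U' <= V')%VS -> (glue U V U' <= glue U V V')%VS.
Proof. by move=> s; apply: addvS => //; apply: tsubS. Qed.

(** The isomorphism is induced by [pi (x) pi']. Outside [V'] the map [pi'] need not be equivariant,
    but there the first tensor factor lies in [U] and is killed by [pi]. *)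
Lemma subquot_glue (M : lmodule A) (M' : lmodule A') (U V : submod M)
    (U' V' : submod M') :
  (U <= V)%VS -> (U' <= V')%VS ->
  miso (subquot (glue U V V') (glue U V U')) (tmod (subquot V U) (subquot V' U')).
Proof.
move=> sUV sU'V'; pose f := tmap (subquot_pi V U) (subquot_pi V' U').
have fT v w : f (tens v w) = tens (subquot_pi V U v) (subquot_pi V' U' w).
  exact: tmapE.
have glP (E : vectType k) (g : tensor M M' -> E) (Z : {vspace E}) (W' : submod M') :
    linear g ->
    (forall v w, v \in (U : {vspace M}) -> g (tens v w) \in Z) ->
    (forall v w, v \in (V : {vspace M}) -> w \in (W' : {vspace M'}) ->
       g (tens v w) \in Z) ->
    forall x, x \in (glue U V W' : {vspace _}) -> g x \in Z.
  move=> lg gU gV _ /memv_addP[x Ux [y Vy ->]].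
  have /= := lg 1 x y; rewrite !scale1r => ->; apply: memvD.
    by apply: (tsub_ind lg _ Ux) => v w Uv _; apply: gU.
  by apply: (tsub_ind lg _ Vy).
apply: (@subquot_iso _ _ (tmod M M') _ _ (tmod (subquot V U) (subquot V' U')) f).
- move=> c x Nx; apply/eqP; rewrite -subr_eq0 -memv0; move: c.
  apply: (pres_memv (t := t)) => [d c1 c2 | a a'].
    by rewrite !actD !actZ lfunD lfunZ scalerBr opprD addrACA.
  rewrite incl_incr; move: x Nx; apply: glP => [d x y | v w Uv | v w Vv Vw].
  + by rewrite !(lfunD, lfunZ) scalerBr opprD addrACA.
  + rewrite tmod_tens !fT tmod_tens (subquot_pi_eq0 _ Uv) lfun0.
    by rewrite (subquot_pi_eq0 _ (sm_act _ Uv)) !tens0l subrr mem0v.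
  by rewrite tmod_tens !fT tmod_tens !subquot_pi_act // subrr mem0v.
- move=> d; suff: d \in (f @: glue U V V')%VS by case/memv_imgP => x Nx ->; exists x.
  move: d; apply: (@tens_memv _ _ _ _ id) => // x y.
  have [v Vv <-] := subquot_pi_surj x; have [w Vw <-] := subquot_pi_surj y.
  rewrite -fT memv_img //; apply: subvP (addvSr _ _) _ _.
  exact: mem_tsub.
- move=> x Nx fx.
  (* With the linear sections [s], [s'] of the projections, [x - (s (x) s') (f x)] lies in the
     smaller submodule for every [x] of the larger one; this is checked on generators. *)
  pose s : 'Hom(subquot V U, M) := linfun vsval.
  pose s' : 'Hom(subquot V' U', M') := linfun vsval.
  have sE y : s y = vsval y by rewrite lfunE.
  have s'E y : s' y = vsval y by rewrite lfunE.
  suff : x - tmap s s' (f x) \in (glue U V U' : {vspace _}).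
    by rewrite fx lfun0 subr0.
  move: x Nx {fx}; apply: glP => [d x y | v w Uv | v w Vv Vw].
  + by rewrite !(lfunD, lfunZ) scalerBr opprD addrACA.
  + rewrite fT (subquot_pi_eq0 _ Uv) tens0l lfun0 subr0.
    apply: subvP (addvSl _ _) _ _; apply: mem_tsub => //; exact: memvf.
  rewrite fT tmapE; set v' := s _; set w' := s' _.
  have -> : tens v w - tens v' w' = tens (v - v') w + tens v' (w - w').
    by rewrite tensBl tensBr addrA subrK.
  apply: memv_add; apply: mem_tsub; rewrite ?memvf //.
  + by rewrite /v' sE subquot_pi_rem.
  + by rewrite /v' sE; apply: subvP (diffvSl _ _) _ (subvsP _).
  by rewrite /w' s'E subquot_pi_rem.
move=> x Nx; apply/eqP; rewrite -memv0; move: x Nx.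
apply: glP => [|v w Uv | v w Vv Uw]; first exact: linearP.
  by rewrite fT (subquot_pi_eq0 _ Uv) tens0l mem0v.
by rewrite fT (subquot_pi_eq0 _ Uw) tens0r mem0v.
Qed.

Section ChainProducts.
Variables (I I' : finType) (D : I -> lmodule A) (D' : I' -> lmodule A').
Variables (M : lmodule A) (M' : lmodule A').
Let D2 (x : I * I') := tmod (D x.1) (D' x.2).

Lemma chain_glue (Y' : pred I') (Y : pred (I * I')) (U V : submod M)
    (U' V' : submod M') j :
    (U <= V)%VS -> miso (subquot V U) (D j) -> (forall j', Y' j' -> Y (j, j')) ->
  chain D' Y' U' V' -> chain D2 Y (glue U V U') (glue U V V').
Proof.
move=> sUV iso YY; elim=> {U' V'} [U' V' e | U' W' V' j' sUW Yj' iso' _ IH].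
  by apply: chain_nil; rewrite /= e.
apply: chain_trans IH; apply: (@chain_step _ _ _ _ _ _ _ _ (j, j')).
- exact: glueS.
- exact: YY.
by apply: miso_trans (subquot_glue sUV sUW) _; apply: tmod_miso.
Qed.

Lemma chain_tsub (X : pred I) (X' : pred I') (Y : pred (I * I')) (U V : submod M) :
    (forall j j', X j -> X' j' -> Y (j, j')) ->
    chain D' X' (submod0 M') (submodT M') -> chain D X U V ->
  chain D2 Y (tsubm U (submodT M')) (tsubm V (submodT M')).
Proof.
move=> XY c'; elim=> {U V} [U V e | U W V j sUW Xj iso _ IH].
  by apply: chain_nil; rewrite /= e.
apply: chain_trans IH.
(* Refinement of the step from [U] to [W]: [glue U W] runs from [U (x) M'] at zero to [W (x) M'] at
   the whole of [M']. *)
have c : chain D2 Y (glue U W (submod0 M')) (glue U W (submodT M')).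
  by apply: chain_glue iso _ c' => // j'; apply: XY.
apply: (@chain_extr _ _ _ _ _ _ _ (glue U W (submodT M'))).
  by apply: chain_extl c; rewrite /= tsub0r addv0.
by rewrite /=; apply/addv_idPr/tsubS.
Qed.

End ChainProducts.

End TensorProducts.

(** * Simple modules and projective covers over a tensor product *)

Section SimpleTensor.
Variables (k : closedFieldType) (A A' C : falgType k).
Variable t : algiso (tensalg A A') C.
Notation tmod := (tmod t).

Lemma tmap_rank1 (V W V' W' : vectType k) i j (u : V') (u' : W') (X : tensor V W) :
  tmap (rank1 i u) (rank1 j u') X = v2r (ctrr V j X) 0 i *: tens u u'.
Proof.
move: X; apply: tensor_extf => [|c X Y | v w]; first exact: linearP.
  by rewrite lfunD lfunZ linearD linearZ !mxE scalerDl scalerA.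
by rewrite tmapE !rank1E tensZl tensZr scalerA ctrrE linearZ mxE mulrC.
Qed.

(** A nonzero [X] in [N] has a nonzero entry [(i, j)]. By Burnside's theorem some element acts as
    [rank1 i u (x) rank1 j u']; it extracts that entry, so [N] contains [u (x) u']. *)
Lemma simple_tmod (M : lmodule A) (M' : lmodule A') :
  simple M -> simple M' -> simple (tmod M M').
Proof.
move=> sM sM'; split.
  have [v v0] := simple_neq0 sM; have [w w0] := simple_neq0 sM'.
  apply/dim_neq0P; exists (tens v w).
  by rewrite [_ == _]tens_eq0 (negPf v0).
move=> N; case: (eqVneq (N : {vspace _}) 0%VS) => [->|N0]; [by left | right].
have X0 : vpick N != 0 by rewrite vpick0.
have NX := memv_pick N; move: (vpick N) X0 NX => X X0 NX.
have [j Xj] : exists j, ctrr M j X != 0.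
  apply: NNPP => nj; case/eqP: X0; apply: ctrr_eq => j; rewrite lfun0.
  by apply/eqP; apply: contraT => Xj; case: nj; exists j.
have [i Xij] := coord_neq0 Xj.
apply/vspaceP => Y; rewrite memvf.
move: Y; apply: (@tens_memv _ _ _ _ id) => // u u'.
have [a au] := burnside (rank1 i u) sM; have [a' au'] := burnside (rank1 j u') sM'.
have : lm_act (tmod M M') (t (tens a a')) X \in (N : {vspace _}) by apply: sm_act.
rewrite tmod_act au au' tmap_rank1 => /(memvZ (v2r (ctrr M j X) 0 i)^-1).
by rewrite scalerA mulVf // scale1r.
Qed.

Variables (I I' : finType) (S : I -> lmodule A) (S' : I' -> lmodule A').
Hypotheses (rS : simple_reps S) (rS' : simple_reps S').

Lemma simple_reps_separate (B : falgType k) (J : finType) (T : J -> lmodule B) i j :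
  simple_reps T -> i != j -> exists a, lm_act (T i) a = \1%VF /\ lm_act (T j) a = 0.
Proof.
case=> sT iT _ ij; have [a [a1 a0]] := density sT iT (\1%VF : 'End(T i)).
by exists a; rewrite a1 a0 // eq_sym.
Qed.

(** Completeness: a simple [M] contains some [S i] over [A]; the [A']-module of [A]-linear maps
    [S i -> M] is then nonzero and contains some [S' i'], and evaluation is a nonzero map from
    [S i (x) S' i'] to [M]. *)
Lemma simple_reps_tmod : simple_reps (fun x : I * I' => tmod (S x.1) (S' x.2)).
Proof.
have [sS iS allS] := rS; have [sS' iS' allS'] := rS'.
split=> [x | [i i'] [j j'] /misoP[e [he ei _]] | M sM].
- exact: simple_tmod.
- have [v v0] := simple_neq0 (sS i); have [v' v'0] := simple_neq0 (sS' i').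
  have ne0 : e (tens v v') != 0.
    apply/eqP => e0; have /eqP : tens v v' = 0 by apply: ei; rewrite e0 lfun0.
    by rewrite tens_eq0 (negPf v0) (negPf v'0).
  (* An element acting as [1] on [S i] and as [0] on [S j] fixes [v (x) v'] but kills its image
     under [e]; likewise in the second factor. *)
  congr (_, _); apply/eqP; apply: contraNT ne0 => ij; apply/eqP.
    have [a [a1 a0]] := simple_reps_separate rS ij.
    have <- : lm_act (tmod (S i) (S' i')) (incl t a) (tens v v') = tens v v'.
      by rewrite tmod_tensl a1 id_lfunE.
    rewrite he tmod_actl a0 /=; move: (e _) => X.
    by apply: ctrr_eq => l; rewrite ctrr_tmap zero_lfunE lfun0.
  have [a [a1 a0]] := simple_reps_separate rS' ij.
  have <- : lm_act (tmod (S i) (S' i')) (incr t a) (tens v v') = tens v v'.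
    by rewrite tmod_tensr a1 id_lfunE.
  rewrite he tmod_actr a0 /=; move: (e _) => X.
  by apply: ctrl_eq => l; rewrite ctrl_tmap zero_lfunE lfun0.
have [m m0] := simple_neq0 sM.
have [|i [f [hf fi _]]] := @ex_simple_sub _ _ _ _ allS (resmod (incl t) M) (submodT _).
  by move=> /vspaceP/(_ m); rewrite memvf memv0 (negPf m0).
have HP (u : 'Hom(S i, M)) :
    reflect (@is_hom _ _ (S i) (resmod (incl t) M) u)
            (u \in hom_space (S i) (resmod (incl t) M)).
  exact: hom_spaceP.
have hE a (u : 'Hom(S i, M)) v :
    (lm_act (hom_mod (S i) (resmod (incr t) M)) a u : 'Hom(S i, M)) v =
      lm_act M (incr t a) (u v).
  exact: hom_actE.
have hH : @stable_space _ _ (hom_mod (S i) (resmod (incr t) M))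
    (hom_space (S i) (resmod (incl t) M)).
  move=> a u /HP hu; apply/HP => b v.
  rewrite !hE hu -[lm_act (resmod _ M) b _]/(lm_act M (incl t b) _).
  rewrite -[lm_act (resmod _ M) b _]/(lm_act M (incl t b) _).
  by rewrite -!actM incr_incl -incl_incr.
have [|i' [g [hg gi gH]]] := ex_simple_sub allS' (N := stable_submod hH).
  move=> /vspaceP/(_ f); rewrite memv0; have /HP -> := hf.
  move=> /esym/eqP f0; have [v v0] := simple_neq0 (sS i).
  by case/eqP: v0; apply: fi; rewrite f0 !zero_lfunE.
exists (i, i'); apply: miso_sym => /=.
pose F : 'Hom(tmod (S i) (S' i'), M) := tlift (fun v w => (g w : 'Hom(S i, M)) v).
have FE v w : F (tens v w) = (g w : 'Hom(S i, M)) v.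
  rewrite tliftE // => [{}w | {}v] c x y; first by rewrite lfunD lfunZ.
  by rewrite lfunD lfunZ add_lfunE scale_lfunE.
have hF : is_hom F.
  apply: (pres_hom (t := t)) => a Z; apply/eqP; rewrite -subr_eq0 -memv0; move: Z.
    apply: tens_memv => [c x y | v w].
      by rewrite !(lfunD, lfunZ) scalerBr opprD addrACA.
    have /HP hgw : g w \in hom_space (S i) (resmod (incl t) M).
      by apply: (subvP gH); rewrite mem_limg.
    by rewrite tmod_tensl !FE hgw subrr mem0v.
  apply: tens_memv => [c x y | v w].
    by rewrite !(lfunD, lfunZ) scalerBr opprD addrACA.
  by rewrite tmod_tensr !FE hg hE subrr mem0v.
apply: (simple_hom_miso hF) => //; last exact: simple_tmod.
move=> F0; have [w w0] := simple_neq0 (sS' i').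
case/eqP: w0; apply: gi; rewrite lfun0; apply/lfunP => v.
by rewrite -FE F0 !zero_lfunE.
Qed.

(** A proper submodule lies in the kernel of a surjection [q] onto some simple [S j (x) S' j']. The
    slices of [q] go to simple modules, so they kill [ker p] and [ker p']; hence [q] kills the
    kernel of [p (x) p'] as well. *)
Lemma projective_cover_tmod (Q : lmodule A) (Q' : lmodule A') i i' :
  projective_cover Q (S i) -> projective_cover Q' (S' i') ->
  projective_cover (tmod Q Q') (tmod (S i) (S' i')).
Proof.
move=> [pQ [p [hp pf sp]]] [pQ' [p' [hp' pf' sp']]].
have [sS iS allS] := rS; have [sS' iS' allS'] := rS'.
split; first exact: projective_tmod.
exists (tmap p p'); split; [exact: tmap_hom | exact: tmap_surj |].
move=> N NK; apply: NNPP => nN.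
have [_ _ all2] := simple_reps_tmod.
have [[j j'] [q [hq qf Nq]]] := ex_simple_quo all2 nN; rewrite /= in q hq qf Nq.
have kq : (lker (tmap p p') <= lker q)%VS.
  apply: lker_tmap => v w h0; rewrite memv_ker; apply/eqP.
    apply: ctrr_eq => l; rewrite lfun0 -slicelE.
    by apply: superfluous_ker_simple h0; rewrite //; apply: slicel_hom.
  apply: ctrl_eq => l; rewrite lfun0 -slicerE.
  by apply: superfluous_ker_simple h0; rewrite //; apply: slicer_hom.
have [X X0] := simple_neq0 (simple_tmod (sS j) (sS' j')).
have /limg_fullP/(_ X)[Y YX] := qf.
have : Y \in (N + lker (tmap p p'))%VS by rewrite NK memvf.
have /subvP s : (N + lker (tmap p p') <= lker q)%VS by rewrite subv_add Nq.
by move/s; rewrite memv_ker YX (negPf X0).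
Qed.

End SimpleTensor.

(** * Traces, standard modules and standard filtrations *)

Section Standard.
Variables (k : fieldType) (A A' C : falgType k).
Variable t : algiso (tensalg A A') C.
Notation tmod := (tmod t).
Variables (I I' : finType) (Q : I -> lmodule A) (Q' : I' -> lmodule A').
Variables (le : rel I) (le' : rel I').
Hypotheses (le_refl : reflexive le) (le_refl' : reflexive le').
Let Q2 (x : I * I') := tmod (Q x.1) (Q' x.2).
Let le2 := prod_le le le'.

Lemma trace_img (B : falgType k) (J : finType) (P : J -> lmodule B) (r : rel J) i j
    (f : 'Hom(P j, P i)) v :
  is_hom f -> ~~ r j i -> f v \in trace_space P r i.
Proof.
move=> hf nji; have /traceP/(_ j f nji hf)/subvP := subvv (trace_space P r i).
by apply; apply: mem_limg.
Qed.

Definition standard_pi i : 'Hom(Q i, standard Q le i) :=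
  subquot_pi (submodT (Q i)) (trace Q le i).
Definition standard_pi' i : 'Hom(Q' i, standard Q' le' i) :=
  subquot_pi (submodT (Q' i)) (trace Q' le' i).

(** The trace is [trace (x) Q' + Q (x) trace'], because [(j, j')] fails to be below [(i, i')]
    exactly when [j] fails to be below [i] or [j'] below [i']. *)
Lemma lker_standard i i' :
  lker (tmap (standard_pi i) (standard_pi' i')) = trace_space Q2 le2 (i, i').
Proof.
apply/eqP; rewrite eqEsubv; apply/andP; split.
  have tl v : v \in trace_space Q le i -> forall w,
      (tens v w : Q2 (i, i')) \in trace_space Q2 le2 (i, i').
    move=> vt w; rewrite -tens_rfunE.
    suff /subvP : (trace_space Q le i <=
        tens_rfun (Q i) w @^-1: trace_space Q2 le2 (i, i'))%VS.
      by move=> s; rewrite memv_preim s.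
    apply/traceP => j f nji hf; apply: limg_sub => u; rewrite -memv_preim tens_rfunE.
    have -> : tens (f u) w = tmap f \1%VF (tens u w) by rewrite tmapE id_lfunE.
    apply: (@trace_img C _ Q2 le2 (i, i') (j, i')).
      exact: tmap_hom hf (@is_hom_id _ _ _).
    by rewrite /le2 /prod_le /= (negPf nji).
  have tr w : w \in trace_space Q' le' i' -> forall v,
      (tens v w : Q2 (i, i')) \in trace_space Q2 le2 (i, i').
    move=> wt v; rewrite -tens_lfunE.
    suff /subvP : (trace_space Q' le' i' <=
        tens_lfun (Q' i') v @^-1: trace_space Q2 le2 (i, i'))%VS.
      by move=> s; rewrite memv_preim s.
    apply/traceP => j f nji hf; apply: limg_sub => u; rewrite -memv_preim tens_lfunE.
    have -> : tens v (f u) = tmap \1%VF f (tens v u) by rewrite tmapE id_lfunE.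
    apply: (@trace_img C _ Q2 le2 (i, i') (i, j)).
      exact: tmap_hom (@is_hom_id _ _ _) hf.
    by rewrite /le2 /prod_le /= (negPf nji) andbF.
  apply: lker_tmap => v w h0; [apply: tl | apply: tr].
    by rewrite -[trace_space _ _ _]/(sm_space (trace Q le i)) -lker_quot_pi memv_ker h0.
  by rewrite -[trace_space _ _ _]/(sm_space (trace Q' le' i')) -lker_quot_pi memv_ker h0.
apply: (proj2 (@traceP k C _ Q2 le2 (i, i') _)) => -[j j'] f.
rewrite /le2 /prod_le /= negb_and => nle hf.
apply: limg_sub; apply: tens_memv_lfun => v w; rewrite memv_ker; apply/eqP.
have ker0 u : u \in trace_space Q le i -> standard_pi i u = 0.
  by move=> ut; apply: subquot_pi_eq0.
have ker0' u : u \in trace_space Q' le' i' -> standard_pi' i' u = 0.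
  by move=> ut; apply: subquot_pi_eq0.
case/orP: nle => nji.
  (* Once the second factor is projected, the slices are [A]-linear maps [Q j -> Q i]; their images
     lie in the trace and are killed by the remaining projection. *)
  pose g : 'Hom(tmod (Q j) (Q' j'), tmod (Q i) (standard Q' le' i')) :=
    (tmap \1 (standard_pi' i') \o f)%VF.
  have hg : is_hom g.
    by apply: is_hom_comp hf _; apply: tmap_hom (@is_hom_id _ _ _) _; apply: quot_pi_hom.
  have gE X : g X = tmap \1 (standard_pi' i') (f X) by rewrite comp_lfunE.
  apply: ctrr_eq => l; rewrite tmap_lr ctrr_tmap lfun0 -gE -slicelE.
  apply: ker0; apply: trace_img nji.
  exact: (@slicel_hom _ _ _ _ t (Q j) (Q i) (Q' j') (standard Q' le' i') g w l hg).
pose g : 'Hom(tmod (Q j) (Q' j'), tmod (standard Q le i) (Q' i')) :=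
  (tmap (standard_pi i) \1 \o f)%VF.
have hg : is_hom g.
  by apply: is_hom_comp hf _; apply: tmap_hom _ (@is_hom_id _ _ _); apply: quot_pi_hom.
have gE X : g X = tmap (standard_pi i) \1 (f X) by rewrite comp_lfunE.
apply: ctrl_eq => l; rewrite tmap_rl ctrl_tmap lfun0 -gE -slicerE.
apply: ker0'; apply: trace_img nji.
exact: (@slicer_hom _ _ _ _ t (Q j) (standard Q le i) (Q' j') (Q' i') g v l hg).
Qed.

Lemma standard_tmod i i' :
  miso (standard Q2 le2 (i, i')) (tmod (standard Q le i) (standard Q' le' i')).
Proof.
apply: (@quot_iso _ _ (Q2 (i, i')) (trace Q2 le2 (i, i'))
  (tmod (standard Q le i) (standard Q' le' i'))
  (tmap (standard_pi i) (standard_pi' i'))).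
- by apply: tmap_hom; apply: quot_pi_hom.
- by apply: tmap_surj; apply: subquot_pi_full.
exact: lker_standard.
Qed.

(** The kernel is [trace (x) Q' + Q (x) trace']. Inside [trace (x) Q'] the factors are
    [Delta j (x) Delta' j'] with [j > i] and [j' >= i']; above it the first factor is [Delta i] and
    [j' > i']. *)
Lemma filtered_tmod i i' :
    filtered_by (standard_ker Q le i) (standard Q le) (fun j => (j != i) && le i j) ->
    filtered_by (standard_ker Q' le' i') (standard Q' le')
      (fun j => (j != i') && le' i' j) ->
  filtered_by (standard_ker Q2 le2 (i, i')) (standard Q2 le2)
    (fun x => (x != (i, i')) && le2 (i, i') x).
Proof.
rewrite /standard_ker !lker_quot_pi => /filtered_chain c /filtered_chain c'.
pose D2 (x : I * I') := tmod (standard Q le x.1) (standard Q' le' x.2).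
pose Y := (fun x => (x != (i, i')) && le2 (i, i') x).
suff cc : chain D2 Y (submod0 (Q2 (i, i'))) (trace Q2 le2 (i, i')).
  apply: (@chain_filtered _ _ _ _ _ _ (submod0 (Q2 (i, i')))) => //.
  elim: cc => {c c'} [U V e | U W V j sUW Xj iso _ IH]; first exact: chain_nil.
  apply: chain_cons IH => //; first exact: Xj.
  by apply: miso_trans iso (miso_sym _); case: j {Xj} => j j'; apply: standard_tmod.
pose T := submodT (Q i); pose T' := submodT (Q' i').
(* All of [Q' i'] is filtered here: its top factor is the standard module of [i'] itself, which is
   why the index set becomes [le' i']. *)
have cT : chain (standard Q' le') (le' i') (submod0 (Q' i')) T'.
  apply: (@chain_trans _ _ _ _ _ _ _ (trace Q' le' i')).
    elim: c' {c} => [U V e | U W V j sUW /andP[_ Xj] iso _ IH]; first exact: chain_nil.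
    exact: chain_cons Xj iso IH.
  apply: chain_step (le_refl' i') (miso_refl _); exact: subvf.
have c1 : chain D2 Y (tsubm t (submod0 (Q i)) T') (tsubm t (trace Q le i) T').
  apply: chain_tsub cT c => j j' /andP[ji ij] ij'.
  by rewrite /Y /le2 /prod_le /= xpair_eqE (negPf ji) ij ij'.
have c2 : chain D2 Y (glue t (trace Q le i) T (submod0 (Q' i')))
    (glue t (trace Q le i) T (trace Q' le' i')).
  apply: chain_glue (miso_refl _) _ c'; first exact: subvf.
  move=> j' /andP[ji ij].
  by rewrite /Y /le2 /prod_le /= xpair_eqE (negPf ji) andbF le_refl ij.
apply: (@chain_trans _ _ _ _ _ _ _ (tsubm t (trace Q le i) T')).
  by apply: chain_extl c1; rewrite /= tsub0l.
apply: chain_extl (chain_extr c2 _); first by rewrite /= tsub0r addv0.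
rewrite -[RHS]/(trace_space Q2 le2 (i, i')) -lker_standard.
apply/eqP; rewrite eqEsubv; apply/andP; split.
  rewrite subv_add; apply/andP; split; apply: tsub_sub => v w vT wT.
    by rewrite memv_ker tmapE (subquot_pi_eq0 _ vT) tens0l.
  by rewrite memv_ker tmapE (subquot_pi_eq0 _ wT) tens0r.
apply: lker_tmap => v w h0.
  apply: subvP (addvSl _ _) _ _; apply: mem_tsub; last exact: memvf.
  by rewrite -lker_quot_pi memv_ker h0.
apply: subvP (addvSr _ _) _ _; apply: mem_tsub; first exact: memvf.
by rewrite -lker_quot_pi memv_ker h0.
Qed.

End Standard.

Section EndField.
Variables (k : fieldType) (A A' C : falgType k).
Variable t : algiso (tensalg A A') C.
Notation tmod := (tmod t).

(** For a fixed [d] with [d_i] nonzero, a slice of [f] is a scalar [c] on [D']; for each [w] and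
    [j], a slice is a scalar [b] on [D]. Reading the entry [(i, j)] of [f (d (x) w)] both ways gives
    [b d_i = c w_j], so [f] is the scalar [c / d_i]. *)
Lemma End_iso_field_tmod (D : lmodule A) (D' : lmodule A') :
  End_iso_field D -> End_iso_field D' -> End_iso_field (tmod D D').
Proof.
move=> /End_iso_fieldP[/dim_neq0P[d d0] hD] /End_iso_fieldP[/dim_neq0P[d' d'0] hD'].
apply/End_iso_fieldP; split.
  apply/dim_neq0P; exists (tens d d').
  by rewrite [_ == _]tens_eq0 (negPf d0).
move=> f hf; have [i di] := coord_neq0 d0.
have [c gc] := hD' (slicer f d i) (@slicer_hom _ _ _ _ t _ _ _ _ f d i hf).
exists ((v2r d 0 i)^-1 * c); apply: tensor_ext => v w.
rewrite scale_lfunE id_lfunE; apply: ctrr_eq => j.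
rewrite lfunZ ctrrE scalerA.
have [b fb] := hD (slicel f w j) (@slicel_hom _ _ _ _ t _ _ _ _ f w j hf).
have fbE u : ctrr D j (f (tens u w)) = b *: u.
  by rewrite -slicelE fb scale_lfunE id_lfunE.
rewrite fbE; congr (_ *: _); apply: (mulfI di).
rewrite !mulrA divff // mul1r.
have := congr1 (fun u => v2r u 0 i) (fbE d).
rewrite linearZ mxE v2r_ctrr -v2r_ctrl -slicerE gc scale_lfunE id_lfunE.
by rewrite linearZ mxE => ->; rewrite mulrC.
Qed.

Lemma miso_End_iso_field (D D' : lmodule A) :
  miso D D' -> End_iso_field D -> End_iso_field D'.
Proof.
case/misoP => e [he ei ef] /End_iso_fieldP[/dim_neq0P[d d0] hD].
apply/End_iso_fieldP; split.
  apply/dim_neq0P; exists (e d); apply: contraNneq d0 => e0.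
  by apply/eqP/ei; rewrite e0 lfun0.
have eV w : e ((e^-1)%VF w) = w by rewrite limg_lfunVK // ef memvf.
move=> f hf; have [|c ec] := hD (e^-1 \o f \o e)%VF.
  apply: (is_hom_comp he); apply: (is_hom_comp hf).
  exact: is_hom_inv he ei ef.
exists c; apply/lfunP => w; have := congr1 (fun g : 'End(D) => e (g ((e^-1)%VF w))) ec.
by rewrite 2!comp_lfunE eV eV !scale_lfunE !id_lfunE lfunZ eV.
Qed.

End EndField.

Lemma quasi_hereditary_for_tmod (k : closedFieldType) (A A' C : falgType k)
    (t : algiso (tensalg A A') C) (I I' : finType)
    (S Q : I -> lmodule A) (S' Q' : I' -> lmodule A') (le : rel I) (le' : rel I') :
  quasi_hereditary_for S Q le -> quasi_hereditary_for S' Q' le' ->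
  quasi_hereditary_for (fun x => tmod t (S x.1) (S' x.2))
    (fun x => tmod t (Q x.1) (Q' x.2)) (prod_le le le').
Proof.
move=> [rS [rl [al tl]] cQ eD fQ] [rS' [rl' [al' tl']] cQ' eD' fQ'].
split.
- exact: simple_reps_tmod.
- split=> [x|]; first by rewrite /prod_le rl rl'.
  split=> [[x x'] [y y'] | [x x'] [y y'] [z z']].
    by rewrite /prod_le /= => /andP[/andP[a a'] /andP[b b']];
      rewrite (al x y) ?a // (al' x' y') ?a'.
  by rewrite /prod_le /= => /andP[a a'] /andP[b b']; rewrite (tl _ _ _ a b) (tl' _ _ _ a' b').
- by move=> [i i']; apply: projective_cover_tmod.
- move=> [i i']; apply: (miso_End_iso_field (miso_sym (standard_tmod _ _ _ _ _ _ _))).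
  exact: End_iso_field_tmod.
by move=> [i i']; apply: filtered_tmod.
Qed.

(** * Semisimple algebras and maximal semisimple subalgebras *)

Section SemisimpleModules.
Variables (k : fieldType) (A : falgType k) (M : lmodule A).

Lemma atom_img (T : lmodule A) (h : 'Hom(T, M)) (hh : is_hom h) :
  simple T -> atom (submod_img (submodT T) hh).
Proof.
case=> _ sT X sX.
have hX : stable_space (h @^-1: X)%VS.
  by move=> a v; rewrite -!memv_preim hh; apply: sm_act.
have [e|e] := sT (stable_submod hX); [left | right]; apply/eqP.
  rewrite -subv0; apply/subvP => x Xx.
  have /memv_imgP[v _ xv] := subvP sX _ Xx.
  have : v \in (stable_submod hX : {vspace T}) by rewrite -memv_preim -xv.
  by rewrite e memv0 xv => /eqP->; rewrite lfun0 mem0v.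
rewrite eqEsubv sX; apply/subvP => _ /memv_imgP[v _ ->].
by rewrite memv_preim -[(_ @^-1: _)%VS]/(sm_space (stable_submod hX)) e memvf.
Qed.

Section Atoms.
Variables (L : finType) (F : L -> submod M).
Hypotheses (atomF : forall l, atom (F l)).
Hypothesis sumF : (\sum_l F l)%VS = fullv.

(** A maximal set of nonzero atoms independent modulo [N], with independence expressed by
    dimensions: an atom outside the sum meets it in zero and could be added. *)
Lemma atom_complement (N : submod M) : exists X : {set L},
  [/\ forall l, l \in X -> F l != 0%VS :> {vspace M},
      \dim (N + \sum_(l in X) F l)%VS = (\dim N + \sum_(l in X) \dim (F l))%N
    & (N + \sum_(l in X) F l)%VS = fullv].
Proof.
pose P (X : {set L}) := [forall l in X, F l != 0%VS :> {vspace M}] &&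
  (\dim (N + \sum_(l in X) F l)%VS == (\dim N + \sum_(l in X) \dim (F l))%N).
have P0 : P set0.
  apply/andP; split; first by apply/forall_inP => l; rewrite inE.
  by rewrite !big_set0 addv0 addn0.
have [X maxX _] := maxset_exists P0.
have /maxsetP[/andP[/forall_inP X0 /eqP dX] Xmax] := maxX.
exists X; split=> //; apply: NNPP => nT.
set W := (N + \sum_(l in X) F l)%VS in dX nT.
have [l lW] : exists l, ~~ (F l <= W)%VS.
  apply: NNPP => nl; case: nT; apply/eqP; rewrite eqEsubv subvf -sumF.
  by apply/subv_sumP => l _; apply: contraT => lW; case: nl; exists l.
have Wl : (W :&: F l = 0)%VS.
  pose Z := submod_cap (F l) (submod_add N (submod_sum (mem X) F)).
  have [||e] := @atomF l Z; rewrite /= ?capvSl //; first by rewrite capvC.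
  by case/negP: lW; rewrite -e capvSr.
have lX : l \notin X.
  apply: contra lW => lX; apply: subv_trans (addvSr _ _).
  exact: (sumv_sup l).
suff : (l |: X)%SET = X by move=> e; rewrite -e setU11 in lX.
apply: Xmax; last exact: subsetUr.
apply/andP; split.
  apply/forall_inP => l'; rewrite in_setU1 => /predU1P[->|/X0//].
  by apply: contraNneq lW => ->; apply: sub0v.
rewrite !big_setU1 //= addvA (addvC N) -addvA dimv_disjoint_sum; last by rewrite capvC.
by rewrite dX addnCA.
Qed.

Lemma atom_semisimple : semisimple M.
Proof.
have [X [X0 dX XT]] := atom_complement (submod0 M).
rewrite /= add0v in XT; rewrite /= add0v dimv0 add0n in dX.
exists #|X|, (fun i => F (enum_val i)); split=> [i | |].
- apply: simple_subquot => [||Y /andP[_ sY]]; first exact: sub0v.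
    by move/esym/eqP; apply/negP/X0/enum_valP.
  exact: atomF.
- rewrite directvE /= -(big_enum_val (fun l => sm_space (F l))).
  by rewrite -(big_enum_val (fun l => \dim (F l))) dX.
by rewrite -(big_enum_val (fun l => sm_space (F l))).
Qed.

End Atoms.

End SemisimpleModules.

Section Subalgebra.
Variables (k : fieldType) (A : falgType k) (B : subalg A).

Fact sub_incl_one : (linfun (vsval : salg B -> A)) 1 = 1.
Proof. by rewrite lfunE; apply: salg1. Qed.
Fact sub_incl_mul x y : (linfun (vsval : salg B -> A)) (x * y) =
  linfun (vsval : salg B -> A) x * linfun (vsval : salg B -> A) y.
Proof. by rewrite !lfunE. Qed.
Definition sub_incl : alghom (salg B) A := AlgHom sub_incl_one sub_incl_mul.

Lemma sub_inclE x : sub_incl x = vsval x.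
Proof. by rewrite /sub_incl /= lfunE. Qed.

(** [A] is a semisimple left [B]-module: the maps [b |-> b x], for [x] in a basis of [A], carry the
    simple summands of [B] to atoms whose sum is [A]. *)
Lemma semisimple_subalg_complement (N : submod (resmod sub_incl (regmod A))) :
  semisimple_subalg B -> exists K : submod (resmod sub_incl (regmod A)),
    (N :&: K = 0)%VS /\ (N + K = fullv)%VS.
Proof.
case=> n [S [sS _ ST]].
pose M := resmod sub_incl (regmod A).
have actE b x : lm_act M b x = vsval b * x.
  by rewrite -[lm_act M b x]/(lm_act (regmod A) (sub_incl b) x) regmod_actE sub_inclE.
pose h (x : A) : 'Hom(regmod (salg B), M) := (amulr x \o sub_incl)%VF.
have hE x b : h x b = vsval b * x by rewrite comp_lfunE amulrE sub_inclE.
have hh x : is_hom (h x).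
  by move=> b y; rewrite hE actE hE mulrA regmod_actE.
have /fin_all_exists[i iP] : forall j : 'I_n, exists i :
    'Hom(subquot (S j) (submod0 (regmod (salg B))), regmod (salg B)),
    is_hom i /\ limg i = S j.
  by move=> j; have [f [hf _ fS]] := submod_incl (S j); exists f.
have hhi l : is_hom (h (bvec l.2) \o i l.1)%VF.
  by apply: is_hom_comp (hh _); have [] := iP l.1.
pose F (l : 'I_n * 'I_(dim A)) : submod M := submod_img (submodT _) (@hhi l).
have atomF l : atom (F l) by apply: atom_img.
have sumF : (\sum_l F l)%VS = fullv.
  apply/eqP; rewrite eqEsubv subvf /=; apply/subvP => x _.
  rewrite (bvec_sum x); apply: memv_suml => c _; apply: memvZ.
  have /memv_sumP[s Ss s1] : 1 \in (\sum_i S i)%VS by rewrite ST memvf.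
  have -> : bvec c = h (bvec c) 1 by rewrite hE salg1 mul1r.
  rewrite s1 lfun_sum; apply: memv_suml => j _.
  apply: (subvP (sumv_sup (j, c) isT (subvv _))).
  have : s j \in limg (i j) by rewrite (proj2 (iP j)); apply: Ss.
  by case/memv_imgP => v _ ->; rewrite -comp_lfunE mem_limg.
have [X [X0 dX XT]] := atom_complement atomF sumF N.
exists (submod_sum (mem X) F); split=> //=.
apply/eqP; rewrite -dimv_eq0 -leqn0 -(leq_add2l (\dim (N + \sum_(l in X) F l)%VS)).
rewrite addn0 dimv_sum_cap dX leq_add2l.
exact: dimv_leq_sum.
Qed.

End Subalgebra.

Section ActionMap.
Variables (k : fieldType) (A : falgType k) (M : lmodule A).
Lemma lm_actB a b : lm_act M (a - b) = lm_act M a - lm_act M b.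
Proof. exact: linearB. Qed.
Lemma lm_act_sum (I : Type) (r : seq I) (P : pred I) F :
  lm_act M (\sum_(i <- r | P i) F i) = \sum_(i <- r | P i) lm_act M (F i).
Proof. exact: linear_sum. Qed.
End ActionMap.

Lemma sum_tagged (V : nmodType) (I : finType) (J : I -> finType)
    (F : forall i, J i -> V) :
  \sum_(p : {i : I & J i}) F (tag p) (tagged p) = \sum_i \sum_(j : J i) F i j.
Proof. by rewrite (sig_big_dep (fun _ => true) (fun _ _ => true) F). Qed.

(** * Separability of the semisimple quotient *)

Section Separability.
Variables (k : closedFieldType) (A : falgType k) (I : finType).
Variable S : I -> lmodule A.
Hypotheses (simpleS : forall i, simple (S i)).
Hypothesis injS : forall i j, miso (S i) (S j) -> i = j.

(* A separability element of A / rad, lifted to A (x) A. *)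
Lemma separability_element : exists (L : finType) (a b : L -> A),
  1 - \sum_l a l * b l \in rad S /\
  forall Psi : A -> A -> A,
    (forall y, linear (Psi^~ y)) -> (forall x, linear (Psi x)) ->
    (forall x y, x \in rad S -> Psi x y = 0) ->
    (forall x y, y \in rad S -> Psi x y = 0) ->
  forall y, \sum_l Psi (y * a l) (b l) = \sum_l Psi (a l) (b l * y).
Proof.
have [E EP] := density_linear simpleS injS.
have Hd i : (0 < dim (S i))%N by rewrite lt0n; case: (simpleS i).
pose z i := Ordinal (Hd i).
have radE i x f : lm_act (S i) x = f -> (forall j, j != i -> lm_act (S j) x = 0) ->
    x - E i f \in rad S.
  move=> xf x0; apply/radP => j; rewrite lm_actB; have [Ef E0] := EP i f.
  case: (eqVneq j i) => [->|ji]; first by rewrite xf Ef subrr.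
  by rewrite (x0 j ji) (E0 j ji) subrr.
pose LL := {i : I & 'I_(dim (S i))}.
(* [a] and [b] lift the matrix units [E_cz] and [E_zc] for a fixed index [z], here the first one;
   modulo the radical the products [a l * b l] are the diagonal idempotents, with sum [1]. *)
pose a (l : LL) := E (tag l) (rank1 (z (tag l)) (bvec (tagged l))).
pose b (l : LL) := E (tag l) (rank1 (tagged l) (bvec (z (tag l)))).
pose G i (c : 'I_(dim (S i))) : LL := Tagged (fun i => 'I_(dim (S i))) c.
exists LL, a, b; split.
  apply/radP => j; rewrite lm_actB lm_act1 lm_act_sum; apply/eqP; rewrite subr_eq0.
  apply/eqP/esym.
  have e i (c : 'I_(dim (S i))) : lm_act (S j) (a (G i c) * b (G i c)) =
      if i == j then lm_act (S j) (E i (rank1 c (bvec c))) else 0.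
    rewrite lm_actM /a /b /=.
    case: (eqVneq i j) => [ij | ij].
      destruct ij; rewrite !(proj1 (EP _ _)); apply/lfunP => v.
      by rewrite comp_lfunE !rank1E linearZ mxE v2r_bvec eqxx mulr1.
    by rewrite (proj2 (EP i (rank1 (z i) (bvec c)))) ?comp_lfun0l // eq_sym.
  have -> : \sum_l lm_act (S j) (a l * b l) =
      \sum_i \sum_c lm_act (S j) (a (G i c) * b (G i c)).
    rewrite -(sum_tagged (fun i c => lm_act (S j) (a (G i c) * b (G i c)))).
    by apply: eq_bigr => -[].
  under eq_bigr => i _ do under eq_bigr => c _ do rewrite e.
  rewrite (bigD1 j) //= [X in _ + X]big1 ?addr0 => [|i ij]; last first.
    by rewrite big1 // (negPf ij).
  rewrite eqxx [RHS]lfun_rank1_sum; apply: eq_bigr => c _.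
  by rewrite (proj1 (EP _ _)) id_lfunE.
move=> Psi Pl Pr Jl Jr y.
have PsiDl x x' w : Psi (x + x') w = Psi x w + Psi x' w.
  by have := Pl w 1 x x'; rewrite !scale1r.
have PsiDr x w w' : Psi x (w + w') = Psi x w + Psi x w'.
  by have := Pr x 1 w w'; rewrite !scale1r.
have congl x x' w : x - x' \in rad S -> Psi x w = Psi x' w.
  by move=> xr; rewrite -(subrK x' x) PsiDl Jl // add0r.
have congr' x w w' : w - w' \in rad S -> Psi x w = Psi x w'.
  by move=> wr; rewrite -(subrK w' w) PsiDr Jr // add0r.
have sumLL (F : LL -> A) : \sum_l F l = \sum_i \sum_c F (G i c).
  by rewrite -(sum_tagged (fun i c => F (G i c))); apply: eq_bigr => -[].
rewrite (sumLL (fun l => Psi (y * a l) (b l))).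
rewrite (sumLL (fun l => Psi (a l) (b l * y))); apply: eq_bigr => i _.
(* With [m] the matrix of [y], both sides are the sum of the [m_dc Psi(E_dz, E_zc)]: modulo the
   radical, which [Psi] ignores, [y E_cz] is the sum over [d] of [m_dc E_dz], and [E_zd y] the sum
   over [c] of [m_dc E_zc]. *)
pose m d c := v2r (lm_act (S i) y (bvec c)) 0 d.
pose Pl_lin w : {linear A -> A} := HB.pack (Psi^~ w)
  (GRing.isLinear.Build k A A _ (Psi^~ w) (Pl w)).
pose Pr_lin x : {linear A -> A} := HB.pack (Psi x)
  (GRing.isLinear.Build k A A _ (Psi x) (Pr x)).
transitivity (\sum_c \sum_d m d c *: Psi (a (G i d)) (b (G i c))).
  apply: eq_bigr => c _.
  rewrite (@congl _ (\sum_d m d c *: a (G i d))).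
    rewrite -[Psi _ _]/(Pl_lin (b (G i c)) _) linear_sum; apply: eq_bigr => d _.
    by rewrite linearZZ.
  have -> : \sum_d m d c *: a (G i d) = E i (rank1 (z i) (lm_act (S i) y (bvec c))).
    rewrite [in RHS](bvec_sum (lm_act (S i) y (bvec c))).
    pose R : {linear S i -> 'End(S i)} := HB.pack (rank1 (z i))
      (GRing.isLinear.Build k (S i) 'End(S i) _ (rank1 (z i)) (rank1_linear (z i))).
    rewrite -[rank1 _ _]/(R _) linear_sum lfun_sum; apply: eq_bigr => d _.
    by rewrite linearZZ lfunZ.
  apply: radE => [|j ji]; rewrite lm_actM.
    rewrite (proj1 (EP _ _)); apply/lfunP => v.
    by rewrite comp_lfunE !rank1E lfunZ.
  by rewrite (proj2 (EP i _)) // comp_lfun0r.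
rewrite exchange_big; apply: eq_bigr => d _ /=.
rewrite (@congr' _ (b (G i d) * y) (\sum_c m d c *: b (G i c))).
  rewrite -[Psi _ _]/(Pr_lin (a (G i d)) _) linear_sum; apply: eq_bigr => c _.
  by rewrite linearZZ.
have -> : \sum_c m d c *: b (G i c) = E i (\sum_c m d c *: rank1 c (bvec (z i))).
  by rewrite lfun_sum; apply: eq_bigr => c _; rewrite lfunZ.
apply: radE => [|j ji]; rewrite lm_actM.
  rewrite (proj1 (EP _ _)); apply: bvec_ext => c.
  rewrite comp_lfunE rank1E sum_lfunE (bigD1 c) //= scale_lfunE rank1E v2r_bvec eqxx.
  rewrite scale1r big1 ?addr0 // => c' cc'.
  by rewrite scale_lfunE rank1E v2r_bvec (negPf cc') scale0r scaler0.
by rewrite (proj2 (EP i _)) // comp_lfun0l.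
Qed.

End Separability.

(** * Lifting the semisimple quotient by successive corrections *)

Section Lifting.
Variables (k : closedFieldType) (A : falgType k) (I : finType).
Variable S : I -> lmodule A.
Hypothesis rS : simple_reps S.
Let J := rad S.
Variable S0 : {vspace A}.
Hypotheses (S0_one : 1 \in S0).

(* s is multiplicative up to an ideal K inside the radical; replacing s x by
   s x + \sum_l (s (x a_l) - s x s a_l) s b_l, for a separability element
   \sum_l a_l (x) b_l, makes it multiplicative up to K^2. *)
Record near_lift (s : 'End(A)) (K : {vspace A}) : Prop := NearLift {
  nl_linear : forall u x, u \in S0 -> s (u * x) = u * s x;
  nl_id : forall u, u \in S0 -> s u = u;
  nl_rad : forall x, x \in J -> s x = 0;
  nl_mod : forall x, s x - x \in J;
  nl_mul : forall x y, s (x * y) - s x * s y \in K;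
  nl_ideall : forall a x, x \in K -> a * x \in K;
  nl_idealr : forall a x, x \in K -> x * a \in K;
  nl_sub : (K <= J)%VS
}.

Lemma lift_step s K : near_lift s K -> exists s', near_lift s' (K * K)%VS.
Proof.
case=> sl sid sJ smod sM Kl Kr KJ; have [sS iS _] := rS.
have [L [a [b [ab sep]]]] := separability_element sS iS.
pose f x y := s (x * y) - s x * s y.
have flinl y : linear (f^~ y).
  move=> c x x'; rewrite /f mulrDl -scalerAl !lfunD !lfunZ mulrDl -scalerAl.
  by rewrite opprD addrACA scalerBr.
have flinr x : linear (f x).
  move=> c y y'; rewrite /f mulrDr -scalerAr !lfunD !lfunZ mulrDr -scalerAr.
  by rewrite opprD addrACA scalerBr.
have fK x y : f x y \in K by apply: sM.
have s1 : s 1 = 1 by apply: sid.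
have fJl x y : x \in J -> f x y = 0.
  by move=> xJ; rewrite /f (sJ x) // mul0r subr0 sJ //; apply: radMr.
have fJr x y : y \in J -> f x y = 0.
  by move=> yJ; rewrite /f (sJ y) // mulr0 subr0 sJ //; apply: radMl.
(* Contracting the defect [f] with the separability element is the usual homotopy of Hochschild
   cohomology: it makes [f] the coboundary of [g], up to terms in [K * K]. *)
pose g0 x := \sum_l f x (a l) * s (b l).
have g0lin : linear g0.
  move=> c x x'; rewrite /g0 scaler_sumr -big_split; apply: eq_bigr => l _.
  by rewrite flinl mulrDl -scalerAl.
pose g : 'End(A) := linfun g0.
have gE x : g x = \sum_l f x (a l) * s (b l) by rewrite (linfun_linear g0lin).
have gK x : g x \in K by rewrite gE; apply: memv_suml => l _; apply: Kr.
have ftl u x y : u \in S0 -> f (u * x) y = u * f x y.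
  by move=> Su; rewrite /f -mulrA !(sl u) // mulrBr mulrA.
have gu u x : u \in S0 -> g (u * x) = u * g x.
  move=> Su; rewrite !gE mulr_sumr; apply: eq_bigr => l _.
  by rewrite ftl // mulrA.
(* Together with [gu], this makes [g] vanish on [S0], so the correction keeps [s] the identity
   there. *)
have g1 : g 1 = 0.
  by rewrite gE big1 // => l _; rewrite /f s1 !mul1r subrr mul0r.
have KK x y : x \in K -> y \in K -> x * y \in (K * K)%VS by exact: memv_mul.
have key x y : f x y - s x * g y - g x * s y + g (x * y) \in (K * K)%VS.
  (* The cocycle identity [s x f(y, a) = f(x y, a) - f(x, y a) + f(x, y) s a] at [a = a l],
     multiplied by [s (b l)] and summed over [l]. *)
  have e1 : s x * g y =
      g (x * y) - \sum_l f x (y * a l) * s (b l) + f x y * \sum_l s (a l) * s (b l).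
    rewrite !gE mulr_sumr mulr_sumr -sumrB -big_split /=; apply: eq_bigr => l _.
    rewrite mulrA [in RHS]mulrA -mulrBl -mulrDl; congr (_ * _).
    rewrite /f !mulrBr !mulrBl !mulrA.
    rewrite !opprD !opprK !addrA [RHS](ACl ((1 * 3) * (2 * 5) * (4 * 6))) /=.
    by rewrite subrr addNr !add0r.
  (* Separability moves [y] across to [b l], and [s (b l * y)] differs from [s (b l) * s y] by the
     defect. *)
  have e2 : \sum_l f x (y * a l) * s (b l) =
      g x * s y + \sum_l f x (a l) * f (b l) y.
    pose Psi p q := f x p * s q.
    have -> : \sum_l f x (y * a l) * s (b l) = \sum_l Psi (y * a l) (b l) by [].
    rewrite sep => [|q c p p' | p c q q' | p q pJ | p q qJ].
    - rewrite gE mulr_suml -big_split; apply: eq_bigr => l _ /=.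
      by rewrite /Psi -mulrA -mulrDr /f addrCA subrr addr0.
    - by rewrite /Psi flinr mulrDl -scalerAl.
    - by rewrite /Psi lfunD lfunZ mulrDr -scalerAr.
    - by rewrite /Psi fJr // mul0r.
    by rewrite /Psi sJ // mulr0.
  (* The sum of the [a l * b l] is [1] modulo the radical, which [s] kills. *)
  have e3 : \sum_l s (a l) * s (b l) = 1 - \sum_l f (a l) (b l).
    rewrite -[X in X - _](subrK (s (\sum_l a l * b l))) -{1}s1 -lfunB (sJ _ ab) add0r.
    rewrite lfun_sum -sumrB; apply: eq_bigr => l _.
    by rewrite /f opprB addrC subrK.
  have -> : f x y - s x * g y - g x * s y + g (x * y) =
      \sum_l f x (a l) * f (b l) y + f x y * \sum_l f (a l) (b l).
    rewrite e1 e2 e3 mulrBr mulr1.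
    move: (f x y) (g (x * y)) (g x * s y) (\sum_l _) (_ * _) => p q r u w.
    rewrite !opprD !opprK !addrA.
    rewrite [LHS](ACl ((1 * 5) * (2 * 8) * (3 * 7) * (4 * 6))) /=.
    by rewrite subrr addNr subrr !add0r.
  apply: memvD; last by apply: KK => //; apply: memv_suml.
  by apply: memv_suml => l _; apply: KK.
exists (s + g); split.
- by move=> u x Su; rewrite !add_lfunE sl // gu // mulrDr.
- by move=> u Su; rewrite add_lfunE sid // -[u in g u]mulr1 gu // g1 mulr0 addr0.
- move=> x xJ; rewrite add_lfunE sJ // gE big1 ?addr0 // => l _.
  by rewrite fJl // mul0r.
- move=> x; rewrite add_lfunE addrAC; apply: memvD; first exact: smod.
  exact: subvP KJ _ (gK x).
- move=> x y; rewrite !add_lfunE mulrDl !mulrDr.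
  have -> : s (x * y) + g (x * y) - (s x * s y + s x * g y + (g x * s y + g x * g y))
      = (f x y - s x * g y - g x * s y + g (x * y)) - g x * g y.
    by rewrite /f !opprD !addrA [LHS](ACl (1 * 3 * 4 * 5 * 2 * 6)).
  by apply: memvB; [apply: key | apply: KK].
- move=> c x; rewrite -[x in c * x]/(idfun x) => xK.
  have sub : (<[c]> * (K * K) <= K * K)%VS.
    rewrite prodvA; apply: prodvSl; apply/prodvP => u v /vlineP[d ->] Kv.
    by rewrite -scalerAl; apply: memvZ; apply: Kl.
  by apply: (subvP sub); apply: memv_mul xK; apply: memv_line.
- move=> c x xK.
  have sub : (K * K * <[c]> <= K * K)%VS.
    rewrite -prodvA; apply: prodvSr; apply/prodvP => v u Kv /vlineP[d ->].
    by rewrite -scalerAr; apply: memvZ; apply: Kr.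
  by apply: (subvP sub); apply: memv_mul xK _; apply: memv_line.
by apply/prodvP => x y xK yK; apply: (subvP KJ); apply: Kl.
Qed.

(** The ideal shrinks strictly: [K * K = K] with [K] inside the radical forces [K = 0] by
    Nakayama. *)
Lemma lift_exists s K : near_lift s K -> exists s', near_lift s' 0%VS.
Proof.
have [sS _ allS] := rS.
have [n] := ubnP (\dim K); elim: n s K => // n IHn s K ltn nl.
case: (eqVneq K 0%VS) => [K0 | K0]; first by exists s; rewrite -K0.
have [s' nl'] := lift_step nl.
rewrite ltnS in ltn; apply: IHn nl'; apply: leq_trans ltn.
have sKK : (K * K <= K)%VS by apply/prodvP => x y _ yK; apply: (nl_ideall nl).
rewrite ltn_neqAle dimvS // andbT; apply: contra K0 => eK.
apply/eqP; apply: (rad_nakayama sS allS); first exact: (nl_ideall nl).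
have eKK : K = (K * K)%VS.
  by apply/esym/eqP; rewrite -(geq_leqif (dimv_leqif_eq sKK)) (eqP eK).
by rewrite {1}eKK; apply: prodvSl; apply: (nl_sub nl).
Qed.

End Lifting.

Section SubalgebraBuilder.
Variables (k : fieldType) (A : falgType k) (U : {vspace A}).
Hypotheses (U1 : 1 \in U) (UM : forall x y, x \in U -> y \in U -> x * y \in U).

Fact build_subalg_subproof : is_aspace U.
Proof. by rewrite /is_aspace has_algid1 //=; apply/prodvP. Qed.
Definition build_subalg : subalg A := @Subalg k A (ASpace build_subalg_subproof) U1.

End SubalgebraBuilder.

(** * Complements of the radical *)

Section MaximalSemisimple.
Variables (k : closedFieldType) (A : falgType k) (I : finType).
Variable S : I -> lmodule A.
Hypothesis rS : simple_reps S.
Notation J := (rad S).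

Lemma subalgM (B : subalg A) x y : x \in (B : {vspace A}) -> y \in (B : {vspace A}) ->
  x * y \in (B : {vspace A}).
Proof. by move=> Bx By; apply: memvM. Qed.

Lemma sub_actE (B : subalg A) b x :
  lm_act (resmod (sub_incl B) (regmod A)) b x = vsval b * x.
Proof.
rewrite -[LHS]/(lm_act (regmod A) (sub_incl B b) x).
by rewrite regmod_actE sub_inclE.
Qed.

Lemma sub_stable (B : subalg A) (V : {vspace A}) :
    (forall b v, b \in (B : {vspace A}) -> v \in V -> b * v \in V) ->
  @stable_space _ _ (resmod (sub_incl B) (regmod A)) V.
Proof. by move=> BV b v Vv; rewrite sub_actE; apply: BV => //; apply: subvsP. Qed.

(** Choose a left [B]-stable complement of [B :&: J] in [A], and let [e] be the component of [1] in
    [B :&: J]. Then [x = x * e] for all [x] in [B :&: J], so [e] is an idempotent of the radical,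
    hence zero. *)
Lemma semisimple_rad0 (B : subalg A) : semisimple_subalg B -> (B :&: J = 0)%VS.
Proof.
move=> ssB; have [sS _ allS] := rS.
have hN : @stable_space _ _ (resmod (sub_incl B) (regmod A)) (B :&: J)%VS.
  apply: sub_stable => b v Bb /memv_capP[Bv Jv].
  by rewrite memv_cap (subalgM Bb Bv) radMl.
have [K [NK0 NKT]] := semisimple_subalg_complement (stable_submod hN) ssB.
rewrite /= in NK0 NKT.
have : (1 : A) \in ((B :&: J) + K)%VS by rewrite NKT memvf.
case/memv_addP => e Ne [f Kf ef].
have xe x : x \in (B :&: J)%VS -> x = x * e.
  move=> Nx; have /memv_capP[Bx _] := Nx.
  have Kxf : x * f \in (K : {vspace A}).
    have := @sm_act _ _ _ K (vsproj B x) f Kf; rewrite sub_actE vsprojK //.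
  have : x - x * e \in ((B :&: J) :&: K)%VS.
    rewrite memv_cap; apply/andP; split; last first.
      by rewrite -{1}[x]mulr1 ef mulrDr addrC addKr.
    apply: memvB => //; have := @sm_act _ _ _ (stable_submod hN) (vsproj B x) e Ne.
    by rewrite sub_actE vsprojK.
  by rewrite NK0 memv0 subr_eq0 => /eqP.
have /memv_capP[_ Je] := Ne; have [b be] := rad_left_inv sS allS Je.
have e0 : e = 0.
  by rewrite -[e]mul1r -be -mulrA mulrBl mul1r -xe // subrr mulr0.
apply/eqP; rewrite -subv0; apply/subvP => x /xe ->.
by rewrite e0 mulr0 mem0v.
Qed.

(** Adding to [B] a left [B]-stable complement [K] of [B + J] gives a vector space complement [C] of
    [J] that contains [B]. The projection onto [C] along [J] starts the lifting, and [U] is the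
    image of the multiplicative map obtained. *)
Lemma wedderburn_malcev (B : subalg A) : semisimple_subalg B ->
  exists U : subalg A, [/\ (B <= U)%VS, (U :&: J = 0)%VS & (U + J = fullv)%VS].
Proof.
move=> ssB; have BJ0 := semisimple_rad0 ssB.
have hB : @stable_space _ _ (resmod (sub_incl B) (regmod A)) (B + J)%VS.
  apply: sub_stable => b _ Bb /memv_addP[u Bu [v Jv ->]].
  by rewrite mulrDr memv_add ?subalgM ?radMl.
have [K [K0 KT]] := semisimple_subalg_complement (stable_submod hB) ssB.
rewrite /= in K0 KT.
pose C := (B + K)%VS.
have CJ0 : (C :&: J = 0)%VS.
  apply/eqP; rewrite -subv0; apply/subvP => _ /memv_capP[/memv_addP[b Bb [x Kx ->]] Jbx].
  have x0 : x = 0.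
    apply/eqP; rewrite -memv0 -K0 memv_cap Kx andbT.
    have -> : x = - b + (b + x) by rewrite addKr.
    by apply: memv_add => //; rewrite rpredN.
  by rewrite -BJ0 memv_cap Jbx x0 addr0 Bb.
have CJT : (C + J = fullv)%VS by rewrite -KT /C -!addvA (addvC K).
have CB b x : b \in (B : {vspace A}) -> x \in C -> b * x \in C.
  move=> Bb /memv_addP[u Bu [v Kv ->]]; rewrite mulrDr memv_add ?subalgM //.
  by have := @sm_act _ _ _ K (vsproj B b) v Kv; rewrite sub_actE vsprojK.
pose s := daddv_pi C J.
have sC x : s x \in C by apply: memv_pi.
have xs x : x - s x \in J.
  rewrite -{1}(@daddv_pi_add _ _ C J x CJ0) ?CJT ?memvf // addrC addKr.
  exact: memv_pi.
have sx x : s x - x \in J by rewrite -opprB rpredN.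
have CJ x : x \in C -> x \in J -> x = 0.
  by move=> Cx Jx; apply/eqP; rewrite -memv0 -CJ0 memv_cap Cx.
have nl : near_lift S B s J.
  split=> // [u x Bu | u Bu | x Jx | x y | a x | a x].
  - apply/eqP; rewrite -subr_eq0; apply/eqP/CJ.
      by apply: memvB => //; apply: CB.
    have -> : s (u * x) - u * s x = (s (u * x) - u * x) + u * (x - s x).
      by rewrite mulrBr addrA subrK.
    by apply: memvD => //; apply: radMl.
  - by apply: daddv_pi_id => //; apply: subvP (addvSl _ _) _ _.
  - by apply: CJ => //; rewrite -[s x](subrK x); apply: memvD.
  - have -> : s (x * y) - s x * s y =
        (s (x * y) - x * y) + ((x - s x) * y + s x * (y - s y)).
      by rewrite mulrBl mulrBr !addrA !subrK.
    apply: memvD => //; apply: memvD; [exact: radMr | exact: radMl].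
  - exact: radMl.
  exact: radMr.
have [s' nl'] := lift_exists rS (sa_one B) nl.
have s'M x y : s' (x * y) = s' x * s' y.
  by apply/eqP; rewrite -subr_eq0 -memv0; apply: (nl_mul nl').
have U1 : 1 \in limg s' by rewrite -(nl_id nl' (sa_one B)) mem_limg.
have UM x y : x \in limg s' -> y \in limg s' -> x * y \in limg s'.
  by move=> /memv_imgP[x' _ ->] /memv_imgP[y' _ ->]; rewrite -s'M mem_limg.
exists (build_subalg U1 UM); split=> /=.
- by apply/subvP => b Bb; rewrite -(nl_id nl' Bb) mem_limg.
- apply/eqP; rewrite -subv0; apply/subvP => _ /memv_capP[/memv_imgP[x _ ->] Jsx].
  rewrite memv0; apply/eqP/(nl_rad nl'); rewrite -[x](subKr (s' x)).
  by apply: memvB => //; apply: (nl_mod nl').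
apply/vspaceP => x; rewrite memvf -[x](subrKC (s' x)) memv_add ?mem_limg //.
by rewrite -opprB rpredN (nl_mod nl').
Qed.

(** Through [A / J], [U] is the product of the matrix algebras [End(S i)]; each [h l] maps a copy of
    [S i] onto one of its columns, and the columns span [U]. *)
Lemma rad_complement_semisimple (U : subalg A) :
  (U :&: J = 0)%VS -> (U + J = fullv)%VS -> semisimple_subalg U.
Proof.
move=> UJ0 UJT; have [sS iS allS] := rS.
have [E EP] := density_linear sS iS.
pose s := daddv_pi U J.
have sU x : s x \in (U : {vspace A}) by apply: memv_pi.
have xs x : x - s x \in J.
  rewrite -{1}(@daddv_pi_add _ _ U J x UJ0) ?UJT ?memvf // addrC addKr.
  exact: memv_pi.
have s_act i x : lm_act (S i) (s x) = lm_act (S i) x.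
  apply/esym/eqP; rewrite -subr_eq0 -lm_actB; apply/eqP.
  by have /radP := xs x; apply.
have UJ x : x \in (U : {vspace A}) -> (forall i, lm_act (S i) x = 0) -> x = 0.
  by move=> Ux /radP Jx; apply/eqP; rewrite -memv0 -UJ0 memv_cap Ux.
pose L := {i : I & 'I_(dim (S i))}.
pose T (l : L) := resmod (sub_incl U) (S (tag l)).
have sT l : simple (T l).
  apply: resmod_simple => // a; exists (vsproj U (s a)).
  by rewrite sub_inclE vsprojK // s_act.
pose h0 (l : L) (v : S (tag l)) : salg U := vsproj U (s (E (tag l) (rank1 (tagged l) v))).
have h0lin l : linear (@h0 l).
  by move=> c x y; rewrite /h0 rank1_linear !lfunD !lfunZ linearP.
pose h (l : L) : 'Hom(T l, regmod (salg U)) := linfun (@h0 l).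
have hE l v : vsval (h l v) = s (E (tag l) (rank1 (tagged l) v)).
  by rewrite (linfun_linear (h0lin l)) vsprojK.
have E_act j l v : lm_act (S j) (vsval (h l v)) =
    lm_act (S j) (E (tag l) (rank1 (tagged l) v)).
  by rewrite hE s_act.
have hh l : is_hom (h l).
  move=> u v; apply: val_inj; rewrite regmod_actE /=.
  apply/eqP; rewrite -subr_eq0; apply/eqP/UJ.
    by rewrite memvB ?subvsP // subalgM ?subvsP.
  move=> j; rewrite lm_actB lm_actM !E_act.
  case: (eqVneq j (tag l)) => [->|jl]; last first.
    by rewrite !(proj2 (EP (tag l) _)) // comp_lfun0r subrr.
  rewrite !(proj1 (EP _ _)); apply/eqP; rewrite subr_eq0; apply/eqP/lfunP => w.
  rewrite comp_lfunE !rank1E lfunZ.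
  by rewrite -[lm_act (T l) u v]/(lm_act (S (tag l)) (sub_incl U u) v) sub_inclE.
pose F l : submod (regmod (salg U)) := submod_img (submodT _) (@hh l).
apply: (@atom_semisimple _ _ _ L F) => [l|]; first exact: atom_img.
apply/eqP; rewrite eqEsubv subvf /=; apply/subvP => x _.
pose G i (c : 'I_(dim (S i))) : L := Tagged (fun i => 'I_(dim (S i))) c.
(* [x] is the sum of its columns; the equality is tested on all [S j], whose common annihilator
   meets [U] in zero. *)
have -> : x = \sum_l h l (lm_act (S (tag l)) (vsval x) (bvec (tagged l))).
  apply: val_inj; rewrite /= linear_sum /=.
  apply/eqP; rewrite -subr_eq0; apply/eqP/UJ.
    by rewrite memvB ?subvsP //; apply: memv_suml => l _; apply: subvsP.
  move=> j; rewrite lm_actB lm_act_sum; apply/eqP; rewrite subr_eq0; apply/eqP.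
  rewrite (eq_bigr (fun l => lm_act (S j) (E (tag l) (rank1 (tagged l)
    (lm_act (S (tag l)) (vsval x) (bvec (tagged l))))))); last by move=> l _; apply: E_act.
  rewrite (sum_tagged (fun i (c : 'I_(dim (S i))) =>
    lm_act (S j) (E i (rank1 c (lm_act (S i) (vsval x) (bvec c)))))).
  rewrite (bigD1 j) //= [X in _ + X]big1 ?addr0 => [|i ij]; last first.
    by rewrite big1 // => c _; rewrite (proj2 (EP i _)) // eq_sym.
  rewrite [LHS]lfun_rank1_sum; apply: eq_bigr => c _.
  by rewrite (proj1 (EP _ _)).
apply: memv_suml => l _; apply: (subvP (sumv_sup l isT (subvv _))).
by rewrite /= mem_limg.
Qed.

(** A semisimple [V] containing the complement [U] meets [J] in zero, so the radical component of
    each of its elements vanishes. *)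
Lemma maximal_semisimpleP (U : subalg A) :
  maximal_semisimple_subalg U <-> (U :&: J = 0)%VS /\ (U + J = fullv)%VS.
Proof.
split=> [[ssU maxU] | [UJ0 UJT]].
  have [V [UV VJ0 VJT]] := wedderburn_malcev ssU.
  by rewrite -(maxU V (rad_complement_semisimple VJ0 VJT) UV).
split; first exact: rad_complement_semisimple.
move=> V ssV UV; have VJ0 := semisimple_rad0 ssV.
apply/eqP; rewrite eqEsubv UV andbT; apply/subvP => x Vx.
have : x \in (U + J)%VS by rewrite UJT memvf.
case/memv_addP => u Uu [j Jj xuj].
suff j0 : j = 0 by rewrite xuj j0 addr0.
apply/eqP; rewrite -memv0 -VJ0 memv_cap Jj andbT.
have -> : j = x - u by rewrite xuj addrC addKr.
by rewrite memvB // (subvP UV).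
Qed.

Lemma strongP (B : subalg A) : strong B <->
  exists U : subalg A, [/\ (U <= B)%VS, (U :&: J = 0)%VS & (U + J = fullv)%VS].
Proof.
split=> [[U /maximal_semisimpleP[UJ0 UJT] UB] | [U [UB UJ0 UJT]]]; exists U => //.
exact/maximal_semisimpleP.
Qed.

End MaximalSemisimple.

(** * Subalgebras that map onto the semisimple quotient *)

Section SurjectiveSubalgebra.
Variables (k : closedFieldType) (A : falgType k) (I I' : finType).
Variables (S : I -> lmodule A) (B : subalg A) (T : I' -> lmodule (salg B)).
Hypotheses (rS : simple_reps S) (rT : simple_reps T).

(** Fed with the ground field as semisimple subalgebra, the relative theorem yields a complement of
    the radical with no prescribed part. *)
Lemma one_semisimple (C : falgType k) (e : subalg C) :
  (e <= 1)%VS -> semisimple_subalg e.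
Proof.
move=> e1; apply: (@atom_semisimple _ _ _ unit (fun _ => submodT _)) => [_ X _|].
  case: (eqVneq (X : {vspace _}) 0%VS) => [|X0]; [by left | right].
  apply/eqP; rewrite eqEsubv subvf /=; rewrite -(geq_leqif (dimv_leqif_sup (subvf X))).
  rewrite (@leq_trans 1%N) ?lt0n ?dimv_eq0 //.
  rewrite dimvf -[dim _]/(\dim e); apply: leq_trans (dimvS e1) _.
  by rewrite dimv1.
by rewrite (big_pred1 tt) // => -[].
Qed.

(** The radical of [B] is [B :&: rad S]: simple [A]-modules stay simple over [B], and conversely
    [1 - n] is invertible in [B] for [n] in [B :&: rad S]. So a complement [U0] of the radical in
    [B] is also one in [A]. *)
Lemma strong_of_surj : (B + rad S = fullv)%VS -> strong B.
Proof.
move=> BJT; have [sS iS allS] := rS; have [sT iT allT] := rT.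
pose k1 : subalg (salg B) := @Subalg k (salg B) (1%AS : {aspace salg B})
  (memv_line 1).
have ss1 : semisimple_subalg k1 by apply: one_semisimple.
have [U0 [_ UJ0 UJT]] := wedderburn_malcev rT ss1.
pose U := (sub_incl B @: U0)%VS.
have UE x : x \in (U0 : {vspace _}) -> vsval x \in U.
  by move=> Ux; rewrite -sub_inclE memv_img.
have U1 : 1 \in U by rewrite -(ah_one (sub_incl B)) memv_img // sa_one.
have UM x y : x \in U -> y \in U -> x * y \in U.
  move=> /memv_imgP[x' Ux ->] /memv_imgP[y' Uy ->].
  by rewrite -ah_mul memv_img // subalgM.
have decomp a : exists b : salg B, a - vsval b \in rad S.
  have : a \in (B + rad S)%VS by rewrite BJT memvf.
  case/memv_addP => b Bb [j Jj ->]; exists (vsproj B b).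
  by rewrite vsprojK // addrC addKr.
have radBS x : x \in rad T -> vsval x \in rad S.
  move=> /radP Tx; apply/radP => i.
  have si : simple (resmod (sub_incl B) (S i)).
    apply: resmod_simple => // a; have [b ab] := decomp a; exists b.
    by rewrite sub_inclE; apply/esym/eqP; rewrite -subr_eq0 -lm_actB; apply/eqP;
      move: ab => /radP; apply.
  have [j /misoP[f [hf fi _]]] := allT _ si.
  apply/lfunP => v; rewrite zero_lfunE; apply: fi; rewrite lfun0.
  rewrite -sub_inclE -[lm_act _ _ _]/(lm_act (resmod (sub_incl B) (S i)) x v) hf.
  by rewrite Tx zero_lfunE.
have radSB x : vsval x \in rad S -> x \in rad T.
  move=> Jx; apply/radP => j; apply/lfunP => v; rewrite zero_lfunE.
  apply: NNPP => xv0.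
  (* As [x v] is nonzero, this submodule must be all of [T j]; then [v = n v] for some [n] in the
     radical of [A], and invertibility of [1 - n] gives [v = 0]. *)
  pose N := (act_at v @: (sub_incl B @^-1: rad S))%VS.
  have hN : stable_space N.
    move=> b _ /memv_imgP[c Nc ->]; rewrite act_atE -actM -act_atE memv_img //.
    by rewrite -memv_preim ah_mul radMl // memv_preim.
  have [_ /(_ (stable_submod hN))/=[N0|NT]] := sT j.
    case: xv0; apply/eqP; rewrite -act_atE -memv0 -N0 memv_img //.
    by rewrite -memv_preim sub_inclE.
  have /memv_imgP[n Nn vn] : v \in N by rewrite NT memvf.
  rewrite -memv_preim sub_inclE in Nn; rewrite act_atE in vn.
  have [b bn] := rad_left_inv sS allS Nn.
  (* The left inverse [b] is only known to lie in [A]; it makes multiplication by [1 - n] injective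
     on the finite-dimensional [B], hence surjective, which yields an inverse in [B]. *)
  have inj : injective (amull (1 - n)).
    apply/lker0_inj/eqP; rewrite -subv0; apply/subvP => y; rewrite memv_ker amullE => /eqP y0.
    rewrite memv0 -[y == 0]/(vsval y == 0) -[vsval y]mul1r -bn -mulrA.
    have -> : (1 - vsval n) * vsval y = vsval ((1 - n) * y).
      by rewrite -!sub_inclE ah_mul lfunB ah_one.
    by rewrite y0 mulr0.
  have surj : limg (amull (1 - n)) = fullv.
    apply/eqP; rewrite eqEsubv subvf /= -(geq_leqif (dimv_leqif_sup (subvf _))).
    by rewrite limg_dim_eq // (proj2 (lker0_inj _) inj) capv0.
  have /limg_fullP/(_ 1)[c] := surj; rewrite amullE => nc.
  have cn : c * (1 - n) = 1.
    by apply: inj; rewrite !amullE mulrA nc mul1r mulr1.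
  case: xv0; have v0 : v = 0; last by rewrite v0 lfun0.
  by rewrite -(act1 v) -cn actM actB act1 -vn subrr lfun0.
apply/(strongP rS); exists (build_subalg U1 UM); split=> /=.
- by apply/subvP => _ /memv_imgP[x _ ->]; rewrite sub_inclE subvsP.
- apply/eqP; rewrite -subv0; apply/subvP => _ /memv_capP[/memv_imgP[x Ux ->]].
  rewrite sub_inclE => /radSB Jx; have : x \in (U0 :&: rad T)%VS by rewrite memv_cap Ux.
  by rewrite UJ0 memv0 => /eqP->; rewrite mem0v.
apply/vspaceP => a; rewrite memvf; have [b ab] := decomp a.
have : b \in (U0 + rad T)%VS by rewrite UJT memvf.
case/memv_addP => u Uu [j Jj bE].
have -> : a = vsval u + (vsval j + (a - vsval b)).
  by rewrite addrA -[_ + vsval j]/(vsval (u + j)) -bE addrC subrK.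
by apply: memv_add; [apply: UE | apply: memvD => //; apply: radBS].
Qed.

End SurjectiveSubalgebra.

(** * Induction and strength of tensor products *)

Section Presentations.
Variable k : fieldType.

Fact id_hom_one (A : falgType k) : (\1%VF : 'End(A)) 1 = 1.
Proof. exact: id_lfunE. Qed.
Fact id_hom_mul (A : falgType k) (x y : A) :
  (\1%VF : 'End(A)) (x * y) = (\1%VF : 'End(A)) x * (\1%VF : 'End(A)) y.
Proof. by rewrite !id_lfunE. Qed.
Definition id_hom (A : falgType k) : alghom A A :=
  AlgHom (@id_hom_one A) (@id_hom_mul A).
Fact id_homK (A : falgType k) : cancel (id_hom A) (id_hom A).
Proof. by move=> x; rewrite !id_lfunE. Qed.
Definition id_iso (A : falgType k) : algiso A A := AlgIso (@id_homK A) (@id_homK A).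

Section Bijective.
Variables (C D : falgType k) (h : alghom C D).
Hypotheses (hi : injective h) (hs : limg h = fullv).

Let hV d : h ((h^-1)%VF d) = d.
Proof. by rewrite limg_lfunVK // hs memvf. Qed.
Fact bij_inv_one : (h^-1)%VF 1 = 1.
Proof. by apply: hi; rewrite hV ah_one. Qed.
Fact bij_inv_mul x y : (h^-1)%VF (x * y) = (h^-1)%VF x * (h^-1)%VF y.
Proof. by apply: hi; rewrite ah_mul !hV. Qed.
Definition bij_inv : alghom D C := AlgHom bij_inv_one bij_inv_mul.
Fact bij_homK : cancel h bij_inv.
Proof. by move=> x; apply: hi; rewrite hV. Qed.
Definition bij_iso : algiso C D := AlgIso bij_homK hV.
End Bijective.

Variables (A A' : falgType k) (B : subalg A) (B' : subalg A').
Notation BB := (tensalg (salg B) (salg B')).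
Notation B2 := (salg (tens_subalg B B')).

Lemma tens_incl_inj : injective (tens_incl B B').
Proof. by apply: tmap_inj => x y; rewrite !lfunE => /val_inj. Qed.

Definition theta_fun (X : BB) : B2 := vsproj (tens_subalg B B') (tens_incl B B' X).

Lemma theta_linear : linear theta_fun.
Proof. by move=> c X Y; rewrite /theta_fun !linearP. Qed.

Lemma val_theta_fun X : vsval (theta_fun X) = tens_incl B B' X.
Proof. by rewrite vsprojK //= mem_limg. Qed.

Definition theta_lfun : 'Hom(BB, B2) := linfun theta_fun.

Lemma val_theta X : vsval (theta_lfun X) = tens_incl B B' X.
Proof. by rewrite (linfun_linear theta_linear) val_theta_fun. Qed.

Fact theta_one : theta_lfun 1 = 1.
Proof.
apply: val_inj; apply: (etrans (val_theta 1)).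
apply: etrans (esym (salg1 (tens_subalg B B'))).
by rewrite -[1 : BB]/(tens 1 1) tens_inclE !salg1.
Qed.

Fact theta_mul X Y : theta_lfun (X * Y) = theta_lfun X * theta_lfun Y.
Proof.
apply: val_inj; apply: (etrans (val_theta _)); rewrite tens_inclM.
by rewrite -[RHS]/(vsval (theta_lfun X) * vsval (theta_lfun Y)) !val_theta.
Qed.

Definition theta_hom : alghom BB B2 := AlgHom theta_one theta_mul.

Fact theta_inj : injective theta_hom.
Proof. by move=> X Y /(congr1 vsval); rewrite !val_theta => /tens_incl_inj. Qed.
Fact theta_surj : limg theta_hom = fullv.
Proof.
apply/limg_fullP => y; have /memv_imgP[X _ yX] := subvsP y.
by exists X; apply: val_inj; apply: (etrans (val_theta _)).
Qed.
Definition theta : algiso BB B2 := bij_iso theta_inj theta_surj.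

Lemma thetaE X : vsval (theta X) = tens_incl B B' X.
Proof. exact: val_theta. Qed.

Notation BBop := (tensalg (oppalg (salg B)) (oppalg (salg B'))).

Lemma tensalg_op_mul (X Y : BBop) : X * Y = (Y : BB) * (X : BB).
Proof.
move: X; apply: tensor_extf => [c X X' | c X X' | a a'].
- by rewrite mulrDl -scalerAl.
- by rewrite [LHS](@mulrDr BB) -(@scalerAr k BB).
move: Y; apply: tensor_extf => [c Y Y' | c Y Y' | b b'].
- by rewrite mulrDr -scalerAr.
- by rewrite [LHS](@mulrDl BB) -(@scalerAl k BB).
by rewrite [LHS]tensalg_mulE [RHS](@tensalg_mulE k (salg B) (salg B')).
Qed.

Definition thetaop_lfun : 'Hom(BBop, oppalg B2) := theta_lfun.
Fact thetaop_one : thetaop_lfun 1 = 1. Proof. exact: theta_one. Qed.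
Fact thetaop_mul X Y : thetaop_lfun (X * Y) = thetaop_lfun X * thetaop_lfun Y.
Proof. by rewrite tensalg_op_mul; apply: theta_mul. Qed.
Definition thetaop_hom : alghom BBop (oppalg B2) := AlgHom thetaop_one thetaop_mul.
Definition thetaop : algiso BBop (oppalg B2) :=
  @bij_iso BBop (oppalg B2) thetaop_hom theta_inj theta_surj.

Lemma rreg_tmod : miso (tmod thetaop (rreg B) (rreg B')) (rreg (tens_subalg B B')).
Proof.
have E (b : oppalg B2) X : lm_act (rreg (tens_subalg B B')) b X =
    (X : tensalg A A') * vsval (b : B2) by apply: amulrE.
pose f : 'Hom(tmod thetaop (rreg B) (rreg B'), rreg (tens_subalg B B')) :=
  (\1%VF : 'End(tensalg A A')).
have fE X : f X = X by apply: id_lfunE.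
exists f; last by exists id.
have main b b' (X : tensalg A A') :
    tmap (lm_act (rreg B) b) (lm_act (rreg B') b') X =
    X * tens (vsval (b : salg B)) (vsval (b' : salg B')) :> tensalg A A'.
  move: X; apply: tensor_extf => [c X Y | c X Y | a a'].
  - by rewrite lfunD lfunZ.
  - by rewrite mulrDl -scalerAl.
  by rewrite tmapE [RHS]tensalg_mulE; congr tens; apply: amulrE.
apply: (pres_hom (t := thetaop)) => b X; rewrite !fE E.
  rewrite inclE tmod_act main; congr (_ * _).
  by rewrite -[RHS]/(vsval (theta_lfun (tens b 1))) val_theta tens_inclE.
rewrite incrE tmod_act main; congr (_ * _).
by rewrite -[RHS]/(vsval (theta_lfun (tens 1 b))) val_theta tens_inclE.
Qed.

Lemma projective_rreg :
  projective (rreg B) -> projective (rreg B') -> projective (rreg (tens_subalg B B')).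
Proof.
by move=> pB pB'; apply: miso_projective rreg_tmod _; apply: projective_tmod.
Qed.

End Presentations.

Section Shuffle.
Variables (k : fieldType) (V1 V2 W1 W2 : vectType k).

(* (v1 (x) v2) (x) (w1 (x) w2) |-> (v1 (x) w1) (x) (v2 (x) w2) *)
Definition shuffle :
    'Hom(tensor (tensor V1 V2) (tensor W1 W2), tensor (tensor V1 W1) (tensor V2 W2)) :=
  tlift (fun X Y =>
    tlift (fun v1 v2 => tmap (tens_lfun W1 v1) (tens_lfun W2 v2)) X Y).

Lemma tens_lfun_linear (V W : vectType k) : linear (@tens_lfun k V W).
Proof.
move=> c v v'; apply/lfunP => w.
by rewrite add_lfunE scale_lfunE !tens_lfunE tensDl tensZl.
Qed.

Lemma shuffleE v1 v2 w1 w2 :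
  shuffle (tens (tens v1 v2) (tens w1 w2)) = tens (tens v1 w1) (tens v2 w2).
Proof.
rewrite /shuffle tliftE => [| Y c X X' | X c Y Y']; last 2 first.
- by rewrite lfunD lfunZ add_lfunE scale_lfunE.
- by rewrite lfunD lfunZ.
rewrite tliftE ?tmapE ?tens_lfunE // => [x | x] c y z; rewrite tens_lfun_linear.
  exact: tmap_linearl.
exact: tmap_linearr.
Qed.

End Shuffle.

Lemma tens4_memv (k : fieldType) (V1 V2 W1 W2 E : vectType k)
    (g : tensor (tensor V1 V2) (tensor W1 W2) -> E) (U : {vspace E}) :
  linear g ->
  (forall v1 v2 w1 w2, g (tens (tens v1 v2) (tens w1 w2)) \in U) -> forall X, g X \in U.
Proof.
move=> lg gU; apply: tens_memv => // X Y.
move: X; apply: tens_memv => [c x y | v1 v2]; first by rewrite tens_linearl lg.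
move: Y; apply: tens_memv => [c x y | w1 w2]; first by rewrite tens_linearr lg.
exact: gU.
Qed.

Lemma tens4_ext (k : fieldType) (V1 V2 W1 W2 E : vectType k)
    (f g : 'Hom(tensor (tensor V1 V2) (tensor W1 W2), E)) :
  (forall v1 v2 w1 w2, f (tens (tens v1 v2) (tens w1 w2)) =
                       g (tens (tens v1 v2) (tens w1 w2))) -> f =1 g.
Proof.
move=> fg X; apply/eqP; rewrite -subr_eq0 -memv0; move: X.
apply: tens4_memv => [c X Y | v1 v2 w1 w2].
  by rewrite !(lfunD, lfunZ) scalerBr opprD addrACA.
by rewrite fg subrr mem0v.
Qed.

Lemma shuffleK (k : fieldType) (V1 V2 W1 W2 : vectType k) :
  cancel (@shuffle k V1 V2 W1 W2) (@shuffle k V1 W1 V2 W2).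
Proof.
move=> X; rewrite -comp_lfunE -[RHS]id_lfunE; move: X.
by apply: tens4_ext => v1 v2 w1 w2; rewrite comp_lfunE !shuffleE id_lfunE.
Qed.

Lemma mem_preim (k : fieldType) (V W : vectType k) (g : 'Hom(V, W)) (U : {vspace W}) v :
  g v \in U -> v \in (g @^-1: U)%VS.
Proof. by rewrite memv_preim. Qed.

(** * Induction commutes with tensor products *)

Section InducedTensor.
Variables (k : fieldType) (A A' : falgType k) (B : subalg A) (B' : subalg A').
Variables (L : lmodule (salg B)) (L' : lmodule (salg B')).
Notation idt := (id_iso (tensalg A A')).
Notation th := (theta B B').
Let L2 := tmod th L L'.

Let sh : 'Hom(ext_mod L2, tmod idt (ext_mod L) (ext_mod L')) := shuffle A A' L L'.

Lemma shuffle_hom : is_hom sh.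
Proof.
have main a a' X : sh (lm_act (ext_mod L2) (idt (tens a a')) X) =
    lm_act (tmod idt (ext_mod L) (ext_mod L')) (idt (tens a a')) (sh X).
  pose u := lm_act (ext_mod L2) (idt (tens a a')).
  pose w := lm_act (tmod idt (ext_mod L) (ext_mod L')) (idt (tens a a')).
  have /(_ X) : (shuffle A A' L L' \o u)%VF =1 (w \o shuffle A A' L L')%VF; last first.
    by rewrite !comp_lfunE.
  apply: tens4_ext => b b' l l'.
  have mE : idt (tens a a') * tens b b' = tens (a * b) (a' * b').
    have -> : idt (tens a a') = tens a a' by apply: id_lfunE.
    exact: tensalg_mulE.
  rewrite !comp_lfunE shuffleE /w tmod_tens !ext_actE /u.
  have -> : lm_act (ext_mod L2) (idt (tens a a')) (tens (tens b b') (tens l l')) =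
    tens (tens (a * b) (a' * b')) (tens l l') by rewrite -mE; apply: ext_actE.
  exact: shuffleE.
by apply: (pres_hom (t := idt)) => a X; rewrite ?inclE ?incrE; apply: main.
Qed.

Let p : 'Hom(ext_mod L, induced L) := subquot_pi (submodT (ext_mod L)) (balance L).
Let p' : 'Hom(ext_mod L', induced L') := subquot_pi (submodT (ext_mod L')) (balance L').

Lemma induced_pi_balance (C : falgType k) (D : subalg C) (M : lmodule (salg D)) a b l :
  subquot_pi (submodT (ext_mod M)) (balance M) (tens (a * vsval b) l) =
  subquot_pi (submodT (ext_mod M)) (balance M) (tens a (lm_act M b l)).
Proof.
apply/eqP; rewrite -subr_eq0 -lfunB; apply/eqP/subquot_pi_eq0.
exact: (proj1 (balanceP _) (subvv (balance_space M))).
Qed.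

Lemma lker_induced_pi (C : falgType k) (D : subalg C) (M : lmodule (salg D)) x :
  subquot_pi (submodT (ext_mod M)) (balance M) x = 0 -> x \in balance_space M.
Proof.
move=> x0; rewrite -[balance_space M]/(sm_space (balance M)).
by rewrite -lker_quot_pi memv_ker x0.
Qed.

Let f : 'Hom(ext_mod L2, tmod idt (induced L) (induced L')) :=
  ((tmap p p' : 'Hom(tmod idt (ext_mod L) (ext_mod L'), tmod idt (induced L) (induced L')))
     \o sh)%VF.

Let fE X : f X = tmap p p' (sh X).
Proof. exact: comp_lfunE. Qed.

(** The balancing relations of [B] and [B'] are those of [b (x) 1] and [1 (x) b'], which gives one
    inclusion after undoing the shuffle. For the other, the two projections absorb the relation of
    [b (x) b'], and these elements span [B (x) B']. *)
Lemma lker_induced : lker f = balance_space L2.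
Proof.
have bal X b Y : (tens (X * vsval b) Y - tens X (lm_act L2 b Y) :
    tensor (tensalg A A') L2) \in balance_space L2.
  exact: (proj1 (balanceP _) (subvv (balance_space L2))).
have vth b b' : vsval (th (tens b b')) = tens (vsval b) (vsval b').
  by rewrite thetaE tens_inclE.
apply/eqP; rewrite eqEsubv; apply/andP; split.
  pose sh' := shuffle A L A' L'.
  suff /subvP s : (lker (tmap p p') <= sh' @^-1: balance_space L2)%VS.
    apply/subvP => X; rewrite memv_ker fE -memv_ker => /s; rewrite -memv_preim.
    by rewrite [sh' _](shuffleK X).
  have shE a l a' l' : sh' (tens (tens a l) (tens a' l')) = tens (tens a a') (tens l l').
    exact: shuffleE.
  apply: lker_tmap => y z h0; apply: mem_preim.
    move: z; apply: tens_memv => [c u v | a' l']; first by rewrite tens_linearr linearP.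
    pose g := (sh' \o tens_rfun (tensor A L) (tens a' l'))%VF.
    have gE x : g x = sh' (tens x (tens a' l')) by rewrite comp_lfunE tens_rfunE.
    suff /subvP/(_ y (lker_induced_pi h0)) : (balance_space L <= g @^-1: balance_space L2)%VS.
      by rewrite -gE -memv_preim.
    apply/balanceP => a b l; apply: mem_preim; rewrite lfunB !gE !shE.
    have := bal (tens a a') (th (tens b 1)) (tens l l').
    by rewrite tmod_tens act1 vth salg1 tensalg_mulE mulr1.
  move: y; apply: tens_memv => [c u v | a l]; first by rewrite tens_linearl linearP.
  pose g := (sh' \o tens_lfun (tensor A' L') (tens a l))%VF.
  have gE x : g x = sh' (tens (tens a l) x) by rewrite comp_lfunE tens_lfunE.
  suff /subvP/(_ z (lker_induced_pi h0)) : (balance_space L' <= g @^-1: balance_space L2)%VS.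
    by rewrite -gE -memv_preim.
  apply/balanceP => a' b l'; apply: mem_preim; rewrite lfunB !gE !shE.
  have := bal (tens a a') (th (tens 1 b)) (tens l l').
  by rewrite tmod_tens act1 vth salg1 tensalg_mulE mulr1.
apply/balanceP => X b Y; move: b.
pose G (b : salg (tens_subalg B B')) : ext_mod L2 :=
  tens (X * vsval b) Y - tens X (lm_act L2 b Y).
have Glin : linear G.
  move=> c b b'; rewrite /G actD actZ linearP mulrDr -scalerAr.
  by rewrite tens_linearl tens_linearr scalerBr opprD addrACA.
apply: (pres_memv (t := th) Glin) => b b'; rewrite /G incl_incr vth memv_ker fE.
rewrite -memv0 {G Glin}; move: X.
apply: tens_memv => [c x y | a a'].
  rewrite mulrDl -scalerAl !tensDl !tensZl -!lfunZ -!lfunD; congr (tmap _ _ (sh _)).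
  by rewrite scalerBr opprD addrACA.
move: Y; apply: tens_memv => [c x y | l l'].
  rewrite [lm_act L2 _ (c *: x + y)]lfunD [lm_act L2 _ (c *: x)]lfunZ.
  rewrite !tensDr !tensZr -!lfunZ -!lfunD; congr (tmap _ _ (sh _)).
  by rewrite scalerBr opprD addrACA.
rewrite tmod_tens tensalg_mulE !lfunB.
have shE a1 l1 a2 l2 : sh (tens (tens a1 a2) (tens l1 l2)) = tens (tens a1 l1) (tens a2 l2).
  exact: shuffleE.
by rewrite !shE !tmapE !induced_pi_balance subrr mem0v.
Qed.

Lemma induced_tmod :
  miso (induced L2) (tmod idt (induced L) (induced L')).
Proof.
apply: (@quot_iso _ _ (ext_mod L2) (balance L2) _ f); last exact: lker_induced.
  by apply: is_hom_comp shuffle_hom _; apply: tmap_hom; apply: quot_pi_hom.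
apply/limg_fullP => Y.
have /limg_fullP/(_ Y)[X <-] := tmap_surj (subquot_pi_full (submodT (ext_mod L)) (balance L))
  (subquot_pi_full (submodT (ext_mod L')) (balance L')).
by exists (shuffle A L A' L' X); rewrite fE [sh _]shuffleK.
Qed.

End InducedTensor.

(** * Radical and strength of a tensor product *)

Section StrongTensor.
Variables (k : closedFieldType) (A A' : falgType k) (I I' : finType).
Variables (S : I -> lmodule A) (S' : I' -> lmodule A').
Hypotheses (rS : simple_reps S) (rS' : simple_reps S').
Hypothesis rS2 : simple_reps (tens_simples S S').
Notation J := (rad S).
Notation J' := (rad S').
Notation J2 := (rad (tens_simples S S')).

Lemma tensmod_act_tens (M : lmodule A) (M' : lmodule A') a a' :
  lm_act (tensmod M M') (tens a a') = tmap (lm_act M a) (lm_act M' a').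
Proof. by apply: tensor_ext => v w; rewrite [LHS]tensmod_actE tmapE. Qed.

Lemma tmap_act_at (M : lmodule A) (M' : lmodule A') v v' (X : tensalg A A') :
  tmap (act_at v) (act_at v') X = lm_act (tensmod M M') X (tens v v').
Proof.
move: X; apply: tensor_extf => [||a a']; first exact: linearP.
  exact: (@act_linear _ _ (tensmod M M')).
by rewrite tmapE tensmod_act_tens tmapE !act_atE.
Qed.

Lemma rad_tens_l a a' : a \in J -> (tens a a' : tensalg A A') \in J2.
Proof.
move/radP => Ja; apply/radP => x; rewrite tensmod_act_tens Ja.
by apply: tensor_ext => v w; rewrite tmapE !zero_lfunE tens0l.
Qed.

Lemma rad_tens_r a a' : a' \in J' -> (tens a a' : tensalg A A') \in J2.
Proof.
move/radP => Ja; apply/radP => x; rewrite tensmod_act_tens Ja.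
by apply: tensor_ext => v w; rewrite tmapE !zero_lfunE tens0r.
Qed.

(** The functional applied to [A'] is a coordinate of [a' |-> a' v'], so the resulting element of
    [A] sends [v] to the contraction of [X (v (x) v')], which is zero. *)
Lemma rad_ctrr i' (v' : S' i') j (X : tensalg A A') :
  X \in J2 -> ctrr A j (tmap \1%VF (act_at v') X) \in J.
Proof.
move/radP => JX; apply/radP => i; apply/lfunP => v.
rewrite -act_atE -ctrr_tmap -tmap_lr tmap_act_at.
by rewrite -[tensmod _ _]/(tens_simples S S' (i, i')) JX !zero_lfunE lfun0.
Qed.

Lemma rad_ctrl i (v : S i) j (X : tensalg A A') :
  X \in J2 -> ctrl A' j (tmap (act_at v) \1%VF X) \in J'.
Proof.
move/radP => JX; apply/radP => i'; apply/lfunP => v'.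
rewrite -act_atE -ctrl_tmap -tmap_rl tmap_act_at.
by rewrite -[tensmod _ _]/(tens_simples S S' (i, i')) JX !zero_lfunE lfun0.
Qed.

Lemma tens_subspace_ind (E : vectType k) (B : subalg A) (B' : subalg A')
    (g : 'Hom(tensor A A', E)) (U : {vspace E}) :
  (forall b b', b \in (B : {vspace A}) -> b' \in (B' : {vspace A'}) ->
     g (tens b b') \in U) ->
  forall X, X \in tens_subspace B B' -> g X \in U.
Proof.
move=> gU _ /memv_imgP[Y _ ->]; move: Y.
apply: tens_memv => [c x y | b b']; first by rewrite !linearP.
by rewrite tens_inclE gU ?subvsP.
Qed.

Lemma mem_tens_subspace (B : subalg A) (B' : subalg A') b b' :
  b \in (B : {vspace A}) -> b' \in (B' : {vspace A'}) ->
  (tens b b' : tensalg A A') \in tens_subspace B B'.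
Proof.
move=> Bb Bb'; apply/memv_imgP; exists (tens (vsproj B b) (vsproj B' b')).
  exact: memvf.
by rewrite tens_inclE !vsprojK.
Qed.

(** The coordinate [j] of [a |-> a v] is then a functional on [C] that is nonzero at [1]; it
    normalises the contractions in the converse below. *)
Lemma ex_simple_vector (C : falgType k) (L : finType) (T : L -> lmodule C) :
  simple_reps T -> exists i (v : T i) j, v2r v 0 j != 0.
Proof.
case=> sT _ allT.
have [|i _] := @ex_simple_sub _ _ _ _ allT (regmod C) (submodT _).
  move=> /vspaceP/(_ (1 : C)); rewrite memvf memv0 => /esym/eqP one0.
  by have := oner_neq0 C; rewrite one0 eqxx.
by have [v /coord_neq0[j vj]] := simple_neq0 (sT i); exists i, v, j.
Qed.

Lemma strong_tens (B : subalg A) (B' : subalg A') :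
  strong B -> strong B' -> strong (tens_subalg B B').
Proof.
move=> /(strongP rS)[U [/subvP UB UJ0 UJT]] /(strongP rS')[U' [/subvP UB' UJ0' UJT']].
apply/(strongP rS2); exists (tens_subalg U U'); split=> /=.
- apply/subvP => X UX; rewrite -[X]id_lfunE; move: X UX.
  apply: tens_subspace_ind => b b' Ub Ub'; rewrite id_lfunE.
  by apply: mem_tens_subspace; [apply: UB | apply: UB'].
- apply/eqP; rewrite -subv0; apply/subvP => X /memv_capP[UX JX]; rewrite memv0.
  (* Acting on [v'] and contracting leads into [U :&: J], which is zero. Hence each [ctrl] of [X]
     kills every vector of every [S' i'], so it lies in [U' :&: J']. *)
  have X0 i' (v' : S' i') : tmap \1%VF (act_at v') X = 0.
    apply: ctrr_eq => j; rewrite lfun0; apply/eqP; rewrite -memv0 -UJ0 memv_cap.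
    rewrite rad_ctrr // andbT -comp_lfunE; apply: tens_subspace_ind UX => u u' Uu _.
    by rewrite comp_lfunE tmapE ctrrE id_lfunE memvZ.
  apply/eqP; apply: ctrl_eq => j; rewrite lfun0; apply/eqP.
  rewrite -memv0 -UJ0' memv_cap; apply/andP; split.
    by apply: tens_subspace_ind UX => u u' _ Uu'; rewrite ctrlE memvZ.
  apply/radP => i'; apply/lfunP => v'.
  by rewrite -act_atE -ctrl_tmap X0 lfun0 zero_lfunE.
apply/vspaceP => X; rewrite memvf.
move: X; apply: (@tens_memv _ _ _ _ id) => // a a'.
have : a \in (U + J)%VS by rewrite UJT memvf.
case/memv_addP => u Uu [j Jj ->].
have : a' \in (U' + J')%VS by rewrite UJT' memvf.
case/memv_addP => u' Uu' [j' Jj' ->].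
rewrite tensDr tensDl -addrA; apply: memv_add; first exact: mem_tens_subspace.
by apply: memvD; [apply: rad_tens_l | apply: rad_tens_r].
Qed.

Lemma strong_tens_inv (L L' : finType) (B : subalg A) (B' : subalg A')
    (T : L -> lmodule (salg B)) (T' : L' -> lmodule (salg B')) :
  simple_reps T -> simple_reps T' -> strong (tens_subalg B B') -> strong B /\ strong B'.
Proof.
move=> rT rT' /(strongP rS2)[U [/subvP /= UB _ UJT]].
have decomp X : exists2 Y, Y \in tens_subspace B B' & X - Y \in J2.
  have : X \in (U + J2)%VS by rewrite UJT memvf.
  case/memv_addP => u Uu [j Jj ->]; exists u; first exact: UB.
  by rewrite addrC addKr.
have [i [v [c vc]]] := ex_simple_vector rS.
have [i' [v' [c' vc']]] := ex_simple_vector rS'.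
split.
  apply: (strong_of_surj rS rT); apply/vspaceP => a; rewrite memvf.
  have [Y BY JY] := decomp (tens a 1).
  (* [g] sends [a (x) 1] to a nonzero multiple of [a], [B (x) B'] into [B], and the radical into
     [J]. *)
  pose g := (ctrr A c' \o tmap \1 (act_at v'))%VF : 'Hom(tensor A A', A).
  have gE X : g X = ctrr A c' (tmap \1%VF (act_at v') X) by apply: comp_lfunE.
  have gT b b' : g (tens b b') = v2r (lm_act (S' i') b' v') 0 c' *: b.
    by rewrite gE tmapE ctrrE id_lfunE act_atE.
  have gB : g Y \in (B : {vspace A}).
    by apply: tens_subspace_ind BY => b b' Bb _; rewrite gT memvZ.
  have gJ : g (tens a 1 - Y) \in J by rewrite gE; apply: rad_ctrr.
  have -> : a = (v2r v' 0 c')^-1 *: (g Y + g (tens a 1 - Y)).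
    by rewrite -lfunD addrC subrK gT act1 scalerA mulVf // scale1r.
  by apply/memvZ/memv_add.
apply: (strong_of_surj rS' rT'); apply/vspaceP => a; rewrite memvf.
have [Y BY JY] := decomp (tens 1 a).
pose g := (ctrl A' c \o tmap (act_at v) \1)%VF : 'Hom(tensor A A', A').
have gE X : g X = ctrl A' c (tmap (act_at v) \1%VF X) by apply: comp_lfunE.
have gT b b' : g (tens b b') = v2r (lm_act (S i) b v) 0 c *: b'.
  by rewrite gE tmapE ctrlE id_lfunE act_atE.
have gB : g Y \in (B' : {vspace A'}).
  by apply: tens_subspace_ind BY => b b' _ Bb; rewrite gT memvZ.
have gJ : g (tens 1 a - Y) \in J' by rewrite gE; apply: rad_ctrl.
have -> : a = (v2r v 0 c)^-1 *: (g Y + g (tens 1 a - Y)).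
  by rewrite -lfunD addrC subrK gT act1 scalerA mulVf // scale1r.
by apply/memvZ/memv_add.
Qed.

End StrongTensor.

Lemma miso_simple_reps (k : fieldType) (A : falgType k) (I : finType)
    (S T : I -> lmodule A) :
  (forall i, miso (S i) (T i)) -> simple_reps S -> simple_reps T.
Proof.
move=> ST [sS iS allS]; split=> [i | i j Tij | M sM].
- exact: miso_simple (ST i) (sS i).
- by apply: iS; apply: miso_trans (ST i) (miso_trans Tij (miso_sym (ST j))).
by have [i Mi] := allS M sM; exists i; apply: miso_trans Mi (ST i).
Qed.

Lemma miso_quasi_hereditary_for (k : fieldType) (A : falgType k) (I : finType)
    (S T Q : I -> lmodule A) (le : rel I) :
  (forall i, miso (S i) (T i)) ->
  quasi_hereditary_for S Q le -> quasi_hereditary_for T Q le.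
Proof.
move=> ST [rS ole cQ eD fQ]; split=> //; first exact: miso_simple_reps ST rS.
by move=> i; apply: miso_projective_cover (ST i) (cQ i).
Qed.

Lemma tmod_id (k : fieldType) (A A' : falgType k) (M : lmodule A) (M' : lmodule A') :
  miso (tmod (id_iso (tensalg A A')) M M') (tensmod M M').
Proof.
exists \1%VF; last by exists id => v; rewrite id_lfunE.
move=> X v; rewrite !id_lfunE.
by rewrite -[LHS]/(lm_act (tensmod M M') (id_hom (tensalg A A') X) v) [id_hom _ _]id_lfunE.
Qed.

Lemma exact_borel_tens (k : closedFieldType) (A A' : falgType k)
    (I I' : finType) (S : I -> lmodule A) (S' : I' -> lmodule A')
    (le : rel I) (le' : rel I') (B : subalg A) (B' : subalg A') :
  simple_reps S -> simple_reps S' ->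
  exact_borel S le B -> exact_borel S' le' B' ->
  exact_borel (tens_simples S S') (prod_le le le') (tens_subalg B B').
Proof.
move=> rS rS' [pB [J [T [phi [rT bphi [Q cQ iQ] [QT qT sT]]]]]].
move=> [pB' [J' [T' [phi' [rT' bphi' [Q' cQ' iQ'] [QT' qT' sT']]]]]].
split; first exact: projective_rreg.
exists (J * J')%type, (fun x => tmod (theta B B') (T x.1) (T' x.2)).
exists (fun x => (phi x.1, phi' x.2)); split.
- exact: simple_reps_tmod.
- have [g gK Kg] := bphi; have [g' gK' Kg'] := bphi'.
  by exists (fun x => (g x.1, g' x.2)) => -[x x'] /=; rewrite ?gK ?gK' ?Kg ?Kg'.
- exists (fun x => tmod (id_iso (tensalg A A')) (Q x.1) (Q' x.2)).
    move=> [i i']; apply: miso_projective_cover (tmod_id (S i) (S' i')) _.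
    exact: (projective_cover_tmod _ rS rS').
  move=> [j j'] /=; apply: miso_trans (induced_tmod (T j) (T' j')) _.
  apply: miso_trans _ (miso_sym (standard_tmod _ Q Q' le le' (phi j) (phi' j'))).
  exact: tmod_miso.
exists (fun x => tmod (theta B B') (QT x.1) (QT' x.2)).
  exact: (quasi_hereditary_for_tmod (theta B B') qT qT').
move=> [j j'].
apply: miso_simple (miso_sym (standard_tmod (theta B B') QT QT'
  (fun j1 j2 => le (phi j1) (phi j2)) (fun j1 j2 => le' (phi' j1) (phi' j2)) j j')) _.
exact: simple_tmod.
Qed.

Theorem theorem3p2 (k : closedFieldType) (A A' : falgType k)
    (I I' : finType) (S : I -> lmodule A) (S' : I' -> lmodule A')
    (le : rel I) (le' : rel I') (B : subalg A) (B' : subalg A') :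
  quasi_hereditary S le -> quasi_hereditary S' le' ->
  exact_borel S le B -> exact_borel S' le' B' ->
  [/\ quasi_hereditary (tens_simples S S') (prod_le le le'),
      exact_borel (tens_simples S S') (prod_le le le') (tens_subalg B B')
    & strong (tens_subalg B B') <-> strong B /\ strong B'].
Proof.
move=> [Q qQ] [Q' qQ'] bB bB'.
have [rS _ _ _ _] := qQ; have [rS' _ _ _ _] := qQ'.
have q2 : quasi_hereditary_for (tens_simples S S')
    (fun x => tmod (id_iso (tensalg A A')) (Q x.1) (Q' x.2)) (prod_le le le').
  apply: miso_quasi_hereditary_for (quasi_hereditary_for_tmod _ qQ qQ').
  by move=> x; apply: tmod_id.
have [rS2 _ _ _ _] := q2.
split; first by exists (fun x => tmod (id_iso (tensalg A A')) (Q x.1) (Q' x.2)).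
  exact: exact_borel_tens.
split=> [|[sB sB']]; last exact: (strong_tens rS rS' rS2).
(* The Borel data supply representatives of the simple modules of [B] and [B'], through which the
   radicals of these algebras are expressed. *)
have [_ [J [T [phi [rT _ _ _]]]]] := bB; have [_ [J' [T' [phi' [rT' _ _ _]]]]] := bB'.
exact: (strong_tens_inv rS rS' rS2 rT rT').
Qed.
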